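(* Consider the sequence of linear regression models, the random scales $s_n$ with $s_n\to s_0>0$ in probability, the loss $\rho_1$ and the redescending M-estimator $\hat{\boldsymbol\beta}=\arg\min_{\boldsymbol\beta\in\mathbb{R}^p}\sum_{i=1}^n\rho_1\big((y_i-\mathbf{x}_i^T\boldsymbol\beta)/s_n\big)$ described in the context. Assume: (1) $\rho_1$ is a three times continuously differentiable, bounded $\rho$-function with derivative $\psi_1=\rho_1'$; the functions $\psi_1(t),\psi_1'(t),\psi_1''(t),t\psi_1(t),t\psi_1'(t),t\psi_1''(t)$ are bounded; and $\mathbb{E}\psi_1'(u/s_0)>0$. (2) $F_0$ has a density $f_0$ that is even, a monotone decreasing function of $|u|$, and a strictly decreasing function of $|u|$ in a neighbourhood of $0$. (3) There is a constant $M>0$ such that $\frac1n\sum_{i=1}^n\Vert\mathbf{x}_i\Vert^2\le pM$ for all $n$, and a constant $B>0$ such that $\max_{i\le n}\Vert\mathbf{x}_i\Vert\le Bn$ for all $n$. (4) $\tau=\sup_n\rho_{2,n}<\infty$, where $\rho_{2,n}$ is the largest eigenvalue of $\boldsymbol\Sigma_n$. (5) For some $0<\alpha<1$, $\liminf_{n}\eta_n(\alpha)>0$, where $\eta_n(\alpha)=\min_{\mathcal{A}\subset\{1,\dots,n\},\,\#\mathcal{A}=[n\alpha]}\ \min_{\Vert\theta\Vert=1}\ \max_{i\in\mathcal{A}}|\mathbf{x}_i^T\theta|$. (6) For any $c>0$ there are constants $a>0$, $\delta>0$ and $C>0$ such that for all $\boldsymbol\beta\in\mathcal{B}(\delta)$,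 all $\mathbf{z}\in\mathcal{S}^*$ and all $n$, $\sum_{i\in J}(\mathbf{x}_i^T\mathbf{z})^2\ge an$, where $J=I(\boldsymbol\beta,c)\cap I(\mathbf{z},C)$. (7) For any $c>0$ and $\varepsilon>0$ there are constants $\delta'>0$ and $C>0$ such that for all $\boldsymbol\beta\in\mathcal{B}(\delta')$, all $\mathbf{z}\in\mathcal{S}^*$ and all $n$, $\sum_{i\notin J}(\mathbf{x}_i^T\mathbf{z})^2\le\varepsilon n$, where $J=I(\boldsymbol\beta,c)\cap I(\mathbf{z},C)$. (8) $\max_{i\le n}\Vert\mathbf{x}_i\Vert^2=o(n/p^2)$. (9) $(p\log n)/n\to 0$. Let $\mathbf{a}_n\in\mathbb{R}^p$ satisfy $\Vert\mathbf{a}_n\Vert=1$ and let $r_n^2=\mathbf{a}_n^T\boldsymbol\Sigma_n^{-1}\mathbf{a}_n$ (with $r_n>0$). Then $$\sqrt{n}\,r_n^{-1}\,\mathbf{a}_n^T(\hat{\boldsymbol\beta}-\boldsymbol\beta_0)\ \to\ N\left(0,\ s_0^2\,\frac{a(\psi_1)}{b(\psi_1)^2}\right)\quad\text{in distribution as } n\to\infty,$$ where $a(\psi_1)=\mathbb{E}\psi_1^2(u/s_0)$ and $b(\psi_1)=\mathbb{E}\psi_1'(u/s_0)$.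
   Context: Model: for each $n$, $y_i=\mathbf{x}_i^T\boldsymbol\beta_0+u_i$, $1\le i\le n$, where $p=p_n$ may depend on $n$ (and may tend to infinity), $\mathbf{x}_i=\mathbf{x}_{i,n}\in\mathbb{R}^{p}$ are fixed (non-random) vectors, $\boldsymbol\beta_0=\boldsymbol\beta_{0,n}\in\mathbb{R}^{p}$ is the unknown parameter, and $u_i=u_{i,n}$ are i.i.d. random variables defined on a common probability space with distribution function $F_0$ (not depending on $n$); $u$ denotes a generic random variable with distribution $F_0$. The matrix $\boldsymbol\Sigma_n=\frac1n\sum_{i=1}^n\mathbf{x}_i\mathbf{x}_i^T$ is assumed non-singular for all $n$. $s_n$ is a positive random variable defined on the same probability space as the errors, and $s_n\to s_0$ in probability for some constant $s_0>0$. $\hat{\boldsymbol\beta}$ is a (random) minimizer of the displayed objective over $\mathbb{R}^p$, assumed to exist. A function $\rho:\mathbb{R}\to\mathbb{R}$ is called a $\rho$-function if: $\rho$ is even and continuous; $\rho(x)$ is a nondecreasing function of $|x|$; $\rho(0)=0$; if $\rho(v)<\lim_{x\to\infty}\rho(x)$ and $0\le u<v$ then $\rho(u)<\rho(v)$; and, if $\rho$ is bounded, $\lim_{x\to\infty}\rho(x)=1$. For $\mathbf{z}\in\mathbb{R}^p$ and $c>0$, $I(\mathbf{z},c)=\{i\in\{1,\dots,n\}:|\mathbf{x}_i^T\mathbf{z}|\le c\}$. $\mathcal{B}(\delta)$ is the ball in $\mathbb{R}^p$ centered at zero with radius $\delta$, and $\mathcal{S}^*$ is the sphere in $\mathbb{R}^p$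 centered at zero with radius $1$. $[x]$ denotes the integer part of $x$, $\#$ is cardinality, and $\Vert\cdot\Vert$ is the Euclidean norm. *)

(* Defs.v *)
From HB Require Import structures.
From mathcomp Require Export all_boot all_order all_algebra.
From mathcomp Require Export all_classical all_reals all_analysis.
Export Order.TTheory GRing.Theory Num.Theory.
Export numFieldNormedType.Exports.

Set Implicit Arguments.
Unset Strict Implicit.
Unset Printing Implicit Defensive.

Local Open Scope ring_scope.
Local Open Scope classical_set_scope.

(** The library norm [`|v|] on matrices is the sup norm, hence [l2norm]. *)
Definition dotv (R : realType) (p : nat) (v w : 'cV[R]_p) : R :=
  (v^T *m w) 0 0.

Definition l2norm (R : realType) (p : nat) (v : 'cV[R]_p) : R :=
  Num.sqrt (dotv v v).

Definition quad_form (R : realType) (p : nat) (A : 'M[R]_p) (v : 'cV[R]_p) : R :=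
  (v^T *m A *m v) 0 0.

(** A supremum of a finite nonempty set when [A] is symmetric and [0 < p]. *)
Definition largest_eigenvalue (R : realType) (p : nat) (A : 'M[R]_p) : R :=
  sup [set l | eigenvalue A l].

Definition is_argmin (R : realType) (T : Type) (f : T -> R) (b : T) : Prop :=
  forall b', f b <= f b'.

Definition Sigma_mx (R : realType) (n p : nat) (x : 'I_n -> 'cV[R]_p) : 'M[R]_p :=
  n%:R^-1 *: \sum_(i < n) (x i *m (x i)^T).

Definition slab (R : realType) (n p : nat) (x : 'I_n -> 'cV[R]_p)
    (z : 'cV[R]_p) (c : R) : {set 'I_n} :=
  [set i | `|dotv (x i) z| <= c]%SET.

(** Both minima are attained when [0 < p] and [0 <= alpha <= 1]; the maxima
    are of nonnegative numbers, with the convention that it is 0 over the empty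
    set (which only occurs when the integer part of [n * alpha] is 0). *)
Definition eta (R : realType) (n p : nat) (x : 'I_n -> 'cV[R]_p) (alpha : R) : R :=
  inf [set inf [set \big[Num.max/0]_(i in A) `|dotv (x i) theta|
               | theta in [set theta : 'cV[R]_p | l2norm theta = 1]]
      | A in [set A : {set 'I_n} | #|A| = Num.truncn (n%:R * alpha)]].

Definition is_rho_function (R : realType) (rho : R -> R) : Prop :=
  [/\ (forall t, rho (- t) = rho t) /\ continuous rho,
      forall s t, `|s| <= `|t| -> rho s <= rho t,
      rho 0 = 0,
      forall u v,
        ((rho v)%:E < lim ((rho t)%:E @[t --> +oo%R]))%E ->
        0 <= u -> u < v -> rho u < rho v
    & bounded_fun rho -> rho t @[t --> +oo] --> (1 : R)].

Definition continuously_differentiable (R : realType) (k : nat) (f : R -> R) : Prop :=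
  (forall j, (j < k)%N -> forall t, derivable (derive1n j f) t 1) /\ continuous (derive1n k f).

Definition is_density (R : realType) (F f : R -> R) : Prop :=
  [/\ measurable_fun setT f,
      forall t, 0 <= f t
    & forall r, (F r)%:E = (\int[lebesgue_measure]_(t in `]-oo, r]) (f t)%:E)%E].

Definition mutually_independent d (T : measurableType d) (R : realType)
    (P : probability T R) (I : finType) (X : I -> {RV P >-> R}) : Prop :=
  forall (J : {set I}) (A : I -> set R), (forall i, measurable (A i)) ->
    P [set w | forall i, i \in J -> A i (X i w)] =
    (\prod_(i in J) P (X i @^-1` A i))%E.

Definition cvg_in_probability d (T : measurableType d) (R : realType)
    (P : probability T R) (X : nat -> T -> R) (c : R) : Prop :=
  forall e, 0 < e -> P [set w | e <= `|X n w - c|] @[n --> \oo] --> 0%E.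

(** Pointwise convergence of the distribution functions at the continuity
    points of the limiting one. *)
Definition cvg_in_distribution d (T : measurableType d) (R : realType)
    (P : probability T R) (X : nat -> T -> R) (mu : probability (measurableTypeR R) R) : Prop :=
  forall t, {for t, continuous (fun r : R => mu `]-oo, r])} ->
    P [set w | X n w <= t] @[n --> \oo] --> mu `]-oo, t].

(* Main.v *)
From HB Require Import structures.
Require Import Defs.
From mathcomp Require Import measurable_realfun.
From mathcomp Require Import ring lra.

(** Write [b] for the deviation of the estimator from the true parameter; it minimizes
    the loss of the errors [u i] shifted by [dotv (x i) b].

    Since the errors are symmetric and unimodal, a shift increases their mean loss, and
    shifts bounded away from 0 increase it by a fixed amount
    ([mean_translate_gap_unbounded]). The design conditions make a positive proportion
    of the shifts at a parameter of norm [e] at least a multiple of [e]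
    ([design_count]). What is missing for the consistency of [b] is a law of large
    numbers that is uniform over an unbounded set of parameters of growing dimension.
    As the loss is bounded, the shifts may be clamped; up to a small error, the clamped
    shifts at any parameter are those at one of the vertices of an arrangement of
    hyperplanes, of which there are polynomially many in [n] per dimension
    ([arrangement_net]). With [p * ln n = o(n)], the exponential inequality
    [exponential_tail] survives the union bound over these vertices ([consistency]).

    Near the true parameter, the quadratic term of the loss has curvature bounded below
    in every direction, by a second union bound, over a grid of the unit ball, so that
    the norm of [b] is at most a multiple of that of the score; the latter has square
    mean of order [p / n], whence the rate ([rate]).

    In the direction [c] for which the average of [dotv (x i) c * dotv (x i) b] is
    [dotv a b / r], the first order condition then gives the statistic as a weighted
    sum of the independent variables [psi (u i / s0)], with an error that the rate and
    the condition on the size of the covariates make negligible ([linearization]). The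
    random scale only enters through sums of centered functions of [u i / s], which are
    Lipschitz in [s]: a dyadic chaining argument bounds their oscillation around [s0]
    ([scale_process_bound]).

    The weighted sum is asymptotically normal by Lindeberg's replacement argument
    ([clt_normal_cdf]). The smoothed indicator of a half line is itself a normal
    distribution function, so replacing one summand by a Gaussian one only changes the
    variance of the smoothing, which the heat equation describes ([heat_step]).

    Since several of these events are not known to be measurable, everything is stated
    for events that hold outside a measurable set of vanishing probability ([whp]). *)

Set Implicit Arguments.
Unset Strict Implicit.
Unset Printing Implicit Defensive.

Local Open Scope ring_scope.
Local Open Scope classical_set_scope.

(** * Means of bounded random variables *)

Lemma eq_ler (R : realType) (a b : R) : a = b -> a <= b.
Proof. by move=> ->. Qed.

Section mean.
Context d (T : measurableType d) (R : realType) (P : probability T R).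
Implicit Types (f g : T -> R) (k e : R).

Definition bdmeas f := measurable_fun setT f /\ exists K : R, forall w, `|f w| <= K.

(** On bounded functions the expectation is a real number and needs no case
    distinction on infinite values. *)
Definition mean f : R := Rintegral P setT f.

Lemma bdmeas_cst k : bdmeas (fun=> k).
Proof. by split=> //; exists `|k|. Qed.

Lemma bdmeasD f g : bdmeas f -> bdmeas g -> bdmeas (fun w => f w + g w).
Proof.
move=> [mf [K hK]] [mg [L hL]]; split; first exact: measurable_funD.
by exists (K + L) => w; rewrite (le_trans (ler_normD _ _))// lerD.
Qed.

Lemma bdmeasM f g : bdmeas f -> bdmeas g -> bdmeas (fun w => f w * g w).
Proof.
move=> [mf [K hK]] [mg [L hL]]; split; first exact: measurable_funM.
by exists (K * L) => w; rewrite normrM ler_pM.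
Qed.

Lemma bdmeasZ k f : bdmeas f -> bdmeas (fun w => k * f w).
Proof. by move=> bf; apply: bdmeasM => //; exact: bdmeas_cst. Qed.

Lemma bdmeasB f g : bdmeas f -> bdmeas g -> bdmeas (fun w => f w - g w).
Proof.
move=> bf bg; have := bdmeasD bf (bdmeasZ (-1) bg).
by under eq_fun do rewrite mulN1r.
Qed.

Lemma bdmeasX f n : bdmeas f -> bdmeas (fun w => f w ^+ n).
Proof.
move=> bf; elim: n => [|n ih]; first by under eq_fun do rewrite expr0; exact: bdmeas_cst.
by under eq_fun do rewrite exprS; exact: bdmeasM.
Qed.

Lemma bdmeas_sum (I : Type) (r : seq I) (Q : pred I) (F : I -> T -> R) :
  (forall i, Q i -> bdmeas (F i)) -> bdmeas (fun w => \sum_(i <- r | Q i) F i w).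
Proof.
move=> bF; elim: r => [|i r ih].
  by under eq_fun do rewrite big_nil; exact: bdmeas_cst.
under eq_fun do rewrite big_cons.
by case: (boolP (Q i)) => // Qi; apply: bdmeasD => //; exact: bF.
Qed.

Lemma bdmeas_prod (I : Type) (r : seq I) (Q : pred I) (F : I -> T -> R) :
  (forall i, Q i -> bdmeas (F i)) -> bdmeas (fun w => \prod_(i <- r | Q i) F i w).
Proof.
move=> bF; elim: r => [|i r ih].
  by under eq_fun do rewrite big_nil; exact: bdmeas_cst.
under eq_fun do rewrite big_cons.
by case: (boolP (Q i)) => // Qi; apply: bdmeasM => //; exact: bF.
Qed.

Lemma bdmeas_indic (A : set T) : measurable A -> bdmeas (fun w => \1_A w).
Proof.
move=> mA; split; first exact: measurable_indic.
by exists 1 => w; rewrite indicE; case: (_ \in _); rewrite ?normr1 ?normr0.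
Qed.

Lemma bdmeas_integrable f : bdmeas f -> P.-integrable setT (EFin \o f).
Proof.
move=> [mf [K hK]]; apply: measurable_bounded_integrable => //.
  by rewrite (le_lt_trans (probability_le1 _ _)) ?ltry.
exists K; split; first by rewrite num_real.
by move=> x xK w _; apply: le_trans (hK w) _; exact: ltW.
Qed.

Lemma mean_cst k : mean (fun=> k) = k.
Proof.
rewrite /mean Rintegral_cst//; rewrite -[RHS]mulr1; congr (_ * _).
have := @probability_setT _ _ _ P; by move=> /= ->.
Qed.

Lemma meanD f g : bdmeas f -> bdmeas g -> mean (fun w => f w + g w) = mean f + mean g.
Proof. by move=> bf bg; rewrite /mean RintegralD//; exact: bdmeas_integrable. Qed.

Lemma meanB f g : bdmeas f -> bdmeas g -> mean (fun w => f w - g w) = mean f - mean g.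
Proof. by move=> bf bg; rewrite /mean RintegralB//; exact: bdmeas_integrable. Qed.

Lemma meanZ k f : bdmeas f -> mean (fun w => k * f w) = k * mean f.
Proof. by move=> bf; rewrite /mean RintegralZl//; exact: bdmeas_integrable. Qed.

Lemma mean_sum (I : Type) (r : seq I) (Q : pred I) (F : I -> T -> R) :
  (forall i, Q i -> bdmeas (F i)) ->
  mean (fun w => \sum_(i <- r | Q i) F i w) = \sum_(i <- r | Q i) mean (F i).
Proof.
move=> bF; elim: r => [|i r ih].
  by rewrite big_nil; under eq_fun do rewrite big_nil; exact: mean_cst.
rewrite big_cons; under eq_fun do rewrite big_cons.
case: (boolP (Q i)) => // Qi; rewrite meanD ?ih//; first exact: bF.
exact: bdmeas_sum.
Qed.

Lemma mean_le f g : bdmeas f -> bdmeas g -> (forall w, f w <= g w) -> mean f <= mean g.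
Proof. by move=> bf bg fg; apply: le_Rintegral => //; exact: bdmeas_integrable. Qed.

Lemma mean_ge0 f : (forall w, 0 <= f w) -> 0 <= mean f.
Proof. by move=> f0; apply: Rintegral_ge0. Qed.

Lemma mean_norm_le f k : bdmeas f -> (forall w, `|f w| <= k) -> `|mean f| <= k.
Proof.
move=> bf fk; rewrite ler_norml; apply/andP; split.
  rewrite -[leLHS]mean_cst; apply: mean_le => //; first exact: bdmeas_cst.
  by move=> w; have := fk w; rewrite ler_norml => /andP[].
rewrite -[leRHS]mean_cst; apply: mean_le => //; first exact: bdmeas_cst.
by move=> w; have := fk w; rewrite ler_norml => /andP[].
Qed.

Lemma EFin_mean f : bdmeas f -> (mean f)%:E = (\int[P]_w (f w)%:E)%E.
Proof.
move=> bf; rewrite /mean /Rintegral fineK//.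
exact: (integrable_fin_num _ (bdmeas_integrable bf)).
Qed.

Lemma mean_expectation f : bdmeas f -> ('E_P[f])%E = (mean f)%:E.
Proof. by move=> bf; rewrite unlock EFin_mean. Qed.

Lemma mean_indic (A : set T) : measurable A -> (mean (fun w => \1_A w))%:E = P A.
Proof.
move=> mA; rewrite EFin_mean; last exact: bdmeas_indic.
by rewrite integral_indic// setIT.
Qed.

Lemma measurable_sublevel f k : measurable_fun setT f -> measurable [set w | f w <= k].
Proof.
move=> mf; have := mf measurableT `]-oo, k]%classic (measurable_itv _).
by rewrite setTI; congr measurable; apply/seteqP; split => w /=; rewrite in_itv.
Qed.

Lemma measurable_superlevel f k : measurable_fun setT f -> measurable [set w | k <= f w].
Proof.
move=> mf; have := mf measurableT `[k, +oo[%classic (measurable_itv _).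
by rewrite setTI; congr measurable; apply/seteqP; split => w /=; rewrite in_itv/= andbT.
Qed.

Lemma markov_mean f e : bdmeas f -> (forall w, 0 <= f w) -> 0 < e ->
  (P [set w | (e <= f w)%R] <= (mean f / e)%:E)%E.
Proof.
move=> bf f0 e0.
have mA := measurable_superlevel e bf.1.
rewrite -mean_indic// lee_fin ler_pdivlMr// mulrC -meanZ; last exact: bdmeas_indic.
apply: mean_le => //; first by apply: bdmeasZ; exact: bdmeas_indic.
move=> w; rewrite indicE; case: (boolP (w \in _)) => [|_]; last by rewrite mulr0.
by rewrite inE/= mulr1.
Qed.

End mean.

(** * Events of asymptotically full probability *)

Section whp.
Context d (T : measurableType d) (R : realType) (P : probability T R).
Implicit Types E F : nat -> set T.

(** The measurable cover [B] makes the notion meaningful for events that involve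
    suprema over uncountable sets of parameters. *)
Definition whp E := forall e : R, 0 < e ->
  \forall n \near \oo, exists B, [/\ measurable B, ~` E n `<=` B & (P B <= e%:E)%E].

Lemma whpI E F : whp E -> whp F -> whp (fun n => E n `&` F n).
Proof.
move=> hE hF e e0; have e2 : 0 < e / 2 by rewrite divr_gt0.
near=> n.
have [B [mB EB PB]] : exists B, [/\ measurable B, ~` E n `<=` B & (P B <= (e / 2)%:E)%E].
  by near: n; exact: hE.
have [C [mC FC PC]] : exists C, [/\ measurable C, ~` F n `<=` C & (P C <= (e / 2)%:E)%E].
  by near: n; exact: hF.
exists (B `|` C); split; first exact: measurableU.
  by rewrite setCI; exact: setUSS.
rewrite (le_trans (measureU2 _ mB mC))// (splitr e) EFinD; exact: leeD.
Unshelve. all: by end_near. Qed.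

Lemma whp_near E F : whp E -> (\forall n \near \oo, E n `<=` F n) -> whp F.
Proof.
move=> hE EF e e0; near=> n.
have [B [mB EB PB]] : exists B, [/\ measurable B, ~` E n `<=` B & (P B <= e%:E)%E].
  by near: n; exact: hE.
exists B; split => //; apply: subset_trans EB; apply: subsetC.
by near: n.
Unshelve. all: by end_near. Qed.

Lemma whpS E F : whp E -> (forall n, E n `<=` F n) -> whp F.
Proof. by move=> hE EF; apply: whp_near hE _; apply: nearW. Qed.

Lemma whp_cvg0 (B : nat -> set T) (b : nat -> R) : (forall n, measurable (B n)) ->
  (\forall n \near \oo, (P (B n) <= (b n)%:E)%E) -> b n @[n --> \oo] --> (0 : R) ->
  whp (fun n => ~` B n).
Proof.
move=> mB Pb b0 e e0; near=> n; exists (B n); split => //; first by rewrite setCK.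
have PB : (P (B n) <= (b n)%:E)%E by near: n.
apply: le_trans PB _; rewrite lee_fin; near: n.
have /cvgr0_norm_le/(_ _ e0) := b0; apply: filterS => m.
by apply: le_trans; exact: ler_norm.
Unshelve. all: by end_near. Qed.

(** Errors such as an oscillation over a shrinking neighbourhood are not small for a
    given neighbourhood; they may be removed one tolerance at a time. *)
Lemma whp_approx E :
  (forall e : R, 0 < e -> exists2 F, whp F &
    \forall n \near \oo, exists B,
       [/\ measurable B, F n `&` ~` B `<=` E n & (P B <= e%:E)%E]) -> whp E.
Proof.
move=> h e e0; have e2 : 0 < e / 2 by rewrite divr_gt0.
have [F hF hB] := h _ e2; near=> n.
have [C [mC FC PC]] : exists C, [/\ measurable C, ~` F n `<=` C & (P C <= (e / 2)%:E)%E].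
  by near: n; exact: hF.
have [B [mB EB PB]] : exists B, [/\ measurable B, F n `&` ~` B `<=` E n & (P B <= (e / 2)%:E)%E].
  by near: n; exact: hB.
exists (B `|` C); split; first exact: measurableU.
  move=> w nE; apply: contrapT => nBC; apply: nE; apply: EB; split.
    by apply: contrapT => /FC Cw; apply: nBC; right.
  by move=> Bw; apply: nBC; left.
rewrite (le_trans (measureU2 _ mB mC))// (splitr e) EFinD; exact: leeD.
Unshelve. all: by end_near. Qed.

End whp.

(** * Independence *)

Section independence.
Context d (T : measurableType d) (R : realType) (P : probability T R).

Lemma ge0_mean_mul_indep (Y Z : T -> R) :
  bdmeas Y -> bdmeas Z -> (forall w, 0 <= Y w) -> (forall w, 0 <= Z w) ->
  (forall A B : set R, measurable A -> measurable B ->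
     P (Y @^-1` A `&` Z @^-1` B) = (P (Y @^-1` A) * P (Z @^-1` B))%E) ->
  mean P (fun w => Y w * Z w) = mean P Y * mean P Z.
Proof.
move=> bY bZ Y0 Z0 YZ; apply: EFin_inj; rewrite EFinM.
rewrite EFin_mean; last exact: bdmeasM.
have mY : measurable_fun setT (Y : T -> R) by case: bY.
have mZ : measurable_fun setT (Z : T -> R) by case: bZ.
have mYZ : measurable_fun setT (fun w => (Y w, Z w) : R * R).
  exact: measurable_fun_pair.
pose Ym : {mfun T >-> R} := mfun_Sub (mem_set mY).
pose Zm : {mfun T >-> R} := mfun_Sub (mem_set mZ).
pose YZm : {mfun T >-> (R * R)%type} := mfun_Sub (mem_set mYZ).
pose f (z : R * R) := (Num.max z.1 0 * Num.max z.2 0)%:E.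
have f0 z : (0 <= f z)%E by rewrite lee_fin mulr_ge0// le_max lexx orbT.
have mmax : measurable_fun setT (fun y : R => Num.max y 0 : R).
  by apply: measurable_maxr => //.
have mf : measurable_fun setT f.
  apply/measurable_EFinP; apply: measurable_funM.
    by apply: (measurableT_comp mmax); exact: measurable_fst.
  by apply: (measurableT_comp mmax); exact: measurable_snd.
transitivity (\int[distribution P YZm]_z f z)%E.
  rewrite ge0_integral_distribution//; apply: eq_integral => w _ /=.
  by rewrite /f/= (max_idPl _)// (max_idPl _).
transitivity (\int[(distribution P Ym \x distribution P Zm)%E]_z f z)%E.
  apply: eq_measure_integral => A mA _; apply/esym.
  by apply: product_measure_unique => // B C mB mC; exact: YZ.
rewrite fubini_tonelli1//.
have mmaxE : measurable_fun setT (fun y : R => (Num.max y 0)%:E).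
  exact/measurable_EFinP.
have max0 (y : R) : (0 <= (Num.max y 0)%:E)%E by rewrite lee_fin le_max lexx orbT.
transitivity (\int[distribution P Ym]_y ((Num.max y 0)%:E * (mean P Z)%:E))%E.
  apply: eq_integral => y _; rewrite /fubini_F /f/=.
  under eq_integral do rewrite EFinM.
  rewrite ge0_integralZl//; congr (_ * _)%E.
  rewrite ge0_integral_distribution// EFin_mean//; apply: eq_integral => w _ /=.
  by rewrite (max_idPl _).
rewrite ge0_integralZr//; last by rewrite lee_fin mean_ge0.
congr (_ * _)%E; rewrite ge0_integral_distribution// EFin_mean//.
by apply: eq_integral => w _ /=; rewrite (max_idPl _).
Qed.

Lemma mean_mul_indep (Y Z : T -> R) : bdmeas Y -> bdmeas Z ->
  (forall A B : set R, measurable A -> measurable B ->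
     P (Y @^-1` A `&` Z @^-1` B) = (P (Y @^-1` A) * P (Z @^-1` B))%E) ->
  mean P (fun w => Y w * Z w) = mean P Y * mean P Z.
Proof.
move=> bY bZ YZ; have [mY [K hK]] := bY; have [mZ [L hL]] := bZ.
have bc k : bdmeas (fun _ : T => k) := bdmeas_cst T k.
have := @ge0_mean_mul_indep (fun w => Y w + K) (fun w => Z w + L).
have shift (V : T -> R) (k : R) (A : set R) : measurable A ->
    exists2 A', measurable A' & (fun w => V w + k) @^-1` A = V @^-1` A'.
  move=> mA; exists ((fun y => y + k) @^-1` A) => //.
  by rewrite -[X in measurable X]setTI; apply: measurable_funD.
have -> // : mean P (fun w => (Y w + K) * (Z w + L)) =
    mean P (fun w => Y w * Z w) + L * mean P Y + K * mean P Z + K * L.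
  under eq_fun do rewrite mulrDl !mulrDr addrA (mulrC (Y _) L).
  by rewrite !meanD ?meanZ ?mean_cst//; repeat
    (apply: bdmeasD || apply: bdmeasM || apply: bdmeasZ || exact: bc || done).
rewrite !meanD// !mean_cst => h.
suff : mean P (fun w => Y w * Z w) + L * mean P Y + K * mean P Z + K * L =
  (mean P Y + K) * (mean P Z + L) by nra.
apply: h.
- exact: bdmeasD.
- exact: bdmeasD.
- by move=> w; have := hK w; rewrite ler_norml => /andP[]; lra.
- by move=> w; have := hL w; rewrite ler_norml => /andP[]; lra.
- by move=> A B /(shift Y K)[A' mA' ->] /(shift Z L)[B' mB' ->]; exact: YZ.
Qed.

Variables (I : finType) (X : I -> {RV P >-> R}).
Hypothesis indX : mutually_independent X.

(** Intersections of events on single coordinates: a pi-system, so that Dynkin's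
    theorem carries the product rule to the sigma-algebra that it generates. *)
Definition cylinders (J : {set I}) : set (set T) :=
  [set D | exists2 A : I -> set R, (forall i, measurable (A i)) &
     D = [set w | forall i, i \in J -> A i (X i w)]].

Definition determined_by (J : {set I}) (F : T -> R) :=
  measurable_fun setT (F : g_sigma_algebraType (cylinders J) -> R).

Lemma setI_closed_cylinders J : setI_closed (cylinders J).
Proof.
move=> _ _ [A mA ->] [B mB ->]; exists (fun i => A i `&` B i).
  by move=> i; exact: measurableI.
apply/seteqP; split => w /=.
  by move=> [hA hB] i iJ; split; [exact: hA|exact: hB].
by move=> h; split=> i iJ; have [] := h i iJ.
Qed.

Lemma measurable_cylinders J D : cylinders J D -> measurable D.
Proof.
move=> [A mA ->].
have -> : [set w | forall i, i \in J -> A i (X i w)] =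
    \bigcap_(i in [set i | i \in J]) (X i @^-1` A i).
  by apply/seteqP; split.
apply: fin_bigcap_measurable => // i _.
by rewrite -[X in measurable X]setTI; exact: measurable_funP.
Qed.

Lemma determined_by_coord (J : {set I}) i (f : R -> R) : i \in J -> measurable_fun setT f ->
  determined_by J (fun w => f (X i w)).
Proof.
move=> iJ mf; apply: (measurableT_comp mf) => _ A mA; rewrite setTI.
apply: sub_sigma_algebra; exists (fun j => if j == i then A else setT).
  by move=> j; case: ifP.
apply/seteqP; split => w /=.
  by move=> XA j _; case: eqP => // ->.
by move=> /(_ i iJ); rewrite eqxx.
Qed.

Lemma indep_cylinders (J : {set I}) k D (B : set R) : k \notin J -> measurable B ->
  <<s cylinders J >> D -> P (D `&` X k @^-1` B) = (P D * P (X k @^-1` B))%E.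
Proof.
move=> kJ mB; have mXB : measurable (X k @^-1` B).
  by rewrite -[X in measurable X]setTI; exact: measurable_funP.
pose H := [set D | measurable D /\
  P (D `&` X k @^-1` B) = (P D * P (X k @^-1` B))%E].
suff : <<s cylinders J >> `<=` H by move=> /[apply] -[].
apply: lambda_system_subset; [exact: setI_closed_cylinders| |..].
- split => //.
  + by split; rewrite ?setTI ?probability_setT ?mul1e.
  + move=> D1 D2 D21 [mD1 h1] [mD2 h2]; split; first exact: measurableD.
    have fin V : measurable V -> (P V < +oo)%E.
      by move=> mD; rewrite (le_lt_trans (probability_le1 _ _)) ?ltry.
    have -> : (D1 `\` D2) `&` X k @^-1` B = (D1 `&` X k @^-1` B) `\` (D2 `&` X k @^-1` B).
      apply/seteqP; split => w /=; first by move=> [[? nD2] ?]; split => // -[].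
      by move=> [[? ?] nD2]; split => //; split => // ?; exact: nD2.
    rewrite [LHS]measureD; [|exact: measurableI|exact: measurableI|]; last first.
      by apply: fin; exact: measurableI.
    rewrite (setIidr (setSI D21)).
    transitivity (P D1 * P (X k @^-1` B) - P D2 * P (X k @^-1` B))%E.
      by rewrite -h1 -h2.
    rewrite measureD//; last exact: fin.
    rewrite (setIidr D21) muleBl//.
    * by rewrite fin_num_measure.
    * by apply: fin_num_adde_defr; rewrite fin_num_measure.
  + move=> F ndF hF; split; first by apply: bigcup_measurable => i _; case: (hF i).
    rewrite setI_bigcupl.
    have mF i : measurable (F i) by case: (hF i).
    have h1 : P (F i) @[i --> \oo] --> P (\bigcup_i F i).
      by apply: nondecreasing_cvg_mu => //; exact: bigcup_measurable.
    have h2 : P (F i `&` X k @^-1` B) @[i --> \oo] --> P (\bigcup_i (F i `&` X k @^-1` B)).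
      apply: nondecreasing_cvg_mu => //.
      * by move=> i; exact: measurableI.
      * by apply: bigcup_measurable => i _; exact: measurableI.
      * by move=> m n mn; apply/subsetPset; apply: setSI; apply/subsetPset; exact: ndF.
    apply: (cvg_unique _ h2) => //=.
    under eq_fun do rewrite (hF _).2.
    apply: cvgeZr => //; exact: fin_num_measure.
- move=> D' cD; split; first exact: measurable_cylinders cD.
  case: cD => A mA ->.
  have := @indX (k |: J)%SET (fun i => if i == k then B else A i).
  rewrite (_ : [set w | forall i, i \in _ -> _] =
    [set w | forall i, i \in J -> A i (X i w)] `&` X k @^-1` B); last first.
    apply/seteqP; split => w /=.
      move=> h; split.
        move=> i iJ; have := h i; rewrite !inE iJ.
        rewrite orbT => /(_ isT); case: eqP => // ik.
        by move: kJ; rewrite -ik iJ.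
      by have := h k; rewrite !inE eqxx => /(_ isT).
    move=> [hA hB] i; rewrite !inE; case: eqP => [-> //|_] /=.
    exact: hA.
  move=> ->; last by move=> i; case: ifP.
  rewrite big_setU1//= eqxx muleC; congr (_ * _)%E.
  rewrite indX//; apply: eq_bigr => i iJ; case: eqP => // ik.
  by move: kJ; rewrite -ik iJ.
- by move=> V _ w _.
Qed.

(** The factorization that drives both the exponential inequality and the
    replacement argument of the central limit theorem. *)
Lemma mean_determined_mul (J : {set I}) k (F : T -> R) (g : R -> R) : k \notin J ->
  bdmeas F -> determined_by J F -> measurable_fun setT g ->
  (exists K : R, forall y, `|g y| <= K) ->
  mean P (fun w => F w * g (X k w)) = mean P F * mean P (fun w => g (X k w)).
Proof.
move=> kJ bF dF mg [K hK]; apply: mean_mul_indep => //.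
  by split; [exact: measurableT_comp|exists K].
move=> A B mA mB.
rewrite -[(fun w => g (X k w)) @^-1` B]/(X k @^-1` (g @^-1` B)).
apply: (indep_cylinders kJ).
  by rewrite -[X in measurable X]setTI; exact: mg.
by have := dF measurableT _ mA; rewrite setTI.
Qed.

Lemma determined_byS (J J' : {set I}) F : J \subset J' ->
  determined_by J F -> determined_by J' F.
Proof.
move=> /fintype.subsetP JJ' mF _ A mA; have := mF measurableT A mA.
apply: smallest_sub; first exact: smallest_sigma_algebra.
move=> D [B mB ->]; apply: sub_sigma_algebra.
exists (fun i => if i \in J then B i else setT); first by move=> i; case: ifP.
apply/seteqP; split => w /= h i iJ; last by have := h i (JJ' _ iJ); rewrite iJ.
by case: ifPn => // /h.
Qed.

Let bdmeas_coord i (f : R -> R) : measurable_fun setT f ->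
  (exists K : R, forall y, `|f y| <= K) -> bdmeas (fun w => f (X i w)).
Proof. by move=> mf [K hK]; split; [exact: measurableT_comp|exists K]. Qed.

Lemma mean_prod_indep (r : seq I) (f : I -> R -> R) : uniq r ->
  (forall i, measurable_fun setT (f i)) ->
  (forall i, exists K : R, forall y, `|f i y| <= K) ->
  mean P (fun w => \prod_(i <- r) f i (X i w)) =
  \prod_(i <- r) mean P (fun w => f i (X i w)).
Proof.
move=> + mf bf; elim: r => [_|i r ih /= /andP[ir ur]].
  by rewrite big_nil; under eq_fun do rewrite big_nil; exact: mean_cst.
rewrite big_cons -ih//; under eq_fun do rewrite big_cons mulrC.
rewrite (@mean_determined_mul [set j in r]%SET)//; first exact: mulrC.
- by rewrite inE.
- by apply: bdmeas_prod => j _; exact: bdmeas_coord.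
- elim: r {ih ir ur} => [|j r ihr].
    have -> : (fun w : T => \prod_(j <- [::]) f j (X j w)) = cst 1.
      by apply/funext => w; rewrite big_nil.
    exact: measurable_cst.
  have -> : (fun w : T => \prod_(k <- j :: r) f k (X k w)) =
    (fun w => f j (X j w) * \prod_(k <- r) f k (X k w)).
    by apply/funext => w; rewrite big_cons.
  rewrite /determined_by; apply: measurable_funM.
    by apply: determined_by_coord; rewrite // inE mem_head.
  apply: determined_byS ihr; apply/fintype.subsetP => k; rewrite !inE => ->.
  by rewrite orbT.
Qed.

(** Orthogonality of centered independent variables. *)
Lemma mean_sqr_sum_indep (v : I -> R) (h : I -> R -> R) (L : R) :
  (forall i, measurable_fun setT (h i)) -> (forall i y, `|h i y| <= L) ->
  (forall i, mean P (fun w => h i (X i w)) = 0) ->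
  mean P (fun w => (\sum_i v i * h i (X i w)) ^+ 2) <= L ^+ 2 * \sum_i v i ^+ 2.
Proof.
move=> mh hL h0.
have bh i : bdmeas (fun w => h i (X i w)) by apply: bdmeas_coord => //; exists L.
under eq_fun do rewrite expr2 big_distrlr/=.
rewrite mean_sum; last first.
  by move=> i _; apply: bdmeas_sum => j _; apply: bdmeasM; exact: bdmeasZ.
rewrite mulr_sumr; apply: ler_sum => i _.
rewrite mean_sum; last by move=> j _; apply: bdmeasM; exact: bdmeasZ.
rewrite (bigD1 i)//= big1 ?addr0.
  rewrite -[leRHS](@mean_cst _ _ _ P); apply: mean_le.
  - by apply: bdmeasM; exact: bdmeasZ.
  - exact: bdmeas_cst.
  - move=> w; rewrite -expr2 exprMn mulrC ler_wpM2r ?sqr_ge0//.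
    by rewrite -real_normK ?num_real// lerXn2r ?nnegrE ?(le_trans _ (hL i (X i w))).
move=> j ji.
transitivity (mean P (fun w => (v i * v j) * (h i (X i w) * h j (X j w)))).
  by congr mean; apply/funext => w; rewrite mulrACA.
rewrite meanZ; last exact: bdmeasM.
rewrite (@mean_determined_mul [set i]%SET j _ (h j)) ?h0 ?mulr0 ?inE//.
- by apply: determined_by_coord; rewrite ?inE.
- by exists L.
Qed.

End independence.

(** * An exponential inequality *)

(** Since [expR (- y) >= 1 - y], the exponential is at most [1 / (1 - y)]. *)
Lemma expR_le_quadratic (R : realType) (y : R) : `|y| <= 1 / 2 ->
  expR y <= 1 + y + 2 * y ^+ 2.
Proof.
rewrite ler_norml => /andP[y1 y2]; have h := expR_ge1Dx (- y).
have E : expR y * expR (- y) = 1 by rewrite -expRD subrr expR0.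
have e0 := expR_gt0 y; have y0 : 0 < 1 - y by lra.
have ey : expR y * (1 - y) <= 1 by rewrite -[leRHS]E ler_pM2l.
have y20 : 0 <= y ^+ 2 by exact: sqr_ge0.
rewrite -(ler_pM2r y0); apply: le_trans ey _.
have : 0 <= y ^+ 2 * (1 - 2 * y) by rewrite mulr_ge0//; lra.
nra.
Qed.

Section exponential_inequality.
Context d (T : measurableType d) (R : realType) (P : probability T R).
Variables (n : nat) (X : 'I_n -> {RV P >-> R}) (h : 'I_n -> R -> R) (K : R).
Hypothesis indX : mutually_independent X.
Hypothesis mh : forall i, measurable_fun setT (h i).
Hypothesis hK : forall i y, `|h i y| <= K.
Hypothesis h0 : forall i, mean P (fun w => h i (X i w)) = 0.

Let bh i : bdmeas (fun w => h i (X i w)).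
Proof. by split; [exact: measurableT_comp|exists K]. Qed.

(** Markov's inequality for [expR (l * S)]: the exponential moment factorizes, and
    each centered factor is at most [expR (2 * (l * K) ^+ 2)]. *)
Lemma exponential_tail (e : R) : 0 < e -> 0 < K -> e <= 2 * K ->
  (P [set w | (n%:R * e <= \sum_i h i (X i w))%R] <=
   (expR (- (n%:R * e ^+ 2 / (8 * K ^+ 2))))%:E)%E.
Proof.
move=> e0 K0 eK; pose l := e / (4 * K ^+ 2).
have K2 : 0 < 4 * K ^+ 2 by rewrite mulr_gt0// exprn_gt0.
have l0 : 0 < l by rewrite divr_gt0.
have lK : l * K <= 1 / 2.
  rewrite /l mulrAC ler_pdivrMr// expr2; nra.
have bexp i : bdmeas (fun w => expR (l * h i (X i w))).
  split; first by apply: measurableT_comp => //; case: (bdmeasZ l (bh i)).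
  exists (expR (l * K)) => w; rewrite ger0_norm ?expR_ge0// ler_expR ler_wpM2l ?(ltW l0)//.
  exact: le_trans (ler_norm _) (hK _ _).
have mgf i : mean P (fun w => expR (l * h i (X i w))) <= expR (2 * (l ^+ 2 * K ^+ 2)).
  apply: (@le_trans _ _ (1 + 2 * (l ^+ 2 * K ^+ 2))); last exact: expR_ge1Dx.
  have bd1 : bdmeas (fun w => 1 + l * h i (X i w)).
    by apply: bdmeasD; [exact: bdmeas_cst|exact: bdmeasZ].
  have bd2 : bdmeas (fun _ : T => 2 * (l * K) ^+ 2) by exact: bdmeas_cst.
  apply: (@le_trans _ _ (mean P (fun w => 1 + l * h i (X i w) + 2 * (l * K) ^+ 2))).
    apply: mean_le => //; first exact: bdmeasD.
    move=> w; have lh : `|l * h i (X i w)| <= l * K.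
      by rewrite normrM gtr0_norm// ler_wpM2l// ltW.
    apply: le_trans (expR_le_quadratic (le_trans lh lK)) _.
    rewrite lerD2l ler_pM2l// -[leLHS]real_normK ?num_real//.
    by rewrite lerXn2r// nnegrE ?(le_trans _ lh).
  rewrite (meanD P bd1 bd2) (meanD P (bdmeas_cst T 1) (bdmeasZ l (bh i))).
  by rewrite (meanZ P l (bh i)) h0 !mean_cst mulr0 addr0 exprMn.
pose S w := \sum_i h i (X i w).
have expS w : expR (l * S w) = \prod_(i <- index_enum 'I_n) expR (l * h i (X i w)).
  by rewrite /S mulr_sumr expR_sum.
have bS : bdmeas (fun w => expR (l * S w)).
  by under eq_fun do rewrite expS; apply: bdmeas_prod.
have := @markov_mean _ _ _ P (fun w => expR (l * S w)) (expR (l * (n%:R * e))) bS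
  (fun w => expR_ge0 _) (expR_gt0 _).
rewrite (_ : [set w | _] = [set w | (n%:R * e <= \sum_i h i (X i w))%R]); last first.
  by apply/seteqP; split => w /=; rewrite ler_expR ler_pM2l.
move=> /le_trans; apply; rewrite lee_fin ler_pdivrMr ?expR_gt0// -expRD.
apply: (@le_trans _ _ (expR (n%:R * (2 * (l ^+ 2 * K ^+ 2))))).
  under eq_fun do rewrite expS.
  rewrite (mean_prod_indep indX (f := fun i y => expR (l * h i y))).
  - apply: (@le_trans _ _ (\prod_(i : 'I_n) expR (2 * (l ^+ 2 * K ^+ 2)))).
      by apply: ler_prod => i _; rewrite mgf mean_ge0// => w; rewrite expR_ge0.
    by rewrite prodr_const card_ord -expRM_natl.
  - exact: index_enum_uniq.
  - move=> i; apply: measurableT_comp => //; exact: measurable_funM.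
  - move=> i; exists (expR (l * K)) => y; rewrite ger0_norm ?expR_ge0//.
    rewrite ler_expR ler_wpM2l ?(ltW l0)//; exact: le_trans (ler_norm _) (hK _ _).
rewrite ler_expR /l; apply: eq_ler.
by field; rewrite gt_eqF.
Qed.

End exponential_inequality.

(** * Laws determined by distribution functions *)

Section law.
Variable R : realType.
Local Notation mu := (@lebesgue_measure R).

(** Half lines form a pi-system that generates the Borel sets. *)
Lemma measure_eq_rays (m1 m2 : {measure set R -> \bar R}) :
  (forall r : R, m1 `]-oo, r] = m2 `]-oo, r]) ->
  (forall r : R, (m1 `]-oo, r] < +oo)%E) ->
  forall A, measurable A -> m1 A = m2 A.
Proof.
move=> m12 m1oo A mA.
pose G := [set B : set R | exists r : R, B = `]-oo, r]%classic].
apply: (measure_unique G (fun k => `]-oo, k%:R]%classic)) => //.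
- apply/seteqP; split => B.
    move=> mB; have : <<s @RGenOInfty.G R >> B.
      by have : (@ocitv R).-sigma.-measurable B by []; rewrite RGenOInfty.measurableE.
    apply: smallest_sub; first exact: smallest_sigma_algebra.
    move=> _ [x ->]; rewrite -setCitvl; apply: sigma_algebraC; apply: sub_sigma_algebra.
    by exists x.
  apply: smallest_sub; first exact: sigma_algebra_measurable.
  by move=> _ [x ->]; exact: measurable_itv.
- move=> _ _ [x ->] [y ->]; exists (Num.min x y); apply/seteqP; split => z /=.
    by rewrite !in_itv/= le_min => -[-> ->].
  by rewrite !in_itv/= le_min => /andP[].
- by move=> k; exists k%:R.
- apply/seteqP; split => // x _; exists (Num.truncn `|x|).+1 => //=.
  rewrite in_itv/=; apply: le_trans (ler_norm x) _; exact: ltW (truncnS_gt _).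
- by move=> B [x ->].
Qed.

Lemma mean_comp_cdf d (T : measurableType d) (P : probability T R)
    (X Y : {RV P >-> R}) (h : R -> R) : (forall r, cdf X r = cdf Y r) ->
  measurable_fun setT h -> (exists K : R, forall y, `|h y| <= K) ->
  mean P (fun w => h (X w)) = mean P (fun w => h (Y w)).
Proof.
move=> XY mh [K hK].
have bh (Z : {RV P >-> R}) : bdmeas (fun w => h (Z w)).
  by split; [exact: measurableT_comp|exists K].
have E (Z : {RV P >-> R}) : mean P (fun w => h (Z w)) + K =
    fine (\int[distribution P Z]_y (h y + K)%:E)%E.
  rewrite ge0_integral_distribution//.
  - rewrite -[X in _ + X](mean_cst P) -meanD//; exact: bdmeas_cst.
  - by apply/measurable_EFinP; apply: measurable_funD.
  - by move=> y; rewrite lee_fin; have := hK y; rewrite ler_norml => /andP[]; lra.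
apply: (addIr K); rewrite !E; congr fine; apply: eq_measure_integral => A mA _.
by apply: measure_eq_rays => // r; rewrite (le_lt_trans (probability_le1 _ _)) ?ltry.
Qed.

End law.

Section density.
Variables (R : realType) (f : R -> R).
Local Notation mu := (@lebesgue_measure R).
Hypotheses (mf : measurable_fun setT f) (f0 : forall t, 0 <= f t).

Let nu : set R -> \bar R := fun A => (\int[mu]_(x in A) (f x)%:E)%E.

Let nu0 : nu set0 = 0%E. Proof. by rewrite /nu integral_set0. Qed.

Let nu_ge0 A : (0 <= nu A)%E.
Proof. by apply: integral_ge0 => x _; rewrite lee_fin. Qed.

Let mfE A : measurable_fun A (EFin \o f).
Proof. by apply/measurable_EFinP; exact: measurable_funTS. Qed.

Let nu_sigma_additive : semi_sigma_additive nu.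
Proof.
move=> /= F mF tF mUF; rewrite /nu; apply: cvg_toP.
  apply: ereal_nondecreasing_is_cvgn => m n mn.
  apply: lee_sum_nneg_natr => // k _ _.
  by apply: integral_ge0 => /= x Fkx; rewrite lee_fin.
rewrite ge0_integral_bigcup//=; first exact: mfE.
by move=> x _; rewrite lee_fin.
Qed.

#[local] HB.instance Definition _ := isMeasure.Build _ _ _ nu
  nu0 nu_ge0 nu_sigma_additive.

Import HBNNSimple.

Let integral_nu_indic (E : set R) : measurable E ->
  (\int[nu]_x (\1_E x)%:E = \int[mu]_x ((\1_E x)%:E * (f x)%:E))%E.
Proof.
move=> mE; rewrite integral_indic//= setIT /nu integral_mkcond.
apply: eq_integral => x _; rewrite patchE indicE; case: (x \in E).
  by rewrite mul1e.
by rewrite mul0e.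
Qed.

Let integral_nu_nnsfun (g : {nnsfun R >-> R}) :
  (\int[nu]_x (g x)%:E = \int[mu]_x ((g x)%:E * (f x)%:E))%E.
Proof.
have ff0 x : (0 <= (f x)%:E)%E by rewrite lee_fin.
have mg (r : R) : measurable (g @^-1` [set r]) by [].
under [LHS]eq_integral do rewrite fimfunE -fsumEFin//.
rewrite [LHS]ge0_integral_fsum//; last 2 first.
  - by move=> r; exact/measurable_EFinP/measurableT_comp.
  - by move=> n x _; rewrite EFinM nnfun_muleindic_ge0.
under [RHS]eq_integral.
  move=> x xD; rewrite fimfunE -fsumEFin// ge0_mule_fsuml; last first.
    by move=> r; rewrite EFinM nnfun_muleindic_ge0.
  over.
rewrite [RHS]ge0_integral_fsum//; last 2 first.
  - move=> r; apply: emeasurable_funM; last exact: mfE.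
    by apply/measurable_EFinP; apply: measurable_funM => //; apply: measurable_indic; exact: mg.
  - by move=> n x _; rewrite mule_ge0// nnfun_muleindic_ge0.
apply: eq_fsbigr => r rg.
rewrite integralZl_indic_nnsfun//= integral_nu_indic//.
have r0 : (0 <= r%:E)%E.
  by move: rg; rewrite inE => -[x _ <-]; rewrite lee_fin.
rewrite -ge0_integralZl//.
- by apply: eq_integral => x _; rewrite EFinM muleA.
- apply: emeasurable_funM; last exact: mfE.
  by apply/measurable_EFinP; apply: measurable_indic; exact: mg.
- by move=> x _; rewrite mule_ge0// lee_fin.
Qed.

Let integral_nu (g : R -> \bar R) : measurable_fun setT g -> (forall x, 0 <= g x)%E ->
  (\int[nu]_x g x = \int[mu]_x (g x * (f x)%:E))%E.
Proof.
move=> mg g0; pose g_ := nnsfun_approx measurableT mg.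
have ff0 x : (0 <= (f x)%:E)%E by rewrite lee_fin.
transitivity (lim (\int[nu]_x (g_ n x)%:E @[n --> \oo])%E).
  rewrite -monotone_convergence//=.
  - apply: eq_integral => ? /[!inE] xD; apply/esym/cvg_lim => //=.
    exact: cvg_nnsfun_approx.
  - by move=> n; exact/measurable_EFinP/measurable_funTS.
  - by move=> n ? _; rewrite lee_fin.
  - by move=> ? _ ? ? mn; rewrite lee_fin; exact/lefP/nd_nnsfun_approx.
under eq_fun do rewrite integral_nu_nnsfun.
have mgn n : measurable_fun [set: R] (fun x : R => (g_ n x)%:E).
  exact/measurable_EFinP/measurable_funTS.
rewrite -monotone_convergence//=.
- apply: eq_integral => x _; apply/cvg_lim => //=.
  by apply: cvgeZr => //; exact: cvg_nnsfun_approx.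
- move=> n; apply: emeasurable_funM; last exact: mfE.
  exact: mgn.
- by move=> n x _; rewrite mule_ge0// lee_fin.
- move=> x _ m n mn; rewrite lee_wpmul2r// lee_fin.
  by have /lefP := nd_nnsfun_approx measurableT mg mn; exact.
Qed.

(** The law of [X] and the measure of density [f] agree on half lines, hence on Borel
    sets, and then on simple functions and their monotone limits. *)
Lemma ge0_mean_density d (T : measurableType d) (P : probability T R)
    (X : {RV P >-> R}) (h : R -> R) :
  (forall r, cdf X r = (\int[mu]_(t in `]-oo, r]) (f t)%:E)%E) ->
  measurable_fun setT h -> (forall y, 0 <= h y) ->
  (\int[P]_w (h (X w))%:E = \int[mu]_y (h y * f y)%:E)%E.
Proof.
move=> Xf mh h0; have mhE : measurable_fun setT (EFin \o h) by exact/measurable_EFinP.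
transitivity (\int[distribution P X]_y (h y)%:E)%E.
  by rewrite ge0_integral_distribution// => y; rewrite lee_fin.
transitivity (\int[nu]_y (h y)%:E)%E.
  apply: eq_measure_integral => A mA _; apply: measure_eq_rays => //.
  by move=> r; rewrite (le_lt_trans (probability_le1 _ _)) ?ltry.
by rewrite integral_nu.
Qed.

End density.

(** * Symmetric unimodal laws *)

Section reflection.
Variable R : realType.
Local Notation mu := (@lebesgue_measure R).

Let reflection (t : R) : R -> measurableTypeR R := fun x => t - x.

Let measurable_reflection (t : R) : measurable_fun [set: R] (reflection t).
Proof. exact: measurable_funB. Qed.

Let lebesgue_measure_reflection (t : R) (A : set R) : measurable A ->
  pushforward mu (reflection t) A = mu A.
Proof.
move=> mA; apply/esym/lebesgue_measure_unique => //=; first exact: measurable_reflection.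
move=> _ _ [[a b]] _ <-.
rewrite /pushforward (_ : _ @^-1` _ = `[t - b, t - a[%classic); last first.
  by apply/seteqP; split => x /=; rewrite /reflection !in_itv/= => /andP[? ?]; apply/andP; split; lra.
rewrite !lebesgue_measure_itv/= !lte_fin ltrD2l ltrN2.
by case: ifP => // _; congr (_%:E); lra.
Qed.

Lemma ge0_integral_reflection (t : R) (k : R -> R) :
  measurable_fun setT k -> (forall y, 0 <= k y) ->
  (\int[mu]_x (k (t - x))%:E = \int[mu]_x (k x)%:E)%E.
Proof.
move=> mk k0.
transitivity (\int[pushforward mu (reflection t)]_x (k x)%:E)%E.
  rewrite ge0_integral_pushforward//.
  - exact: measurable_reflection.
  - exact/measurable_EFinP.
  - by move=> x _; rewrite lee_fin.
apply: eq_measure_integral => [|mrefl A mA _]; first exact: measurable_reflection.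
exact: lebesgue_measure_reflection.
Qed.

End reflection.

Section symmetric_unimodal.
Context d (T : measurableType d) (R : realType) (P : probability T R).
Local Notation mu := (@lebesgue_measure R).
Variables (f : R -> R) (X : {RV P >-> R}).
Hypotheses (mf : measurable_fun setT f) (f0 : forall t, 0 <= f t).
Hypothesis Xf : forall r, cdf X r = (\int[mu]_(t in `]-oo, r]) (f t)%:E)%E.
Hypothesis f_even : forall t, f (- t) = f t.

Let mean_dens (h : R -> R) : bdmeas (fun w => h (X w)) -> measurable_fun setT h ->
  (forall y, 0 <= h y) -> (mean P (fun w => h (X w)))%:E = (\int[mu]_y (h y * f y)%:E)%E.
Proof. by move=> bh mh h0; rewrite EFin_mean// (ge0_mean_density mf). Qed.

Let mean_dens_reflection t (h : R -> R) : bdmeas (fun w => h (X w)) ->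
  measurable_fun setT h -> (forall y, 0 <= h y) ->
  (mean P (fun w => h (X w)))%:E = (\int[mu]_y (h (t - y) * f (t - y))%:E)%E.
Proof.
move=> bh mh h0; rewrite mean_dens// -(@ge0_integral_reflection _ t (fun y => h y * f y))//.
- exact: measurable_funM.
- by move=> y; rewrite mulr_ge0.
Qed.

Let bdmeas_comp (h : R -> R) : measurable_fun setT h ->
  (exists K : R, forall y, `|h y| <= K) -> bdmeas (fun w => h (X w)).
Proof. by move=> mh [K hK]; split; [exact: measurableT_comp|exists K]. Qed.

(** A symmetric law gives the same mean to [h] and to its reflection [- h]. *)
Lemma mean_odd (h : R -> R) : measurable_fun setT h ->
  (exists K : R, forall y, `|h y| <= K) -> (forall y, h (- y) = - h y) ->
  mean P (fun w => h (X w)) = 0.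
Proof.
move=> mh bh hN; have [K hK] := bh; have bhX := bdmeas_comp mh bh.
have m1 : measurable_fun setT (fun y => h y + K) by exact: measurable_funD.
have m2 : measurable_fun setT (fun y => K - h y) by exact: measurable_funB.
have b1 : bdmeas (fun w => h (X w) + K) by apply: bdmeasD => //; exact: bdmeas_cst.
have b2 : bdmeas (fun w => K - h (X w)) by apply: bdmeasB => //; exact: bdmeas_cst.
have : mean P (fun w => h (X w) + K) = mean P (fun w => K - h (X w)).
  apply: EFin_inj.
  rewrite (@mean_dens (fun y => h y + K))//; last first.
    by move=> y; have := hK y; rewrite ler_norml => /andP[]; lra.
  rewrite (@mean_dens_reflection 0 (fun y => K - h y))//; last first.
    by move=> y; have := hK y; rewrite ler_norml => /andP[]; lra.
  by apply: eq_integral => y _; rewrite !sub0r hN f_even opprK addrC.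
rewrite (meanD P bhX (bdmeas_cst T K)) (meanB P (bdmeas_cst T K) bhX) mean_cst.
lra.
Qed.

Hypothesis f_mono : forall t v, `|t| <= `|v| -> f v <= f t.
Hypothesis f_strict : exists2 e : R, 0 < e &
  forall t v, `|t| < `|v| -> `|v| < e -> f v < f t.

(** A density that decreases strictly near the origin is positive there. *)
Lemma mean_gt0_near : exists2 e : R, 0 < e & forall h : R -> R, continuous h ->
  (exists K : R, forall y, `|h y| <= K) -> (forall y, 0 <= h y) ->
  (exists2 y0, `|y0| < e & 0 < h y0) -> 0 < mean P (fun w => h (X w)).
Proof.
have [e e0 fe] := f_strict; exists e => // h ch bh h0 [y0 y0e hy0].
have mh : measurable_fun setT h by exact: continuous_measurable_fun.
have mhf : measurable_fun setT (fun y : R => (h y * f y)%:E).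
  by apply/measurable_EFinP; exact: measurable_funM.
have bhX := bdmeas_comp mh bh.
rewrite lt_neqAle mean_ge0// andbT; apply/negP => /eqP eq0.
have F0 : (\int[mu]_y (h y * f y)%:E = 0)%E by rewrite -mean_dens// -eq0.
have : ae_eq mu setT (fun y => (h y * f y)%:E) (cst 0%E).
  apply/ae_eq_integral_abs => //.
  by rewrite -F0; apply: eq_integral => y _ /=; rewrite ger0_norm// mulr_ge0.
move=> [N [mN N0 FN]].
have : \forall y \near y0, 0 < h y /\ `|y| < e.
  near=> y; split.
    have : `|h y0 - h y| < h y0.
      near: y; have /cvgrPdist_lt := ch y0; exact.
    by rewrite ltr_distl; lra.
  have : `|y0 - y| < e - `|y0|.
    near: y; apply: (@cvgr_dist_lt _ _ _ (nbhs y0) _ id y0 cvg_id); lra.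
  have := ler_normD y0 (y - y0); rewrite addrC subrK (distrC y); lra.
move=> /nbhs_ballP[m /= m0 hm].
pose I : set R := `](y0 - m)%R, (y0 + m)%R[%classic.
have : (mu I <= mu N)%E.
  apply: le_measure; rewrite ?inE; [exact: measurable_itv|exact: mN|].
  apply: subset_trans FN => y; rewrite /I /= in_itv/= => ym.
  have [hy ye] : 0 < h y /\ `|y| < e.
    by apply: hm; rewrite /ball/= ltr_distl; lra.
  have fy : 0 < f y.
    have y1 := normr_ge0 y.
    have ve : `|(`|y| + e) / 2| = (`|y| + e) / 2 by apply: ger0_norm; lra.
    by apply: le_lt_trans (f0 _) (fe y ((`|y| + e) / 2) _ _); rewrite ve; lra.
  by move=> /(_ Logic.I) [] /eqP; rewrite gt_eqF// mulr_gt0.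
rewrite N0 /I lebesgue_measure_itv/=; case: ifP => [_|/negP[]].
  by rewrite -EFinD lee_fin; lra.
by rewrite lte_fin; lra.
Unshelve. all: by end_near. Qed.

Variable rho : R -> R.
Hypotheses (mrho : measurable_fun setT rho) (rho0 : forall y, 0 <= rho y).
Hypothesis rho_bnd : exists K : R, forall y, `|rho y| <= K.
Hypothesis rho_even : forall y, rho (- y) = rho y.
Hypothesis rho_mono : forall t v, `|t| <= `|v| -> rho t <= rho v.

Let mrhot t : measurable_fun setT (fun y : R => rho (y - t)).
Proof. by apply: (measurableT_comp mrho); exact: measurable_funB. Qed.

Let brhot t : bdmeas (fun w => rho (X w - t)).
Proof.
apply: (@bdmeas_comp (fun y => rho (y - t))) => //.
by have [K hK] := rho_bnd; exists K.
Qed.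

Let F t y := (rho (y - t) - rho y) * (f y - f (t - y)) : R.

Let mF t : measurable_fun setT (F t).
Proof.
apply: measurable_funM; first exact: measurable_funB.
apply: measurable_funB => //; apply: (measurableT_comp mf); exact: measurable_funB.
Qed.

Let mFE t : measurable_fun setT (fun y : R => (F t y)%:E).
Proof. by apply/measurable_EFinP; exact: mF. Qed.

Let F_ge0 t y : 0 <= F t y.
Proof.
rewrite /F; have [h|/ltW h] := leP `|y| `|t - y|.
  by rewrite mulr_ge0// subr_ge0; [rewrite rho_mono// distrC|exact: f_mono].
by rewrite mulr_le0// subr_le0; [rewrite rho_mono// distrC|exact: f_mono].
Qed.

(** Folding the line at [t / 2] shows that the means of [rho (X - t)] and of
    [rho X] differ by half the integral of a product of two factors of equal sign. *)
Let mean_translate t :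
  ((2 * mean P (fun w => rho (X w - t)))%:E =
  \int[mu]_y (F t y)%:E + (2 * mean P (fun w => rho (X w)))%:E)%E.
Proof.
have bX : bdmeas (fun w => rho (X w)) by exact: bdmeas_comp.
have mft : measurable_fun setT (fun y : R => f (t - y)).
  by apply: (measurableT_comp mf); exact: measurable_funB.
have E1 : (mean P (fun w => rho (X w - t)))%:E = (\int[mu]_y (rho (y - t) * f y)%:E)%E.
  exact: (@mean_dens (fun y => rho (y - t))).
have E2 : (mean P (fun w => rho (X w - t)))%:E = (\int[mu]_y (rho y * f (t - y))%:E)%E.
  rewrite (@mean_dens_reflection t (fun y => rho (y - t)))//.
  by apply: eq_integral => y _; rewrite addrAC subrr add0r rho_even.
have E3 : (mean P (fun w => rho (X w)))%:E = (\int[mu]_y (rho y * f y)%:E)%E.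
  exact: mean_dens.
have E4 : (mean P (fun w => rho (X w)))%:E = (\int[mu]_y (rho (y - t) * f (t - y))%:E)%E.
  rewrite (@mean_dens_reflection t rho)//.
  by apply: eq_integral => y _; rewrite -[t - y]opprB rho_even.
have m1 : measurable_fun setT (fun y : R => rho (y - t) * f y) by exact: measurable_funM.
have m2 : measurable_fun setT (fun y : R => rho y * f (t - y)) by exact: measurable_funM.
have m3 : measurable_fun setT (fun y : R => rho y * f y) by exact: measurable_funM.
have m4 : measurable_fun setT (fun y : R => rho (y - t) * f (t - y)) by exact: measurable_funM.
have double (z : R) : (2 * z)%:E = (z%:E + z%:E)%E by rewrite -EFinD; congr EFin; ring.
rewrite !double {1}E1 E2 {1}E3 E4.
rewrite -ge0_integralD//; first last.
- exact/measurable_EFinP.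
- by move=> y _; rewrite lee_fin mulr_ge0.
- exact/measurable_EFinP.
- by move=> y _; rewrite lee_fin mulr_ge0.
rewrite -ge0_integralD//; first last.
- exact/measurable_EFinP.
- by move=> y _; rewrite lee_fin mulr_ge0.
- exact/measurable_EFinP.
- by move=> y _; rewrite lee_fin mulr_ge0.
rewrite -ge0_integralD//; first last.
- by apply: emeasurable_funD; exact/measurable_EFinP.
- by move=> y _; rewrite -EFinD lee_fin addr_ge0// mulr_ge0.
- exact: mFE.
- by move=> y _; rewrite lee_fin F_ge0.
by apply: eq_integral => y _; rewrite -!EFinD /F; congr EFin; ring.
Qed.

Lemma mean_translate_ge t : mean P (fun w => rho (X w)) <= mean P (fun w => rho (X w - t)).
Proof.
rewrite -(ler_pM2l (ltr0n R 2)) -lee_fin mean_translate leeDr//.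
by apply: integral_ge0 => y _; rewrite lee_fin F_ge0.
Qed.

Hypothesis rho_strict : exists2 e : R, 0 < e &
  forall t v, `|t| < e -> `|t| < `|v| -> rho t < rho v.

(** The folded integrand of [mean_translate] is positive near the origin, where both
    the density and the loss are strictly monotone. *)
Let mean_translate_gt t : t != 0 ->
  mean P (fun w => rho (X w)) < mean P (fun w => rho (X w - t)).
Proof.
move=> t0; rewrite lt_neqAle mean_translate_ge andbT; apply/negP => /eqP eq0.
have [e e0 fe] := f_strict; have [e' e'0 re] := rho_strict.
have F0 : (\int[mu]_y (F t y)%:E = 0)%E.
  have := congr1 (fun z => z - (2 * mean P (fun w => rho (X w)))%:E)%E (mean_translate t).
  by rewrite -eq0 addeK// subee// => /esym.
pose m := Num.min (Num.min e e') (`|t| / 2).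
have m0 : 0 < m by rewrite !lt_min e0 e'0 divr_gt0// normr_gt0.
have F_gt0 y : `|y| < m -> 0 < F t y.
  rewrite !lt_min => /andP[/andP[ye ye'] yt].
  have yty : `|y| < `|t - y|.
    have := lerB_dist t y; lra.
  rewrite /F mulr_gt0// subr_gt0; first by rewrite re// distrC.
  have [tye|tye] := ltP `|t - y| e; first exact: fe.
  have y0 := normr_ge0 y.
  have ve : `|(`|y| + e) / 2| = (`|y| + e) / 2 by apply: ger0_norm; lra.
  have yv : `|y| < `|(`|y| + e) / 2| by rewrite ve; lra.
  have vt : `|(`|y| + e) / 2| < e by rewrite ve; lra.
  apply: le_lt_trans (fe _ _ yv vt); apply: f_mono.
  by rewrite ve; lra.
have : ae_eq mu setT (EFin \o F t) (cst 0%E).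
  apply/ae_eq_integral_abs => //; first exact: mFE.
  by rewrite -F0; apply: eq_integral => y _ /=; rewrite ger0_norm.
move=> [N [mN N0 FN]].
pose I : set R := `]- m, m[%classic.
have : (mu I <= mu N)%E.
  apply: le_measure; rewrite ?inE; [exact: measurable_itv|exact: mN|].
  apply: subset_trans FN => y; rewrite /I/= in_itv/= => ym.
  have ym' : `|y| < m by rewrite ltr_norml.
  by move=> /(_ Logic.I) [] /eqP; rewrite gt_eqF// F_gt0.
rewrite N0 /I lebesgue_measure_itv/=; case: ifP => [_|/negP[]].
  by rewrite -EFinD lee_fin; lra.
by rewrite lte_fin; lra.
Qed.

Hypothesis rho_lipschitz : exists L : R, forall y z, `|rho y - rho z| <= L * `|y - z|.

(** Identifiability: shifting a symmetric unimodal law away from its center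
    increases the mean loss, by compactness uniformly over intermediate shifts. *)
Lemma mean_translate_gap (c K : R) : 0 < c -> c <= K -> exists2 kappa : R, 0 < kappa &
  forall t, c <= `|t| -> `|t| <= K ->
  mean P (fun w => rho (X w)) + kappa <= mean P (fun w => rho (X w - t)).
Proof.
move=> c0 cK; pose g t := mean P (fun w => rho (X w - t)).
have cg : continuous g.
  have [L hL] := rho_lipschitz.
  have gL t v : `|g t - g v| <= L * `|t - v|.
    rewrite /g -meanB//; apply: mean_norm_le; first exact: bdmeasB.
    move=> w; apply: le_trans (hL _ _) _; rewrite distrC.
    by rewrite (_ : X w - v - (X w - t) = t - v)//; ring.
  move=> t; apply/cvgrPdist_le => e e0.
  have L1 : 0 < `|L| + 1 by rewrite ltr_wpDl.
  near=> v; apply: le_trans (gL _ _) _.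
  apply: (@le_trans _ _ ((`|L| + 1) * `|t - v|)).
    by rewrite ler_wpM2r// (le_trans (ler_norm L))// lerDl.
  rewrite mulrC -ler_pdivlMr//; near: v.
  by apply: cvgr_dist_le; [exact: cvg_id|rewrite divr_gt0].
have [t1 t1c ht1] := EVT_min cK (continuous_subspaceT cg).
have NcK : - K <= - c by rewrite lerN2.
have [t2 t2c ht2] := EVT_min NcK (continuous_subspaceT cg).
have g1 : mean P (fun w => rho (X w)) < g t1.
  by apply: mean_translate_gt; move: t1c; rewrite in_itv/= => /andP[]; lra.
have g2 : mean P (fun w => rho (X w)) < g t2.
  by apply: mean_translate_gt; move: t2c; rewrite in_itv/= => /andP[]; lra.
exists (Num.min (g t1) (g t2) - mean P (fun w => rho (X w))).
  by rewrite subr_gt0 lt_min g1.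
move=> t ct tK; rewrite addrC subrK -/(g t) ge_min; apply/orP.
have [t0|t0] := leP 0 t.
  by left; apply: ht1; move: ct tK; rewrite ger0_norm// in_itv/= => -> ->.
right; apply: ht2; move: ct tK; rewrite ltr0_norm// in_itv/=; lra.
Unshelve. all: by end_near. Qed.

End symmetric_unimodal.

(** * Euclidean geometry *)

Section euclidean.
Variable R : realType.

Lemma cauchy_schwarz_sum (I : finType) (a b : I -> R) :
  (\sum_i a i * b i) ^+ 2 <= (\sum_i a i ^+ 2) * (\sum_i b i ^+ 2).
Proof.
have : 0 <= \sum_i \sum_j (a i * b j - a j * b i) ^+ 2.
  by apply: sumr_ge0 => i _; apply: sumr_ge0 => j _; exact: sqr_ge0.
have -> : \sum_i \sum_j (a i * b j - a j * b i) ^+ 2 =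
    \sum_i \sum_j a i ^+ 2 * b j ^+ 2 + \sum_i \sum_j b i ^+ 2 * a j ^+ 2
    - 2 * \sum_i \sum_j (a i * b i) * (a j * b j).
  rewrite mulr_sumr -big_split -sumrB; apply: eq_bigr => i _ /=.
  rewrite mulr_sumr -big_split -sumrB; apply: eq_bigr => j _ /=; ring.
rewrite -!big_distrlr/= (mulrC (\sum_i b i ^+ 2)) -expr2; lra.
Qed.

Lemma norm_sum_mul_le (I : finType) (a b : I -> R) :
  `|\sum_i a i * b i| <= Num.sqrt (\sum_i a i ^+ 2) * Num.sqrt (\sum_i b i ^+ 2).
Proof.
rewrite -sqrtrM ?sumr_ge0// => [|i _]; last exact: sqr_ge0.
by rewrite -sqrtr_sqr ler_wsqrtr// cauchy_schwarz_sum.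
Qed.

Variable p : nat.
Implicit Types v w z : 'cV[R]_p.

Lemma dotvE v w : dotv v w = \sum_j v j 0 * w j 0.
Proof. by rewrite /dotv mxE; apply: eq_bigr => j _; rewrite mxE. Qed.

Lemma dotvDr v w z : dotv v (w + z) = dotv v w + dotv v z.
Proof. by rewrite /dotv mulmxDr mxE. Qed.

Lemma dotvZr v k w : dotv v (k *: w) = k * dotv v w.
Proof. by rewrite /dotv -scalemxAr mxE. Qed.

Lemma dotvBr v w z : dotv v (w - z) = dotv v w - dotv v z.
Proof. by rewrite dotvDr -scaleN1r dotvZr mulN1r. Qed.

Lemma dotvC v w : dotv v w = dotv w v.
Proof. by rewrite !dotvE; apply: eq_bigr => j _; rewrite mulrC. Qed.

Lemma dotv0r v : dotv v 0 = 0.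
Proof. by rewrite /dotv mulmx0 mxE. Qed.

Lemma dotv_sumr (I : finType) v (w : I -> 'cV[R]_p) :
  dotv v (\sum_i w i) = \sum_i dotv v (w i).
Proof. by rewrite /dotv mulmx_sumr summxE. Qed.

Lemma l2norm_ge0 v : 0 <= l2norm v.
Proof. exact: sqrtr_ge0. Qed.

Lemma sqr_l2norm v : l2norm v ^+ 2 = \sum_j v j 0 ^+ 2.
Proof.
rewrite /l2norm sqr_sqrtr dotvE//; last by apply: sumr_ge0 => j _; rewrite -expr2 sqr_ge0.
Qed.

Lemma l2normE v : l2norm v = Num.sqrt (\sum_j v j 0 ^+ 2).
Proof. by rewrite -sqr_l2norm sqrtr_sqr ger0_norm// l2norm_ge0. Qed.

Lemma cauchy_schwarz_dotv v w : `|dotv v w| <= l2norm v * l2norm w.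
Proof. by rewrite dotvE !l2normE; exact: norm_sum_mul_le. Qed.

Lemma l2norm_eq0 v : l2norm v = 0 -> v = 0.
Proof.
move=> v0; have /eqP : \sum_j v j 0 ^+ 2 = 0 by rewrite -sqr_l2norm v0 expr0n.
rewrite psumr_eq0 => [/allP h|j _]; last exact: sqr_ge0.
apply/matrixP => j k; rewrite mxE ord1; apply/eqP; rewrite -sqrf_eq0.
by apply: h; rewrite mem_index_enum.
Qed.

Lemma l2normZ k v : l2norm (k *: v) = `|k| * l2norm v.
Proof.
rewrite !l2normE; under eq_bigr do rewrite mxE exprMn.
by rewrite -mulr_sumr sqrtrM ?sqr_ge0// sqrtr_sqr.
Qed.

End euclidean.

(** * Finite nets *)

Section clamp.
Variables (R : realType) (K : R).

Definition clamp (t : R) : R := Num.max (- K) (Num.min K t).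

Lemma clamp_id t : - K <= t -> t <= K -> clamp t = t.
Proof. by move=> h1 h2; rewrite /clamp (min_idPr h2) (max_idPr h1). Qed.

Lemma clamp_ge t : 0 <= K -> K <= t -> clamp t = K.
Proof. by move=> K0 Kt; rewrite /clamp (min_idPl Kt) max_r//; lra. Qed.

Lemma clamp_le t : 0 <= K -> t <= - K -> clamp t = - K.
Proof. by move=> K0 Kt; rewrite /clamp max_l// ge_min Kt orbT. Qed.

Lemma clamp_cases t : 0 <= K ->
  [\/ K <= t /\ clamp t = K, t <= - K /\ clamp t = - K
    | (- K <= t /\ t <= K) /\ clamp t = t].
Proof.
move=> K0; have [Kt|tK] := leP K t; first by apply: Or31; rewrite clamp_ge.
have [tNK|NKt] := leP t (- K); first by apply: Or32; rewrite clamp_le.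
by apply: Or33; rewrite clamp_id ?ltW.
Qed.

Lemma clamp_lipschitz s t : 0 <= K -> `|clamp s - clamp t| <= `|s - t|.
Proof.
move=> K0; wlog st : s t / s <= t.
  move=> h; have [/h//|/ltW/h] := leP s t; by rewrite distrC (distrC t).
rewrite (ler0_norm (x := s - t)) ?subr_le0// ler_norml.
by case: (clamp_cases s K0) => -[hs ->]; case: (clamp_cases t K0) => -[ht ->];
  apply/andP; split; lra.
Qed.

End clamp.

Section arrangement.
Variables (R : realType) (n p m : nat) (e : R) (x : 'I_n -> 'cV[R]_p).
Hypothesis e0 : 0 < e.
Hypothesis span : forall z, (forall i, dotv (x i) z = 0) -> z = 0.

Local Notation level k := ((k%:R - m%:R) * e).
Local Notation code := {ffun 'I_p -> 'I_n * 'I_(2 * m).+1}.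

(** The point at which the [p] hyperplanes selected by [f] meet; its value is
    arbitrary when they are not in general position. *)
Definition vertex (f : code) : 'cV[R]_p :=
  invmx (\matrix_(j < p) (x (f j).1)^T) *m \col_(j < p) level (nat_of_ord (f j).2).

Let in_cell (b w : 'cV[R]_p) := forall i (k : 'I_(2 * m).+1),
  (dotv (x i) b <= level k -> dotv (x i) w <= level k) /\
  (level k <= dotv (x i) b -> level k <= dotv (x i) w).

Let tight (w : 'cV[R]_p) : {set 'I_n * 'I_(2 * m).+1} :=
  [set ik : 'I_n * 'I_(2 * m).+1 | dotv (x ik.1) w == level (nat_of_ord ik.2)]%SET.

(** A point of the cell that can still move without leaving the hyperplanes it
    lies on moves until it meets a further one. *)
Let tight_grow b w z : in_cell b w -> z != 0 ->
  (forall ik, ik \in tight w -> dotv (x ik.1) z = 0) ->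
  exists2 w', in_cell b w' & (#|tight w| < #|tight w'|)%N.
Proof.
move=> wb z0 tz.
have [i0 xi0] : exists i, dotv (x i) z != 0.
  apply: contrapT => h; move/eqP: z0; apply; apply: span => i.
  by apply/eqP; apply: contrapT => /negP xz; apply: h; exists i.
pose time (z' : 'cV[R]_p) (ik : 'I_n * 'I_(2 * m).+1) :=
  (level (nat_of_ord ik.2) - dotv (x ik.1) w) / dotv (x ik.1) z'.
pose ik0 := (i0, ord0 : 'I_(2 * m).+1).
have time0 : time z ik0 != 0.
  rewrite mulf_neq0 ?invr_neq0// subr_eq0; apply/negP => /eqP h.
  have := tz ik0; rewrite inE/= -h eqxx => /(_ isT) xz.
  by move: xi0; rewrite xz eqxx.
have [z1 [z1z xz1 time1]] : exists z1,
    [/\ (forall ik, ik \in tight w -> dotv (x ik.1) z1 = 0),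
        dotv (x i0) z1 != 0 & 0 < time z1 ik0].
  have [h|h] := ltP 0 (time z ik0); first by exists z.
  exists (- z); split.
  - by move=> ik /tz h'; rewrite -scaleN1r dotvZr h' mulr0.
  - by rewrite -scaleN1r dotvZr mulN1r oppr_eq0.
  - move: time0 h; rewrite /time -(scaleN1r z) dotvZr mulN1r invrN mulrN => t0 h.
    by rewrite oppr_gt0 lt_neqAle t0.
pose good ik := (dotv (x ik.1) z1 != 0) && (0 < time z1 ik).
have g0 : good ik0 by rewrite /good xz1.
case: (arg_minP (time z1) g0) => ik1 /andP[xik1 t1] tmin.
set t := time z1 ik1 in t1 tmin.
have move_le (ik : 'I_n * 'I_(2 * m).+1) (s : R) : 0 <= s -> s < t -> dotv (x ik.1) w != level (nat_of_ord ik.2) ->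
    dotv (x ik.1) (w + s *: z1) != level (nat_of_ord ik.2).
  move=> s0 st nt; apply/negP => /eqP; rewrite dotvDr dotvZr => h.
  have xz : dotv (x ik.1) z1 != 0.
    by apply/negP => /eqP h'; move: nt; rewrite -h h' mulr0 addr0 eqxx.
  have s_eq : s = time z1 ik by rewrite /time -h addrAC subrr add0r mulfK.
  have sneq0 : s != 0.
    by apply/negP => /eqP h'; move: nt; rewrite -h h' mul0r addr0 eqxx.
  have := tmin ik; rewrite /good xz -s_eq lt_neqAle eq_sym sneq0 s0 => /(_ isT).
  by rewrite leNgt st.
exists (w + t *: z1).
  move=> i k; have [le1 le2] := wb i k.
  have [/eqP tk|ntk] := boolP ((i, k) \in tight w).
    have tk' : dotv (x i) w = level k by move: tk; rewrite inE => /eqP/eqP.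
    have -> : dotv (x i) (w + t *: z1) = dotv (x i) w.
      by rewrite dotvDr dotvZr (z1z (i, k)) ?mulr0 ?addr0//; apply/eqP.
    by [].
  rewrite inE/= in ntk.
  have cross : (dotv (x i) (w + t *: z1) - level k) * (dotv (x i) w - level k) < 0 ->
      False.
    set A := dotv (x i) w - level k; rewrite dotvDr dotvZr => h.
    have A0 : A != 0 by rewrite subr_eq0.
    set D := dotv (x i) z1 in h.
    have D0 : D != 0.
      by apply/negP => /eqP D0; move: h; rewrite D0 mulr0 addr0 -/A -expr2 ltNge sqr_ge0.
    have hk : (A + t * D) * A < 0 by move: h; rewrite addrAC.
    have A2 : 0 < A ^+ 2 by rewrite lt_neqAle eq_sym sqrf_eq0 A0 sqr_ge0.
    have tDA : A ^+ 2 < t * (- (D * A)) by move: hk; rewrite mulrDl -expr2; lra.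
    have DA : 0 < - (D * A) by move: (lt_trans A2 tDA); rewrite pmulr_rgt0.
    pose s := A ^+ 2 / (- (D * A)).
    have s0 : 0 < s by rewrite divr_gt0.
    have st : s < t by rewrite ltr_pdivrMr.
    have := move_le (i, k) s (ltW s0) st ntk; rewrite dotvDr dotvZr/= -/D => /eqP; apply.
    have -> : s = - A / D by rewrite /s; field; rewrite A0 D0.
    by rewrite mulfVK// /A; ring.
  have [lt_wk|gt_wk|eq_wk] := ltgtP (dotv (x i) w) (level k); last by rewrite eq_wk eqxx in ntk.
    split=> [_|/le2]; last by rewrite leNgt lt_wk.
    rewrite leNgt; apply/negP => h; apply: cross.
    by rewrite pmulr_rlt0 ?subr_gt0// subr_lt0.
  split=> [/le1|_]; first by rewrite leNgt gt_wk.
  rewrite leNgt; apply/negP => h; apply: cross.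
  by rewrite pmulr_llt0 ?subr_gt0// subr_lt0.
apply: proper_card; apply/properP; split.
  apply/fintype.subsetP => ik h; have := z1z _ h; move: h; rewrite !inE => /eqP h xz.
  by rewrite dotvDr dotvZr xz mulr0 addr0 h.
exists ik1; rewrite inE.
  by rewrite dotvDr dotvZr /t /time mulfVK// addrC subrK.
by apply/negP => h; move: xik1; rewrite z1z ?inE// eqxx.
Qed.

(** The number of tight hyperplanes is bounded, so a cell contains a point from which
    no direction is free, that is, at which the tight normals span the space. *)
Let tight_full b : exists2 w, in_cell b w &
  forall z, (forall ik, ik \in tight w -> dotv (x ik.1) z = 0) -> z = 0.
Proof.
pose Q N := `[< exists2 w, in_cell b w & #|tight w| = N >].
have [|N QN|N /asboolP[w wb wN] Nmax] := @ex_maxnP Q #|{: 'I_n * 'I_(2 * m).+1}|.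
- by exists #|tight b|; apply/asboolP; exists b => // i k; split.
- by move/asboolP: QN => [w _ <-]; exact: max_card.
exists w => // z tz; apply/eqP; apply: contrapT => /negP z0.
have [w' w'b] := tight_grow wb z0 tz.
rewrite wN ltnNge => /negP; apply; apply: Nmax; apply/asboolP; by exists w'.
Qed.

(** The vertices of the arrangement of the hyperplanes on which some [dotv (x i)]
    takes a grid value form a net whose size does not depend on the magnitude of
    the vectors: this is what allows the parameter to be unbounded. *)
Lemma arrangement_net b : exists f : code, forall i,
  `|clamp (m%:R * e) (dotv (x i) b) - clamp (m%:R * e) (dotv (x i) (vertex f))| <= e.
Proof.
have [w wb tw] := tight_full b.
pose tightb i := [exists k, (i, k) \in tight w].
pose A : 'M[R]_(n, p) := \matrix_(i, j) (if tightb i then x i j 0 else 0).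
have Az (z : 'cV[R]_p) : A *m z = 0 -> z = 0.
  move=> Az; apply: tw => -[i k] ik /=.
  have := congr1 (fun M : 'cV[R]_n => M i 0) Az; rewrite !mxE => <-.
  rewrite dotvE; apply: eq_bigr => j _; rewrite mxE.
  by rewrite (_ : tightb i)//; apply/existsP; exists k.
have fA : row_full A.
  have : cokermx A = 0.
    apply/matrixP => i j; rewrite mxE.
    have : col j (cokermx A) = 0 by apply: Az; rewrite colE mulmxA mulmx_coker mul0mx.
    by move=> /(congr1 (fun M : 'cV[R]_p => M i 0)); rewrite !mxE.
  move=> /(congr1 (@mxrank _ _ _)); rewrite mxrank_coker mxrank0 => /eqP.
  by rewrite subn_eq0 /row_full eqn_leq rank_leq_col.
pose sel j := fullrankfun fA j.
have Usel : rowsub sel A \in unitmx by exact: fullrowsub_unit.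
have tsel j : tightb (sel j).
  apply: contrapT => /negP nt.
  have := congr1 (fun M : 'M[R]_p => M j j) (mulmxV Usel); rewrite !mxE eqxx.
  rewrite big1 => [/esym/eqP|k _]; first by rewrite oner_eq0.
  by rewrite !mxE (negbTE nt) mul0r.
have /choice[kk hkk] : forall j, exists k, (sel j, k) \in tight w.
  by move=> j; have /existsP := tsel j.
pose f : code := [ffun j => (sel j, kk j)].
have fw : vertex f = w.
  rewrite /vertex (_ : \matrix_(j < p) _ = rowsub sel A); last first.
    by apply/matrixP => j k; rewrite !mxE ffunE/= tsel.
  rewrite (_ : \col_(j < p) _ = rowsub sel A *m w) ?mulKmx//.
  apply/matrixP => j k; rewrite !mxE ffunE/=.
  have := hkk j; rewrite inE/= => /eqP <-; rewrite dotvE ord1; apply: eq_bigr => l _.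
  by rewrite !mxE tsel.
exists f => i; rewrite fw.
have K0 : 0 <= m%:R * e by rewrite mulr_ge0 ?ler0n// ltW.
have lmax : level (nat_of_ord (ord_max : 'I_(2 * m).+1)) = m%:R * e.
  by rewrite /= natrM; ring.
have l0 : level (nat_of_ord (ord0 : 'I_(2 * m).+1)) = - (m%:R * e) by rewrite /=; ring.
have [hi|hi] := leP (m%:R * e) (dotv (x i) b).
  have [_] := wb i ord_max; rewrite lmax => /(_ hi) hw.
  by rewrite !clamp_ge// subrr normr0 ltW.
have [lo|lo] := leP (dotv (x i) b) (- (m%:R * e)).
  have [+ _] := wb i ord0; rewrite l0 => /(_ lo) hw.
  by rewrite !clamp_le// subrr normr0 ltW.
apply: le_trans (clamp_lipschitz _ _ K0) _.
set t := dotv (x i) b in hi lo *.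
pose k := Num.truncn (t / e + m%:R).
have t0 : 0 <= t / e + m%:R.
  by rewrite -(pmulr_lge0 _ e0) mulrDl divfK ?gt_eqF//; lra.
have /andP[k1 k2] := truncn_itv t0.
have k1' : level k <= t.
  by rewrite -ler_pdivlMr// lerBlDr.
have k2' : t < level k.+1.
  by rewrite -ltr_pdivrMr// ltrBrDr.
have km : (k < 2 * m)%N.
  rewrite -(ltr_nat R); apply: le_lt_trans k1 _.
  by rewrite -(ltr_pM2r e0) mulrDl divfK ?gt_eqF// natrM; lra.
have [_] := wb i (Ordinal (ltnW km : (k < (2 * m).+1)%N)).
rewrite /= => /(_ k1') w1.
have [+ _] := wb i (Ordinal (km : (k.+1 < (2 * m).+1)%N)).
rewrite /= => /(_ (ltW k2')) w2.
have e1 : level k.+1 = level k + e by rewrite -natr1; ring.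
rewrite ler_norml; apply/andP; split; lra.
Qed.

End arrangement.

Section grid.
Variables (R : realType) (p m : nat).
Hypothesis m0 : (0 < m)%N.

Definition grid_point (f : {ffun 'I_p -> 'I_(2 * m).+1}) : 'cV[R]_p :=
  \col_j ((f j)%:R / m%:R - 1).

(** Rounding each coordinate down to the grid of mesh [1 / m]. *)
Lemma grid_net (z : 'cV[R]_p) : l2norm z <= 1 -> exists f, forall v : 'cV[R]_p,
  `|dotv v z - dotv v (grid_point f)| <= l2norm v * (Num.sqrt p%:R / m%:R).
Proof.
move=> z1; have mR : 0 < m%:R :> R by rewrite ltr0n.
have zj j : `|z j 0| <= 1.
  apply: le_trans z1; rewrite l2normE -sqrtr_sqr ler_wsqrtr// (bigD1 j)//= lerDl.
  by apply: sumr_ge0 => k _; exact: sqr_ge0.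
have bd j : (Num.truncn ((z j 0 + 1) * m%:R)%R < (2 * m).+1)%N.
  rewrite ltnS -(ler_nat R); have := zj j; rewrite ler_norml => /andP[h1 h2].
  apply: (@le_trans _ _ ((z j 0 + 1) * m%:R)).
    have t0 : 0 <= (z j 0 + 1) * m%:R by apply: mulr_ge0; [lra|exact: ltW].
    have /andP[h _] := truncn_itv t0; exact: h.
  by rewrite natrM ler_pM2r//; lra.
exists [ffun j => Ordinal (bd j)] => v; rewrite -dotvBr.
apply: le_trans (cauchy_schwarz_dotv _ _) _; rewrite ler_wpM2l ?l2norm_ge0//.
have rhs0 : 0 <= Num.sqrt p%:R / m%:R :> R by rewrite divr_ge0 ?sqrtr_ge0 ?ler0n.
rewrite l2normE -(ger0_norm rhs0) -sqrtr_sqr; apply: ler_wsqrtr.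
rewrite expr_div_n sqr_sqrtr ?ler0n//.
apply: (@le_trans _ _ (\sum_(j < p) (m%:R^-1) ^+ 2)); last first.
  by rewrite sumr_const card_ord -[leLHS]mulr_natl exprVn.
apply: ler_sum => j _; rewrite !mxE ffunE/=.
have := zj j; rewrite ler_norml => /andP[h1 h2].
have t0 : 0 <= (z j 0 + 1) * m%:R by apply: mulr_ge0; [lra|exact: ltW].
have /andP[] := truncn_itv t0; set k := Num.truncn _ => k1 k2.
have -> : z j 0 - (k%:R / m%:R - 1) = ((z j 0 + 1) * m%:R - k%:R) / m%:R.
  by field; rewrite gt_eqF.
rewrite expr_div_n exprVn ler_piMl ?invr_ge0 ?sqr_ge0//.
by rewrite expr_le1//; move: k2; rewrite -natr1; lra.
Qed.

End grid.

(** * Calculus *)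

Section calculus.
Variable R : realType.
Implicit Types (f df : R -> R) (x y h K c t : R).

Lemma mvt_between f df x y : x <= y ->
  (forall c, x <= c <= y -> is_derive c 1 f (df c)) ->
  exists2 c, x <= c <= y & f y - f x = df c * (y - x).
Proof.
move=> xy fdf; have [c cxy ->] : exists2 c, c \in `[x, y]%R & f y - f x = df c * (y - x).
  apply: MVT_segment => //.
    by move=> c; rewrite in_itv/= => /andP[h1 h2]; apply: fdf; rewrite !ltW.
  apply: derivable_within_continuous => c; rewrite in_itv/= => cxy.
  by have [] := fdf _ cxy.
by exists c => //; move: cxy; rewrite in_itv.
Qed.

Lemma mvt f df x y : (forall c, is_derive c 1 f (df c)) ->
  exists2 c, `|c - x| <= `|y - x| & f y - f x = df c * (y - x).
Proof.
move=> fdf; have [xy|/ltW yx] := leP x y.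
  have [c /andP[xc cy] ->] := mvt_between xy (fun c _ => fdf c).
  by exists c => //; rewrite !ger0_norm ?subr_ge0//; lra.
have [c /andP[xc cy] e] := mvt_between yx (fun c _ => fdf c).
exists c; last by rewrite -opprB e; ring.
by rewrite !ler0_norm ?subr_le0//; lra.
Qed.

Lemma lipschitz_of_derive f df K : (forall c, is_derive c 1 f (df c)) ->
  (forall c, `|df c| <= K) -> forall x y, `|f x - f y| <= K * `|x - y|.
Proof.
move=> fdf dfK x y; have [c _ ->] := mvt y x fdf.
by rewrite normrM ler_wpM2r.
Qed.

Lemma is_derive_addl x t : is_derive t (1 : R) (fun t => x + t) 1.
Proof.
have : is_derive t (1 : R) (cst x + id) (0 + 1) by exact: is_deriveD.
by rewrite add0r.
Qed.

Lemma is_derive_mull x t : is_derive t (1 : R) (fun t => x * t) x.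
Proof.
have : is_derive t (1 : R) (x \*: (id : R -> R)) (x *: 1) by exact: is_deriveZ.
by rewrite /GRing.scale/= mulr1.
Qed.

Lemma taylor1 f df K : 0 <= K -> (forall c, is_derive c 1 f (df c)) ->
  (forall x y, `|df x - df y| <= K * `|x - y|) ->
  forall x h, `|f (x + h) - f x - h * df x| <= K * h ^+ 2.
Proof.
move=> K0 fdf dfL x h; have [c] := mvt x (x + h) fdf.
rewrite (addrC x) addrK => cx ->.
rewrite (mulrC _ h) -mulrBr normrM; apply: (@le_trans _ _ (`|h| * (K * `|h|))).
  by rewrite ler_wpM2l//; apply: le_trans (dfL _ _) _; rewrite ler_wpM2l.
by rewrite -[h ^+ 2]real_normK ?num_real// expr2; apply: eq_ler; ring.
Qed.

(** The remainder vanishes at 0 together with its derivative in [h], which is the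
    remainder of [taylor1] for [df]. *)
Lemma taylor2 f df ddf K : 0 <= K -> (forall c, is_derive c 1 f (df c)) ->
  (forall c, is_derive c 1 df (ddf c)) ->
  (forall x y, `|ddf x - ddf y| <= K * `|x - y|) ->
  forall x h, `|f (x + h) - f x - h * df x - h ^+ 2 / 2 * ddf x| <= K * `|h| ^+ 3.
Proof.
move=> K0 fdf dfddf ddfL x h.
pose g t := f (x + t) - t * df x - t ^+ 2 / 2 * ddf x.
pose dg t := df (x + t) - df x - t * ddf x.
have gdg t : is_derive t 1 g (dg t).
  have fx : is_derive t 1 (fun t => f (x + t)) (df (x + t)).
    have := @is_derive1_comp _ f (fun t => x + t) t (df (x + t)) 1 (fdf _) (is_derive_addl _ _).
    by rewrite mulr1.
  have dl : is_derive t 1 (fun t => t * df x) (df x).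
    by under eq_fun do rewrite mulrC; exact: is_derive_mull.
  have dq : is_derive t 1 (fun t => t ^+ 2 / 2 * ddf x) (t * ddf x).
    have -> : (fun t => t ^+ 2 / 2 * ddf x) = id * (fun t => ddf x / 2 * t).
      by apply/funext => s; rewrite /= fctE/=; field.
    apply: is_derive_eq (is_deriveM (is_derive_id t (1 : R)) (is_derive_mull (ddf x / 2) t)) _.
    by rewrite /GRing.scale/=; field.
  exact: is_deriveB (is_deriveB fx dl) dq.
have [c] := mvt 0 h gdg; rewrite !subr0 => ch.
rewrite /g addr0 !mul0r expr0n !mul0r !subr0 => gh.
have -> : f (x + h) - f x - h * df x - h ^+ 2 / 2 * ddf x = dg c * h.
  by rewrite -gh; ring.
have dgc : `|dg c| <= K * `|c| ^+ 2.
  by rewrite /dg real_normK ?num_real//; exact: taylor1.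
rewrite normrM exprSr mulrA ler_wpM2r//; apply: le_trans dgc _.
by rewrite ler_wpM2l// lerXn2r// nnegrE.
Qed.

(** The chain rule along [q = 1 / s] shows that bounds on [t * f' t] make
    [s |-> f (u / s)] Lipschitz uniformly in [u]. *)
Lemma lipschitz_scale f df K (s0 : R) : 0 < s0 -> 0 <= K ->
  (forall c, is_derive c 1 f (df c)) -> (forall c, `|c * df c| <= K) ->
  forall u s s', s0 / 2 <= s -> s <= 2 * s0 -> s0 / 2 <= s' -> s' <= 2 * s0 ->
  `|f (u / s) - f (u / s')| <= 8 * K / s0 * `|s - s'|.
Proof.
move=> s00 K0 fdf dfK u s s'.
wlog ss' : s s' / s' <= s.
  move=> h; have [h1|/ltW h1] := leP s' s; first exact: h.
  by move=> *; rewrite distrC (distrC s); apply: h.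
move=> sa sb sa' sb'; have sp : 0 < s by lra. have sp' : 0 < s' by lra.
have qq : s^-1 <= s'^-1 by rewrite lef_pV2.
have [c /andP[c1 c2] fE] : exists2 c, s^-1 <= c <= s'^-1 &
    f (u * s'^-1) - f (u * s^-1) = (u * df (u * c)) * (s'^-1 - s^-1).
  apply: (mvt_between (f := fun q => f (u * q)) (df := fun q => u * df (u * q))) => // c _.
  have := @is_derive1_comp _ f (fun q => u * q) c (df (u * c)) u (fdf _) (is_derive_mull _ _).
  by rewrite mulrC.
have c0 : 0 < c by apply: lt_le_trans c1; rewrite invr_gt0.
rewrite distrC fE normrM.
have -> : s'^-1 - s^-1 = (s - s') / (s * s') by field; rewrite !gt_eqF.
have cs : 1 <= c * (2 * s0).
  apply: (@le_trans _ _ (s^-1 * s)); first by rewrite mulVf ?gt_eqF.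
  by rewrite ler_pM// ?invr_ge0 ltW.
have udf : `|u * df (u * c)| <= K * (2 * s0).
  have : `|u * df (u * c)| * c <= K.
    by rewrite -[X in _ * X](gtr0_norm c0) -normrM mulrAC dfK.
  move=> h; apply: (@le_trans _ _ (`|u * df (u * c)| * (c * (2 * s0)))).
    by rewrite ler_peMr.
  by rewrite [leLHS]mulrA ler_wpM2r//; lra.
have inv : `|(s - s') / (s * s')| <= `|s - s'| * (4 / s0 ^+ 2).
  rewrite normrM ler_wpM2l// gtr0_norm ?invr_gt0 ?mulr_gt0//.
  rewrite -[4 / _]invf_div lef_pV2 ?posrE ?mulr_gt0 ?divr_gt0 ?exprn_gt0//.
  have -> : s0 ^+ 2 / 4 = (s0 / 2) * (s0 / 2) by field.
  by rewrite ler_pM//; lra.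
apply: (@le_trans _ _ (K * (2 * s0) * (`|s - s'| * (4 / s0 ^+ 2)))).
  by rewrite ler_pM.
by apply: eq_ler; field; rewrite gt_eqF.
Qed.

Lemma derive_even f df : (forall c, is_derive c 1 f (df c)) ->
  (forall t, f (- t) = f t) -> forall t, df (- t) = - df t.
Proof.
move=> fdf fe t.
have h1 : is_derive t 1 f (- df (- t)).
  have := @is_derive1_comp _ f (fun q => - q) t (df (- t)) (- 1) (fdf _) _.
  rewrite mulrN1 (_ : f \o -%R = f); last by apply/funext => z /=; rewrite fe.
  by apply; apply: is_derive_eq.
have e1 := @derive_val _ _ _ _ _ _ _ h1; have e2 := @derive_val _ _ _ _ _ _ _ (fdf t).
by rewrite -e2 e1 opprK.
Qed.

(** First order condition, read off the quadratic upper bound. *)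
Lemma critical_of_quadratic_bound (D C : R) :
  (forall t, 0 <= t * D + C * t ^+ 2) -> D = 0.
Proof.
move=> h; have C0 : 0 < `|C| + 1 by rewrite ltr_wpDl.
have := h (- D / (`|C| + 1) / 2); set t := _ / 2.
have tE : D = - 2 * (`|C| + 1) * t by rewrite /t; field; rewrite gt_eqF.
move=> ht; have Ct : C * t ^+ 2 <= (`|C| + 1) * t ^+ 2.
  by rewrite ler_wpM2r ?sqr_ge0// (le_trans (ler_norm C))// lerDl.
have t2 : t ^+ 2 <= 0.
  rewrite -(pmulr_rle0 _ C0); move: ht; rewrite tE; nra.
have /eqP : t ^+ 2 = 0 by apply/eqP; rewrite eq_le t2 sqr_ge0.
by rewrite sqrf_eq0 => /eqP t0; rewrite tE t0 mulr0.
Qed.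

Lemma bounded_fun_le f : bounded_fun f -> exists2 K : R, 0 <= K & forall x, `|f x| <= K.
Proof.
move=> /pinfty_ex_gt0[K K0 hK]; exists K; first exact: ltW.
by move=> x; exact: hK.
Qed.

End calculus.

(** * Processes indexed by the scale *)

Section dyadic.
Variable R : realType.

Definition dyadic (A l : R) (j k : nat) : R := A + l * (k%:R / 2 ^+ j).

Definition dyadic_variation (D : R -> R) (A l : R) (j : nat) : R :=
  \sum_(k < 2 ^ j) (D (dyadic A l j k.+1) - D (dyadic A l j k)) ^+ 2.

Lemma dyadic_double (A l : R) j k : dyadic A l j.+1 k.*2 = dyadic A l j k.
Proof.
rewrite /dyadic -muln2 natrM exprSr; congr (_ + _ * _).
by rewrite invfM mulrACA divff ?mulr1// pnatr_eq0.
Qed.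

Lemma dyadic_variation_ge0 D (A l : R) j : 0 <= dyadic_variation D A l j.
Proof. by apply: sumr_ge0 => k _; exact: sqr_ge0. Qed.

Lemma dyadic_increment_le D (A l : R) j k : (k < 2 ^ j)%N ->
  `|D (dyadic A l j k.+1) - D (dyadic A l j k)| <= Num.sqrt (dyadic_variation D A l j).
Proof.
move=> kj; rewrite -sqrtr_sqr ler_wsqrtr//.
rewrite /dyadic_variation (bigD1 (Ordinal kj))//= lerDl.
by apply: sumr_ge0 => i _; exact: sqr_ge0.
Qed.

(** A dyadic point of level [j + 1] is at most one step away from one of level [j]. *)
Lemma dyadic_chain D (A l : R) J k : (k <= 2 ^ J)%N ->
  `|D (dyadic A l J k) - D A| <= \sum_(j < J.+1) Num.sqrt (dyadic_variation D A l j).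
Proof.
elim: J k => [|J ih] k kJ.
  rewrite big_ord_recl big_ord0 addr0; case: k kJ => [|[|//]] _.
    by rewrite /dyadic mul0r mulr0 addr0 subrr normr0 sqrtr_ge0.
  have := @dyadic_increment_le D A l 0 0 isT.
  by rewrite {2}/dyadic mul0r mulr0 addr0.
rewrite big_ord_recr/=; have kE := odd_double_half k.
have half_le : (k./2 <= 2 ^ J)%N.
  by rewrite -leq_double -[(2 ^ J).*2]mul2n -expnS (leq_trans _ kJ)// -[leqRHS]kE leq_addl.
case: (boolP (odd k)) kE => ok /=; rewrite ?add0n ?add1n => kE; last first.
  rewrite -kE dyadic_double; apply: le_trans (ih _ half_le) _.
  by rewrite lerDl sqrtr_ge0.
rewrite -(subrK (D (dyadic A l J.+1 k./2.*2)) (D (dyadic A l J.+1 k))) -addrA.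
rewrite [leRHS]addrC; apply: le_trans (ler_normD _ _) _; apply: lerD.
  by rewrite -{1}kE; apply: dyadic_increment_le; rewrite kE.
by rewrite dyadic_double; exact: ih.
Qed.

Lemma geometric_le (q : R) J : 0 <= q -> q < 1 -> \sum_(j < J) q ^+ j <= (1 - q)^-1.
Proof.
move=> q0 q1; have q1' : 0 < 1 - q by rewrite subr_gt0.
rewrite -(ler_pM2l q1') divff ?gt_eqF//.
have := subrX1 q J; have := exprn_ge0 J q0; set S := \sum_(_ < _) _; lra.
Qed.

(** The weights [(3 / 4) ^ j] balance the number [2 ^ j] of increments of level [j]
    against their variance, of order [4 ^ - j]. *)
Definition chaining_bound (D : R -> R) (A l : R) (J : nat) : R :=
  4 * \sum_(j < J.+1) (4 / 3) ^+ j * dyadic_variation D A l j.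

Lemma chaining_bound_ge0 D A l J : 0 <= chaining_bound D A l J.
Proof.
rewrite /chaining_bound mulr_ge0// sumr_ge0// => j _.
by rewrite mulr_ge0 ?dyadic_variation_ge0// exprn_ge0//; lra.
Qed.

Lemma dyadic_chain_sqr D (A l : R) J k : (k <= 2 ^ J)%N ->
  (D (dyadic A l J k) - D A) ^+ 2 <= chaining_bound D A l J.
Proof.
move=> kJ; have := dyadic_chain D A l kJ; set S := \sum_(j < _) _ => DS.
have S0 : 0 <= S by apply: sumr_ge0 => j _; exact: sqrtr_ge0.
apply: (@le_trans _ _ (S ^+ 2)).
  by rewrite -[leLHS]real_normK ?num_real// lerXn2r// nnegrE.
have q34 : 0 <= 3 / 4 :> R by lra.
have SE : S = \sum_(j < J.+1) Num.sqrt ((3 / 4) ^+ j) *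
    Num.sqrt ((4 / 3) ^+ j * dyadic_variation D A l j).
  apply: eq_bigr => j _; rewrite -sqrtrM ?exprn_ge0// mulrA -exprMn.
  by rewrite (_ : 3 / 4 * (4 / 3) = 1) ?expr1n ?mul1r//; field.
rewrite SE; apply: le_trans (cauchy_schwarz_sum _ _) _.
rewrite /chaining_bound; apply: ler_pM.
- by apply: sumr_ge0 => j _; exact: sqr_ge0.
- by apply: sumr_ge0 => j _; exact: sqr_ge0.
- under eq_bigr do rewrite sqr_sqrtr ?exprn_ge0//.
  apply: le_trans (geometric_le _ q34 _) _; first by lra.
  by rewrite (_ : 1 - 3 / 4 = 4^-1 :> R) ?invrK//; field.
- apply: ler_sum => j _; rewrite sqr_sqrtr// mulr_ge0 ?dyadic_variation_ge0//.
Qed.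

(** Between the points of the last level, the Lipschitz bound takes over from the
    chaining. *)
Lemma chaining_interval D (A l Lam : R) J s : 0 <= Lam ->
  (forall x y, `|x - A| <= `|l| -> `|y - A| <= `|l| -> `|D x - D y| <= Lam * `|x - y|) ->
  (exists2 r, 0 <= r <= 1 & s = A + l * r) ->
  (D s - D A) ^+ 2 <= 2 * chaining_bound D A l J + 2 * (Lam * `|l| / 2 ^+ J) ^+ 2.
Proof.
move=> Lam0 DL [r /andP[r0 r1] ->].
have p0 : 0 < 2 ^+ J :> R by rewrite exprn_gt0.
have t0 : 0 <= r * 2 ^+ J by rewrite mulr_ge0// ltW.
have /andP[k1 k2] := truncn_itv t0; set k := Num.truncn _ in k1 k2.
have kJ : (k <= 2 ^ J)%N.
  rewrite -(ler_nat R) natrX; apply: le_trans k1 _.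
  by rewrite ler_piMl// ltW.
have q1 : k%:R / 2 ^+ J <= r by rewrite ler_pdivrMr.
have q2 : r < k%:R / 2 ^+ J + (2 ^+ J)^-1.
  by rewrite -[X in _ + X]mul1r -mulrDl natr1 ltr_pdivlMr.
have q0 : 0 <= k%:R / 2 ^+ J :> R by rewrite divr_ge0 ?ler0n// ltW.
set q := k%:R / 2 ^+ J in q0 q1 q2.
have near1 : `|D (A + l * r) - D (A + l * q)| <= Lam * `|l| / 2 ^+ J.
  apply: le_trans (DL _ _ _ _) _.
  - by rewrite addrAC subrr add0r normrM ler_piMr// ger0_norm.
  - rewrite addrAC subrr add0r normrM ler_piMr// ger0_norm//; lra.
  - rewrite -mulrA ler_wpM2l// (_ : _ - _ = l * (r - q)); last by ring.
    by rewrite normrM ler_wpM2l// ger0_norm ?subr_ge0//; lra.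
have := @dyadic_chain_sqr D A l J k kJ; rewrite /dyadic -/q => h.
have near2 : (D (A + l * r) - D (A + l * q)) ^+ 2 <= (Lam * `|l| / 2 ^+ J) ^+ 2.
  by rewrite -[leLHS]real_normK ?num_real// lerXn2r// nnegrE (le_trans _ near1).
set a := D (A + l * r) in near2 *; set b := D (A + l * q) in h near2 *.
have : 0 <= (a - b - (b - D A)) ^+ 2 by exact: sqr_ge0.
nra.
Qed.

End dyadic.

Section scale_process.
Context d (T : measurableType d) (R : realType) (P : probability T R).
Variables (n : nat) (X : 'I_n -> {RV P >-> R}).
Hypothesis indX : mutually_independent X.
Variables (h : R -> R -> R) (s0 delta L K : R).
Hypotheses (delta0 : 0 <= delta) (L0 : 0 <= L).
Hypothesis mh : forall s, measurable_fun setT (h ^~ s).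
Hypothesis hK : forall y s, `|h y s| <= K.
Hypothesis h0 : forall i s, mean P (fun w => h (X i w) s) = 0.
Hypothesis hL : forall y s s', `|s - s0| <= delta -> `|s' - s0| <= delta ->
  `|h y s - h y s'| <= L * `|s - s'|.
Variables (C : finType) (v : C -> 'I_n -> R).

Let D c w s := \sum_i v c i * h (X i w) s.
Let V := \sum_c \sum_i v c i ^+ 2.

Let bh i s : bdmeas (fun w => h (X i w) s).
Proof. by split; [exact: (measurableT_comp (mh s))|exists K]. Qed.

Let bD c s : bdmeas (fun w => D c w s).
Proof. by apply: bdmeas_sum => i _; exact: bdmeasZ. Qed.

Let bvar c l j : bdmeas (fun w => dyadic_variation (D c w) s0 l j).
Proof. by apply: bdmeas_sum => k _; apply: bdmeasX; exact: bdmeasB. Qed.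

Let bbound c l : bdmeas (fun w => chaining_bound (D c w) s0 l n).
Proof. by apply: bdmeasZ; apply: bdmeas_sum => j _; exact: bdmeasZ. Qed.

Let mean_increment c s s' : `|s - s0| <= delta -> `|s' - s0| <= delta ->
  mean P (fun w => (D c w s - D c w s') ^+ 2) <=
  L ^+ 2 * `|s - s'| ^+ 2 * \sum_i v c i ^+ 2.
Proof.
move=> hs hs'; rewrite -exprMn.
have := @mean_sqr_sum_indep _ _ _ P _ _ indX (v c) (fun i y => h y s - h y s')
  (L * `|s - s'|).
have DE w : D c w s - D c w s' = \sum_i v c i * (h (X i w) s - h (X i w) s').
  by rewrite -sumrB; apply: eq_bigr => i _; rewrite mulrBr.
under [X in _ -> mean P X <= _]eq_fun do rewrite DE.
apply.
- by move=> i; exact: measurable_funB.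
- by move=> i y; exact: hL.
- by move=> i; rewrite meanB// !h0 subrr.
Qed.

Let mean_bound c l : `|l| = delta ->
  mean P (fun w => chaining_bound (D c w) s0 l n) <=
  12 * (L ^+ 2 * delta ^+ 2 * \sum_i v c i ^+ 2).
Proof.
move=> ld; rewrite /chaining_bound meanZ; last by apply: bdmeas_sum => j _; exact: bdmeasZ.
rewrite (_ : 12 = 4 * 3); last by ring.
rewrite -[leRHS]mulrA ler_pM2l//.
rewrite mean_sum; last by move=> j _; exact: bdmeasZ.
set B := L ^+ 2 * _ * _.
have B0 : 0 <= B by rewrite !mulr_ge0 ?sqr_ge0// sumr_ge0// => i _; exact: sqr_ge0.
have var j : mean P (fun w => dyadic_variation (D c w) s0 l j) <= B * 2^-1 ^+ j.
  rewrite /dyadic_variation mean_sum; last by move=> k _; apply: bdmeasX; exact: bdmeasB.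
  have pj : 0 < 2 ^+ j :> R by rewrite exprn_gt0.
  have in_ball k : (k <= 2 ^ j)%N -> `|dyadic s0 l j k - s0| <= delta.
    move=> kj; rewrite /dyadic addrAC subrr add0r normrM ld ler_piMr//.
    have q0 : 0 <= k%:R / 2 ^+ j :> R by rewrite divr_ge0 ?ler0n// ltW.
    by rewrite ger0_norm// ler_pdivrMr// mul1r -natrX ler_nat.
  apply: (@le_trans _ _ (\sum_(k < 2 ^ j) B * (2^-1 ^+ j) ^+ 2)).
    apply: ler_sum => k _.
    apply: le_trans (mean_increment c (in_ball k.+1 (ltn_ord k)) (in_ball k (ltnW (ltn_ord k)))) _.
    rewrite /B (_ : _ - _ = l * 2^-1 ^+ j); last first.
      by rewrite /dyadic -natr1 exprVn; ring.
    rewrite normrM ld exprMn real_normK ?num_real//.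
    by apply: eq_ler; ring.
  rewrite sumr_const card_ord -[leLHS]mulr_natr natrX exprVn -mulrA ler_wpM2l//.
  by rewrite expr2 -mulrA mulVf ?mulr1// gt_eqF.
apply: (@le_trans _ _ (\sum_(j < n.+1) B * (2 / 3) ^+ j)).
  apply: ler_sum => j _; rewrite meanZ//.
  apply: (@le_trans _ _ ((4 / 3) ^+ j * (B * 2^-1 ^+ j))).
    by rewrite ler_wpM2l// exprn_ge0//; lra.
  by rewrite mulrCA -exprMn (_ : 4 / 3 * 2^-1 = 2 / 3)//; field.
rewrite -mulr_sumr mulrC ler_wpM2r//.
apply: le_trans (geometric_le _ _ _) _; [lra|lra|].
by rewrite (_ : 1 - 2 / 3 = 3^-1 :> R) ?invrK//; field.
Qed.

(** The increments of the process away from [s0] are of the order of [delta]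
    uniformly over the interval, so a random scale may be substituted. *)
Lemma scale_process_bound : exists W : T -> R,
  [/\ bdmeas W, forall w, 0 <= W w, mean P W <= 50 * (L ^+ 2 * delta ^+ 2 * V)
    & forall w s, `|s - s0| <= delta ->
      \sum_c (\sum_i v c i * h (X i w) s - \sum_i v c i * h (X i w) s0) ^+ 2 <= W w].
Proof.
pose B := L ^+ 2 * delta ^+ 2 * V.
have B0 : 0 <= B.
  rewrite !mulr_ge0 ?sqr_ge0// sumr_ge0// => c _.
  by rewrite sumr_ge0// => i _; exact: sqr_ge0.
exists (fun w => \sum_c (2 * (chaining_bound (D c w) s0 delta n +
  chaining_bound (D c w) s0 (- delta) n)) + 2 * B); split.
- apply: bdmeasD; last exact: bdmeas_cst.
  by apply: bdmeas_sum => c _; apply: bdmeasZ; exact: bdmeasD.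
- move=> w; apply: addr_ge0; last exact: mulr_ge0.
  by apply: sumr_ge0 => c _; rewrite mulr_ge0// addr_ge0// chaining_bound_ge0.
- have b1 e : bdmeas (fun w => 2 * (chaining_bound (D e w) s0 delta n +
    chaining_bound (D e w) s0 (- delta) n)) by apply: bdmeasZ; exact: bdmeasD.
  rewrite meanD; [|by apply: bdmeas_sum => c _|exact: bdmeas_cst].
  rewrite mean_cst mean_sum//.
  have -> : 50 * (L ^+ 2 * delta ^+ 2 * V) =
      \sum_c 2 * (12 * (L ^+ 2 * delta ^+ 2 * \sum_i v c i ^+ 2) +
        12 * (L ^+ 2 * delta ^+ 2 * \sum_i v c i ^+ 2)) + 2 * B.
    under eq_bigr do rewrite -mulrDl mulrA mulrA.
    by rewrite -mulr_sumr -/V /B; ring.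
  rewrite lerD2r; apply: ler_sum => c _.
  rewrite meanZ; last exact: bdmeasD.
  rewrite meanD// ler_pM2l// lerD// mean_bound//; first by rewrite ger0_norm.
  by rewrite normrN ger0_norm.
- move=> w s sd.
  apply: (@le_trans _ _ (\sum_c (2 * (chaining_bound (D c w) s0 delta n +
      chaining_bound (D c w) s0 (- delta) n) +
      2 * (L ^+ 2 * delta ^+ 2 * \sum_i v c i ^+ 2)))); last first.
    by rewrite big_split/= lerD2l -!mulr_sumr.
  apply: ler_sum => c _.
  pose Lam := \sum_i `|v c i| * L.
  have Lam0 : 0 <= Lam by apply: sumr_ge0 => i _; rewrite mulr_ge0.
  have DL (l x y : R) : `|l| = delta -> `|x - s0| <= `|l| -> `|y - s0| <= `|l| ->
      `|D c w x - D c w y| <= Lam * `|x - y|.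
    move=> -> hx hy; rewrite /D -sumrB; apply: le_trans (ler_norm_sum _ _ _) _.
    rewrite mulr_suml; apply: ler_sum => i _.
    by rewrite -mulrBr normrM -mulrA ler_wpM2l// hL.
  have res (l : R) : `|l| = delta -> (Lam * `|l| / 2 ^+ n) ^+ 2 <= L ^+ 2 * delta ^+ 2 * \sum_i v c i ^+ 2.
    move=> ->.
    have p0 : 0 < 2 ^+ n :> R by rewrite exprn_gt0.
    have LamE : Lam = (\sum_i 1 * `|v c i|) * L.
      by rewrite mulr_suml; apply: eq_bigr => i _; rewrite mul1r.
    have n2 : n%:R <= (2 ^+ n) ^+ 2 :> R.
      have : n%:R <= 2 ^+ n :> R by rewrite -natrX ler_nat ltnW// ltn_expl.
      move=> /le_trans; apply; rewrite expr2 ler_peMr ?(ltW p0)//.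
      by rewrite exprn_ege1//; lra.
    have := cauchy_schwarz_sum (fun _ : 'I_n => 1) (fun i => `|v c i|).
    under [X in _ <= X * _]eq_bigr do rewrite expr1n.
    rewrite sumr_const card_ord; under [X in _ <= _ * X]eq_bigr do rewrite real_normK ?num_real//.
    set S1 := \sum_i 1 * _; set S2 := \sum_i v c i ^+ 2 => cs.
    rewrite LamE !exprMn exprVn; rewrite ler_pdivrMr ?exprn_gt0//.
    rewrite (_ : S1 ^+ 2 * L ^+ 2 * delta ^+ 2 = L ^+ 2 * delta ^+ 2 * S1 ^+ 2); last by ring.
    rewrite -!mulrA; do 4 (rewrite ler_wpM2l//).
      apply: le_trans cs _; rewrite mulrC ler_wpM2l//.
    by rewrite sumr_ge0// => i _; exact: sqr_ge0.
  have cb l := chaining_bound_ge0 (D c w) s0 l n.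
  have [|hs] := leP s0 s.
    move=> hs; have := @chaining_interval _ (D c w) s0 delta Lam n s Lam0.
    move=> /(_ (fun x y => @DL delta x y (ger0_norm delta0))).
    have := res delta (ger0_norm delta0); have := cb (- delta).
    move=> c1 c2 chain; apply: (le_trans (chain _)); last by lra.
    have [d0|d0] := eqVneq delta 0.
      exists 0; first by rewrite lexx ler01.
      move: sd; rewrite d0 normr_le0 subr_eq0 => /eqP ->; ring.
    have dp : 0 < delta by rewrite lt_neqAle eq_sym d0.
    exists ((s - s0) / delta); last by field.
    rewrite divr_ge0 ?subr_ge0//= ler_pdivrMr// mul1r.
    exact: le_trans (ler_norm _) sd.
  have nd : `|- delta| = delta by rewrite normrN ger0_norm.
  have := @chaining_interval _ (D c w) s0 (- delta) Lam n s Lam0.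
  move=> /(_ (fun x y => @DL (- delta) x y nd)).
  have := res (- delta) nd; have := cb delta.
  move=> c1 c2 chain; apply: (le_trans (chain _)); last by lra.
  have dp : 0 < delta by apply: lt_le_trans sd; rewrite normr_gt0 subr_eq0 lt_eqF.
  exists ((s0 - s) / delta); last by field; rewrite gt_eqF.
  have q0 : 0 <= (s0 - s) / delta by apply: divr_ge0 => //; rewrite subr_ge0 ltW.
  rewrite q0/= ler_pdivrMr// mul1r.
  by apply: le_trans sd; rewrite distrC ler_norm.
Qed.

End scale_process.

(** * The normal distribution function *)

Section normal_cdf.
Variable R : realType.
Local Notation mu := (@lebesgue_measure R).

Definition normal_cdf (s x : R) : R := fine (normal_prob 0 s `]-oo, x]).

Lemma EFin_normal_cdf s x : (normal_cdf s x)%:E = normal_prob 0 s `]-oo, x].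
Proof. by rewrite /normal_cdf fineK// fin_num_measure. Qed.

Lemma normal_cdf_ge0 s x : 0 <= normal_cdf s x.
Proof. by rewrite -lee_fin EFin_normal_cdf. Qed.

Lemma normal_cdf_le1 s x : normal_cdf s x <= 1.
Proof. by rewrite -lee_fin EFin_normal_cdf probability_le1. Qed.

Lemma normal_cdf_nondecreasing s x y : x <= y -> normal_cdf s x <= normal_cdf s y.
Proof.
move=> xy; rewrite -lee_fin !EFin_normal_cdf; apply: le_measure; rewrite ?inE//.
by move=> z /=; rewrite !in_itv/= => /le_trans; exact.
Qed.

Lemma is_derive_normal_cdf s x : s != 0 ->
  is_derive x (1 : R) (normal_cdf s) (normal_pdf 0 s x).
Proof.
move=> s0.
have intf : mu.-integrable `]-oo, (x + 1)%R]%classic (EFin \o normal_pdf 0 s).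
  by apply: (integrableS measurableT) => //; exact: integrable_normal_pdf.
have x1 : x < x + 1 by rewrite ltrDl.
have [] := continuous_FTC1 x1 intf (ltNyr _) (@continuous_normal_pdf _ 0 s s0 x).
have -> : normal_cdf s =
  (fun x => \int[mu]_(t in [set` Interval -oo%O (BRight x)]) normal_pdf 0 s t)%R by [].
by move=> h1 h2; apply: DeriveDef; [exact: h1|rewrite -derive1E; exact: h2].
Qed.

Let idR : measurableTypeR R -> R := idfun.

Let midR : measurable_fun setT idR. Proof. exact: measurable_id. Qed.

Let id_rv s : {RV (normal_prob 0 s) >-> R} := mfun_Sub (mem_set midR).

Lemma cvg_normal_cdfNy s : normal_cdf s x @[x --> -oo] --> (0 : R).
Proof. by apply: fine_cvg; exact: (cvg_cdfNy0 (id_rv s)). Qed.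

Lemma cvg_normal_cdfy s : normal_cdf s x @[x --> +oo] --> (1 : R).
Proof. by apply: fine_cvg; exact: (cvg_cdfy1 (id_rv s)). Qed.

Lemma normal_pdf1E (x : R) : normal_pdf 0 1 x = normal_peak 1 * expR (- (x ^+ 2 / 2)).
Proof.
rewrite normal_pdfE ?oner_eq0// /normal_fun subr0; congr (_ * expR _).
by rewrite expr1n mulNr.
Qed.

Lemma normal_pdf_scale (s x : R) : 0 < s -> normal_pdf 0 s x = normal_pdf 0 1 (x / s) / s.
Proof.
move=> s0; rewrite normal_pdf1E normal_pdfE ?gt_eqF// /normal_fun subr0.
rewrite mulrAC; congr (_ * expR _); last by field; rewrite gt_eqF.
rewrite /normal_peak -mulrnAr sqrtrM ?sqr_ge0// sqrtr_sqr gtr0_norm//.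
by rewrite expr1n mul1r invfM mulrC.
Qed.

(** Both sides have the same derivative and the same limit at minus infinity. *)
Lemma normal_cdf_scale (s x : R) : 0 < s -> normal_cdf s x = normal_cdf 1 (x / s).
Proof.
move=> s0; pose D y := normal_cdf s y - normal_cdf 1 (y / s).
have dD (y : R) : is_derive y 1 D 0.
  have dl : is_derive y 1 (fun y => y / s) s^-1.
    by under eq_fun do rewrite mulrC; exact: is_derive_mull.
  have d1 := @is_derive1_comp _ (normal_cdf 1) (fun y => y / s) y _ _
    (@is_derive_normal_cdf 1 (y / s) (oner_neq0 _)) dl.
  have d2 := @is_derive_normal_cdf s y (lt0r_neq0 s0).
  have := is_deriveB d2 d1.
  by rewrite normal_pdf_scale// subrr.
have Dx y : D y = D x.
  by have [c _] := mvt x y dD; rewrite mul0r => /eqP; rewrite subr_eq0 => /eqP.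
have D0 : D y @[y --> -oo] --> (0 - 0 : R).
  apply: cvgB; first exact: cvg_normal_cdfNy.
  apply: (cvg_comp (fun y => y / s) (normal_cdf 1)); last exact: cvg_normal_cdfNy.
  by apply: gt0_cvgMlNy; rewrite ?invr_gt0//; exact: cvg_id.
have : D x = 0.
  have : D y @[y --> -oo] --> D x.
    by rewrite (_ : (fun y => D y) = cst (D x)); [exact: cvg_cst|apply/funext].
  by move/(cvg_unique _ D0); rewrite subr0 => /(_ _)/esym; apply.
by move=> /eqP; rewrite subr_eq0 => /eqP.
Qed.

Local Notation phi := (normal_pdf 0 (1 : R)).

Lemma normal_peak1_le1 : normal_peak 1 <= 1 :> R.
Proof.
rewrite /normal_peak invf_le1; last first.
  by rewrite sqrtr_gt0 expr1n mul1r mulrn_wgt0// pi_gt0.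
rewrite -[leLHS]sqrtr1 ler_wsqrtr// expr1n mul1r.
by have := pi_ge2 R; rewrite mulr2n; lra.
Qed.

Lemma is_derive_phi (x : R) : is_derive x 1 phi (- (x * phi x)).
Proof.
have -> : phi = (fun x => normal_peak 1 * expR (- (x ^+ 2 / 2))).
  by apply/funext => y; exact: normal_pdf1E.
have dq : is_derive x 1 (fun x => - (x ^+ 2 / 2) : R) (- x).
  have -> : (fun x => - (x ^+ 2 / 2) : R) = id * (fun t => - (2^-1) * t).
    by apply/funext => s; rewrite /= fctE/=; ring.
  apply: is_derive_eq (is_deriveM (is_derive_id x (1 : R)) (is_derive_mull (- 2^-1) x)) _.
  by rewrite /GRing.scale/=; field.
have de := @is_derive1_comp _ expR (fun x => - (x ^+ 2 / 2)) x _ _ (is_derive_expR _) dq.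
have := is_deriveZ (normal_peak 1) de.
by rewrite /GRing.scale/= mulrA mulrN mulrC.
Qed.

Lemma is_derive_dphi (x : R) : is_derive x 1 (fun x => - (x * phi x)) ((x ^+ 2 - 1) * phi x).
Proof.
apply: is_derive_eq (is_deriveN (is_deriveM (is_derive_id x (1 : R)) (is_derive_phi x))) _.
by rewrite /GRing.scale/=; ring.
Qed.

(** One bound for all the polynomial multiples of the density that occur as
    derivatives of the distribution function. *)
Lemma phi_bound (x : R) : 0 <= phi x /\ (x ^+ 4 + x ^+ 2 + 1) * phi x <= 32.
Proof.
have phi0 : 0 <= phi x by exact: normal_pdf_ge0.
split => //; rewrite normal_pdf1E mulrCA.
apply: (@le_trans _ _ ((x ^+ 4 + x ^+ 2 + 1) * expR (- (x ^+ 2 / 2)))).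
  have x4 : 0 <= x ^+ 4 + x ^+ 2 + 1.
    by rewrite addr_ge0// addr_ge0 ?sqr_ge0// (exprM x 2 2) sqr_ge0.
  by rewrite ler_piMl ?normal_peak1_le1// mulr_ge0 ?expR_ge0.
have e1 : 1 + x ^+ 2 / 4 <= expR (x ^+ 2 / 4) by exact: expR_ge1Dx.
have x2 := sqr_ge0 x.
have ee : expR (x ^+ 2 / 2) = expR (x ^+ 2 / 4) ^+ 2.
  by rewrite [RHS]expr2 -expRD; congr expR; field.
rewrite expRN ler_pdivrMr ?expR_gt0// ee.
apply: (@le_trans _ _ (32 * (1 + x ^+ 2 / 4) ^+ 2)).
  rewrite (exprM x 2 2); set y := x ^+ 2 in x2 *; nra.
by rewrite ler_pM2l// lerXn2r// nnegrE; lra.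
Qed.

Lemma continuous_normal_cdf (x : R) : {for x, continuous (normal_cdf 1)}.
Proof.
apply: differentiable_continuous; apply/derivable1_diffP.
by have [] := @is_derive_normal_cdf 1 x (oner_neq0 _).
Qed.

Lemma normal_cdf_lipschitz (x y : R) : `|normal_cdf 1 x - normal_cdf 1 y| <= 32 * `|x - y|.
Proof.
apply: (lipschitz_of_derive (fun c => @is_derive_normal_cdf 1 c (oner_neq0 _))) => c.
have [p0 pb] := phi_bound c; rewrite ger0_norm//.
have c4 : 0 <= c ^+ 4 by rewrite (exprM c 2 2) sqr_ge0.
have c2 := sqr_ge0 c; have := mulr_ge0 c4 p0; have := mulr_ge0 c2 p0; lra.
Qed.

(** * One step of the Gaussian replacement *)

Lemma inv_sqrt_expansion (a r : R) : 0 <= a -> 0 < r -> r ^+ 2 * (1 + a) = 1 ->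
  [/\ r <= 1, 1 - r <= a / 2 & a / 2 - (1 - r) <= a ^+ 2 / 2].
Proof.
move=> a0 r0 ra.
have r2 : r ^+ 2 <= 1 by have := mulr_ge0 (sqr_ge0 r) a0; lra.
have r1 : r <= 1 by rewrite -(expr_le1 (ltn0Sn 1) (ltW r0)).
have key : (a - 2 * (1 - r)) * (1 + r) = a * (1 - r) * (1 + 2 * r) by lra.
have r10 : 0 < 1 + r by lra.
have lo : 0 <= a - 2 * (1 - r).
  by rewrite -(pmulr_lge0 _ r10) key !mulr_ge0//; lra.
have hi : a - 2 * (1 - r) <= a ^+ 2.
  rewrite -(ler_pM2r r10) key.
  have : a * (1 - r) * (1 + 2 * r) <= a * (a / 2) * (1 + 2 * r).
    by rewrite ler_wpM2r//; [lra|rewrite ler_wpM2l//; lra].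
  have := sqr_ge0 a; nra.
by split => //; lra.
Qed.

(** [normal_cdf 1 (q * x)] is the smoothing at scale [1 / q] of a jump; raising the
    variance [q ^- 2] by [m] changes it like [m / 2] times its second derivative,
    which is the heat equation. *)
Lemma heat_step (q m x : R) : 0 < q -> 0 <= m -> m * q ^+ 2 <= 1 ->
  forall r, 0 < r -> r ^+ 2 * (1 + m * q ^+ 2) = 1 ->
  `|normal_cdf 1 (q * r * x) - normal_cdf 1 (q * x)
    + m / 2 * (q ^+ 2 * (q * x * phi (q * x)))| <= 64 * (m * q ^+ 2) ^+ 2.
Proof.
move=> q0 m0; have [a aE] : exists a, a = m * q ^+ 2 by exists (m * q ^+ 2).
rewrite -aE => a1 r r0 ra; have a0 : 0 <= a by rewrite aE mulr_ge0// sqr_ge0.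
have [r1 lo hi] := inv_sqrt_expansion a0 r0 ra.
have [z zE] : exists z, z = q * x by exists (q * x).
rewrite -zE; have p0 y := (phi_bound y).1.
pose f t := normal_cdf 1 (z * t); pose df t := z * phi (z * t).
pose ddf t := z ^+ 2 * - (z * t * phi (z * t)).
have dl (c : R) := is_derive_mull z c.
have fdf (c : R) : is_derive c 1 f (df c).
  have := @is_derive1_comp _ (normal_cdf 1) (fun y => z * y) c _ _
    (@is_derive_normal_cdf 1 (z * c) (oner_neq0 _)) (dl c).
  by rewrite mulrC.
have dfddf (c : R) : is_derive c 1 df (ddf c).
  apply: is_derive_eq (is_deriveZ z (@is_derive1_comp _ phi (fun y => z * y) c _ _
    (is_derive_phi (z * c)) (dl c))) _.
  by rewrite /GRing.scale/= /ddf; ring.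
have [c /andP[rc c1] fc] := mvt_between r1 (fun c _ => fdf c).
have [c' /andP[cc' c'1] dfc] := mvt_between c1 (fun c _ => dfddf c).
have ddfc : `|ddf c'| <= 64.
  have c'0 : 0 < c' by lra.
  have c'2 : 1 <= 2 * c' ^+ 2.
    have rc' : 0 <= (c' - r) * (c' + r) by apply: mulr_ge0; lra.
    have : a * r ^+ 2 <= 1 * r ^+ 2 by rewrite ler_wpM2r// sqr_ge0.
    lra.
  rewrite /ddf; set y := z * c'; have [_ pb] := phi_bound y; have py := p0 y.
  have y4 : 0 <= y ^+ 4 by rewrite (exprM y 2 2) sqr_ge0.
  have y2 := sqr_ge0 y.
  have h : c' ^+ 2 * `|z ^+ 2 * - (y * phi y)| <= 32.
    rewrite -[X in X * _]ger0_norm ?sqr_ge0// -normrM mulrN mulrN normrN.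
    have -> : c' ^+ 2 * (z ^+ 2 * (y * phi y)) = y ^+ 3 * phi y by rewrite /y; ring.
    have y3 : `|y ^+ 3| <= y ^+ 4 + y ^+ 2.
      have := sqr_ge0 (y ^+ 2 - y); have := sqr_ge0 (y ^+ 2 + y).
      by move=> h1 h2; rewrite ler_norml; apply/andP; split; nra.
    rewrite normrM (ger0_norm py); apply: le_trans pb.
    by rewrite ler_wpM2r// (le_trans y3)// lerDl.
  have := normr_ge0 (z ^+ 2 * - (y * phi y)); set N := `|_| in h *; move=> N0.
  have : N * 1 <= N * (2 * c' ^+ 2) by rewrite ler_wpM2l.
  lra.
have zz : q * r * x = z * r by rewrite zE; ring.
have -> : normal_cdf 1 (q * r * x) - normal_cdf 1 z + m / 2 * (q ^+ 2 * (z * phi z)) =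
    (df 1 - df c) * (1 - r) + (a / 2 - (1 - r)) * df 1.
  rewrite zz -/(f r) (_ : normal_cdf 1 z = f 1); last by rewrite /f mulr1.
  have -> : f r - f 1 = - (df c * (1 - r)) by rewrite -fc; ring.
  have -> : z * phi z = df 1 by rewrite /df mulr1.
  by rewrite aE; field.
have dfb : `|df 1| <= 32.
  rewrite /df mulr1; have [_ pb] := phi_bound z; have pz := p0 z.
  have z4 : 0 <= z ^+ 4 by rewrite (exprM z 2 2) sqr_ge0.
  have zb : `|z| <= z ^+ 2 + 1.
    by rewrite ler_norml; have := sqr_ge0 (z - 1); have := sqr_ge0 (z + 1); nra.
  rewrite normrM (ger0_norm pz); apply: le_trans pb.
  by rewrite ler_wpM2r// (le_trans zb)// -addrA lerDr.
have dfcb : `|df 1 - df c| <= 64 * (1 - r).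
  by rewrite dfc normrM; apply: ler_pM => //; rewrite ger0_norm; lra.
apply: le_trans (ler_normD _ _) _.
rewrite (normrM (df 1 - df c)) (normrM (a / 2 - (1 - r))).
move: dfb dfcb; set N1 := `|df 1|; set N2 := `|df 1 - df c|.
rewrite (@ger0_norm _ (1 - r)) ?subr_ge0// (@ger0_norm _ (a / 2 - (1 - r))) ?subr_ge0//.
move: N1 N2 => N1 N2 h1 h2; clear -a0 r1 lo hi h1 h2.
have h3 : N2 * (1 - r) <= 64 * (1 - r) * (1 - r) by rewrite ler_wpM2r ?subr_ge0.
have h4 : (a / 2 - (1 - r)) * N1 <= (a / 2 - (1 - r)) * 32 by rewrite ler_wpM2l ?subr_ge0.
have h5 : (1 - r) * (1 - r) <= a / 2 * (a / 2) by rewrite ler_pM ?subr_ge0.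
apply: le_trans (lerD h3 h4) _; rewrite expr2 in hi *; lra.
Qed.

(** The same quadratic term as in [heat_step], so that it cancels when the argument
    moves by a centered variable of matching variance. *)
Lemma space_step (q x h : R) : 0 < q ->
  `|normal_cdf 1 (q * (x + h)) - normal_cdf 1 (q * x) - h * (q * phi (q * x))
    - h ^+ 2 / 2 * (q ^+ 2 * - (q * x * phi (q * x)))| <= 64 * q ^+ 3 * `|h| ^+ 3.
Proof.
move=> q0; have p0 y := (phi_bound y).1.
have q1 : 0 <= q by exact: ltW.
have dl (c : R) := is_derive_mull q c.
have d0 (c : R) : is_derive c 1 (fun c => normal_cdf 1 (q * c)) (q * phi (q * c)).
  have := @is_derive1_comp _ (normal_cdf 1) (fun y => q * y) c _ _
    (@is_derive_normal_cdf 1 (q * c) (oner_neq0 _)) (dl c).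
  by rewrite mulrC.
have d1 (c : R) : is_derive c 1 (fun c => q * phi (q * c))
    (q ^+ 2 * - (q * c * phi (q * c))).
  apply: is_derive_eq (is_deriveZ q (@is_derive1_comp _ phi (fun y => q * y) c _ _
    (is_derive_phi (q * c)) (dl c))) _.
  by rewrite /GRing.scale/=; ring.
have d2 (c : R) : is_derive c 1 (fun c => q ^+ 2 * - (q * c * phi (q * c)))
    (q ^+ 3 * (((q * c) ^+ 2 - 1) * phi (q * c))).
  apply: is_derive_eq (is_deriveZ (q ^+ 2) (@is_derive1_comp _ _ (fun y => q * y) c _ _
    (is_derive_dphi (q * c)) (dl c))) _.
  by rewrite /GRing.scale/=; ring.
have [K KE] : exists K, K = 64 * q ^+ 3 by exists (64 * q ^+ 3).
have K0 : 0 <= K by rewrite KE mulr_ge0// exprn_ge0.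
suff lip c c' : `|q ^+ 2 * - (q * c * phi (q * c)) - q ^+ 2 * - (q * c' * phi (q * c'))| <=
    K * `|c - c'|.
  by rewrite -KE; exact: (taylor2 K0 d0 d1 lip x h).
apply: (lipschitz_of_derive d2) => y.
rewrite KE normrM ger0_norm ?exprn_ge0// mulrC ler_wpM2r ?exprn_ge0//.
have [_] := phi_bound (q * y); set z := q * y => pb.
have z4 : 0 <= z ^+ 4 by rewrite (exprM z 2 2) sqr_ge0.
have z2 := sqr_ge0 z; have pz := p0 z.
rewrite ler_norml; have := mulr_ge0 z4 pz; have := mulr_ge0 z2 pz.
by move=> h1 h2; apply/andP; split; lra.
Qed.

End normal_cdf.

(** * Central limit theorem for weighted sums *)

(** As the squares of the weights add up to one, their third and fourth powers are
    negligible with the largest weight. *)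
Lemma sum_pow_le (R : realType) (n : nat) (v : 'I_n -> R) (K e om : R) :
  0 < e -> 0 <= K -> (forall i, `|v i| <= om) -> \sum_i v i ^+ 2 = 1 ->
  \sum_i (64 * (K / e) ^+ 3 * `|v i| ^+ 3 + 64 * (K / e) ^+ 4 * v i ^+ 4) <=
  64 * (K / e) ^+ 3 * om + 64 * (K / e) ^+ 4 * om ^+ 2.
Proof.
move=> e0 K0 vom v1; have Ke : 0 <= K / e by rewrite divr_ge0// ltW.
rewrite big_split/= -!mulr_sumr; apply: lerD; apply: ler_wpM2l.
- by rewrite mulr_ge0// exprn_ge0.
- rewrite -[leRHS]mulr1 -v1 mulr_sumr; apply: ler_sum => i _.
  by rewrite exprS -[v i ^+ 2]real_normK ?num_real// ler_wpM2r ?exprn_ge0.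
- by rewrite mulr_ge0// exprn_ge0.
- rewrite -[leRHS]mulr1 -v1 mulr_sumr; apply: ler_sum => i _.
  rewrite -[4%N]/(2 + 2)%N exprD ler_wpM2r ?sqr_ge0//.
  rewrite -[leLHS]real_normK ?num_real// lerXn2r// nnegrE//.
  exact: le_trans (vom i).
Qed.

Section lindeberg.
Context d (T : measurableType d) (R : realType) (P : probability T R).
Local Notation phi := (normal_pdf 0 (1 : R)).
Local Notation Phi := (normal_cdf (1 : R)).

Let continuous_phi : continuous phi.
Proof. exact: (@continuous_normal_pdf _ 0 1 (oner_neq0 R)). Qed.

Let measurable_phi : measurable_fun setT phi.
Proof. exact: continuous_measurable_fun. Qed.

Let measurable_Phi : measurable_fun setT Phi.
Proof. by apply: continuous_measurable_fun => x; exact: continuous_normal_cdf. Qed.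

Let Phi_norm_le x : `|Phi x| <= 1.
Proof. by rewrite ger0_norm ?normal_cdf_ge0// normal_cdf_le1. Qed.

Let phi_norm_le x : `|phi x| <= 32.
Proof.
have [p0 pb] := phi_bound x; rewrite ger0_norm//.
have x4 : 0 <= x ^+ 4 by rewrite (exprM x 2 2) sqr_ge0.
have := mulr_ge0 x4 p0; have := mulr_ge0 (sqr_ge0 x) p0; lra.
Qed.

Let xphi_norm_le x : `|x * phi x| <= 32.
Proof.
have [p0 pb] := phi_bound x.
have x4 : 0 <= x ^+ 4 by rewrite (exprM x 2 2) sqr_ge0.
rewrite normrM (ger0_norm p0); apply: le_trans pb; rewrite ler_wpM2r//.
rewrite -addrA ler_wpDl// ler_norml.
by have := sqr_ge0 (x - 1); have := sqr_ge0 (x + 1); nra.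
Qed.

Let bdmeas_comp (f : R -> R) (K : R) (S : T -> R) : measurable_fun setT f ->
  (forall y, `|f y| <= K) -> measurable_fun setT S -> bdmeas (fun w => f (S w)).
Proof. by move=> mf fK mS; split; [exact: measurableT_comp|exists K]. Qed.

Variables (n : nat) (X : 'I_n -> {RV P >-> R}) (v : 'I_n -> R) (g : R -> R).
Variables (K s2 e om : R).
Hypothesis indX : mutually_independent X.
Hypothesis mg : measurable_fun setT g.
Hypothesis gK : forall y, `|g y| <= K.
Hypothesis g0 : forall i, mean P (fun w => g (X i w)) = 0.
Hypothesis g2 : forall i, mean P (fun w => g (X i w) ^+ 2) = s2.
Hypotheses (e0 : 0 < e) (vom : forall i, `|v i| <= om) (omK : om * K <= e).
Hypothesis v1 : \sum_i v i ^+ 2 = 1.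

Let S k w := \sum_(i < n | (i < k)%N) v i * g (X i w).
Let var k := e ^+ 2 + s2 * \sum_(i < n | (k <= i)%N) v i ^+ 2.
Let q k := (Num.sqrt (var k))^-1.
Let Q t k := mean P (fun w => Phi (q k * (t - S k w))).

Let bg i : bdmeas (fun w => g (X i w)).
Proof. exact: bdmeas_comp. Qed.

Let s20 (i : 'I_n) : 0 <= s2.
Proof. by rewrite -(g2 i) mean_ge0// => w; exact: sqr_ge0. Qed.

Let s2K (i : 'I_n) : s2 <= K ^+ 2.
Proof.
rewrite -(g2 i) -[leRHS](mean_cst P); apply: mean_le; [exact: bdmeasX|exact: bdmeas_cst|].
move=> w; rewrite -[leLHS]real_normK ?num_real// lerXn2r// nnegrE//.
exact: le_trans (gK 0).
Qed.

Let var_ge k : e ^+ 2 <= var k.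
Proof.
rewrite lerDl; have [n0|n0] := posnP n.
  rewrite big1 ?mulr0// => i; have : (i < 0)%N by rewrite -[X in (_ < X)%N]n0 ltn_ord.
  by rewrite ltn0.
by rewrite mulr_ge0 ?(s20 (Ordinal n0))// sumr_ge0// => i _; exact: sqr_ge0.
Qed.

Let var_gt0 k : 0 < var k.
Proof. by apply: lt_le_trans (var_ge k); rewrite exprn_gt0. Qed.

Let q_gt0 k : 0 < q k.
Proof. by rewrite invr_gt0 sqrtr_gt0. Qed.

Let q_le k : q k <= e^-1.
Proof.
rewrite lef_pV2 ?posrE ?sqrtr_gt0// -[leLHS](gtr0_norm e0) -sqrtr_sqr.
exact: ler_wsqrtr.
Qed.

Let sqr_q k : q k ^+ 2 = (var k)^-1.
Proof. by rewrite /q exprVn sqr_sqrtr// ltW. Qed.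

Let bS k : bdmeas (S k).
Proof. by apply: bdmeas_sum => i _; exact: bdmeasZ. Qed.

Let dS k : determined_by X [set i : 'I_n | (i < k)%N]%SET (S k).
Proof.
rewrite /S; elim: (index_enum _) => [|i r ih].
  have -> : (fun w : T => \sum_(j <- ([::] : seq 'I_n) | (j < k)%N) v j * g (X j w)) = cst 0.
    by apply/funext => w; rewrite big_nil.
  exact: measurable_cst.
have [ik|ik] := boolP (i < k)%N.
  have -> : (fun w : T => \sum_(j <- (i :: r : seq 'I_n) | (j < k)%N) v j * g (X j w)) =
      (fun w => v i * g (X i w) + \sum_(j <- r | (j < k)%N) v j * g (X j w)).
    by apply/funext => w; rewrite big_cons ik.
  rewrite /determined_by; apply: measurable_funD => //.
  by apply: measurable_funM => //; apply: determined_by_coord => //; rewrite inE.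
have -> // : (fun w : T => \sum_(j <- (i :: r : seq 'I_n) | (j < k)%N) v j * g (X j w)) =
    (fun w => \sum_(j <- r | (j < k)%N) v j * g (X j w)).
by apply/funext => w; rewrite big_cons (negbTE ik).
Qed.

Let mtS t k : measurable_fun setT (fun w => t - S k w).
Proof. by apply: measurable_funB => //; case: (bS k). Qed.

(** The centered summand and the Gaussian increment of the same variance change the
    smoothed indicator by the same terms up to the second order. *)
Let step t (i : 'I_n) : `|Q t i.+1 - Q t i| <=
  64 * (K / e) ^+ 3 * `|v i| ^+ 3 + 64 * (K / e) ^+ 4 * v i ^+ 4.
Proof.
have K0 : 0 <= K by exact: le_trans (gK 0).
set k := nat_of_ord i; pose m := v i ^+ 2 * s2.
have m0 : 0 <= m by rewrite mulr_ge0 ?sqr_ge0// (s20 i).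
have varE : var k = var k.+1 + m.
  rewrite /var -addrA; congr (_ + _); rewrite (bigD1 i) ?leqnn//= mulrDr addrC.
  congr (_ + _); first by rewrite /m mulrC.
  congr (_ * _); apply: eq_bigl => j; rewrite ltn_neqAle andbC eq_sym.
  by rewrite -val_eqE/= eq_sym.
have SE w : S k.+1 w = S k w + v i * g (X i w).
  rewrite /S (bigD1 i) ?leqnn//= addrC; congr (_ + _).
  apply: eq_bigl => j; rewrite [in RHS]ltn_neqAle ltnS andbC -val_eqE/=.
  by case: eqVneq => //; rewrite andbT.
set qq := q k.+1; have qq0 : 0 < qq := q_gt0 k.+1.
pose r := q k / qq; have r0 : 0 < r by rewrite divr_gt0// q_gt0.
have qr : qq * r = q k by rewrite /r mulrC divfK// gt_eqF.
have mq : m * qq ^+ 2 <= (K / e) ^+ 2 * v i ^+ 2.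
  rewrite /m -mulrA mulrC; apply: ler_wpM2r; first exact: sqr_ge0.
  rewrite expr_div_n; apply: ler_pM; rewrite ?sqr_ge0 ?(s20 i) ?(s2K i)//.
  by rewrite sqr_q lef_pV2 ?posrE ?exprn_gt0.
have mq1 : m * qq ^+ 2 <= 1.
  apply: le_trans mq _; rewrite -exprMn -real_normK ?num_real// expr_le1//.
  rewrite normrM ger0_norm ?divr_ge0 ?(ltW e0)// mulrAC ler_pdivrMr// mul1r mulrC.
  by apply: le_trans omK; rewrite ler_wpM2r.
have rr : r ^+ 2 * (1 + m * qq ^+ 2) = 1.
  rewrite /r expr_div_n !sqr_q varE.
  by field; rewrite -varE !gt_eqF.
pose F1 w := qq * phi (qq * (t - S k w)).
pose F2 w := qq ^+ 2 * (qq * (t - S k w) * phi (qq * (t - S k w))).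
pose h w := - (v i * g (X i w)).
pose A w := Phi (qq * (t - S k.+1 w)) - Phi (qq * (t - S k w)) - h w * F1 w + h w ^+ 2 / 2 * F2 w.
pose B w := Phi (q k * (t - S k w)) - Phi (qq * (t - S k w)) + m / 2 * F2 w.
have hb w : `|A w - B w| <= 64 * (K / e) ^+ 3 * `|v i| ^+ 3 + 64 * (K / e) ^+ 4 * v i ^+ 4.
  apply: le_trans (ler_normB _ _) _; apply: lerD.
    have := space_step (t - S k w) (h w) qq0; set LHS := `|_| => sp.
    have -> : `|A w| = LHS.
      rewrite /LHS /A SE /F1 /F2; congr `|_|.
      by rewrite (_ : t - S k w + h w = t - (S k w + v i * g (X i w))); rewrite /h; ring.
    apply: le_trans sp _.
    have hv : `|h w| <= K * `|v i| by rewrite /h normrN normrM mulrC ler_wpM2r.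
    have -> : 64 * qq ^+ 3 * `|h w| ^+ 3 = 64 * (qq * `|h w|) ^+ 3 by ring.
    have -> : 64 * (K / e) ^+ 3 * `|v i| ^+ 3 = 64 * (e^-1 * (K * `|v i|)) ^+ 3 by ring.
    rewrite ler_pM2l// lerXn2r// ?nnegrE ?mulr_ge0 ?invr_ge0 ?(ltW e0) ?(ltW qq0)//.
    by rewrite ler_pM// ?(ltW qq0)//; exact: q_le.
  have := heat_step (t - S k w) qq0 m0 mq1 r0 rr; rewrite qr -/(B w) => /le_trans; apply.
  rewrite -mulrA ler_pM2l//.
  rewrite (_ : (K / e) ^+ 4 * v i ^+ 4 = ((K / e) ^+ 2 * v i ^+ 2) ^+ 2); last by ring.
  by rewrite lerXn2r// nnegrE mulr_ge0 ?sqr_ge0.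
have mqS (c : R) : measurable_fun setT (fun w => c * (t - S k w)) by exact: measurable_funM.
have mqS' (c : R) : measurable_fun setT (fun w => c * (t - S k.+1 w)) by exact: measurable_funM.
have b1 : bdmeas (fun w => Phi (qq * (t - S k.+1 w))) := bdmeas_comp measurable_Phi Phi_norm_le (mqS' qq).
have b2 c : bdmeas (fun w => Phi (c * (t - S k w))) := bdmeas_comp measurable_Phi Phi_norm_le (mqS c).
have b3 : bdmeas F1 by apply: bdmeasZ; exact: (bdmeas_comp measurable_phi phi_norm_le).
have mxphi : measurable_fun setT (fun x : R => x * phi x) by exact: measurable_funM.
have b4 : bdmeas F2 by apply: bdmeasZ; exact: (bdmeas_comp mxphi xphi_norm_le).
have iJ : i \notin [set j : 'I_n | (j < k)%N]%SET by rewrite inE ltnn.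
have dtS : determined_by X [set j : 'I_n | (j < k)%N]%SET (fun w => qq * (t - S k w)).
  by rewrite /determined_by; apply: measurable_funM => //; apply: measurable_funB => //; exact: dS.
have dF1 : determined_by X [set j : 'I_n | (j < k)%N]%SET F1.
  by rewrite /determined_by; apply: measurable_funM => //; exact: (measurableT_comp measurable_phi dtS).
have dF2 : determined_by X [set j : 'I_n | (j < k)%N]%SET F2.
  by rewrite /determined_by; apply: measurable_funM => //; exact: (measurableT_comp mxphi dtS).
have mF1 : mean P (fun w => F1 w * g (X i w)) = 0.
  by rewrite (mean_determined_mul indX iJ b3 dF1 mg) ?g0 ?mulr0//; exists K.
have mF2 : mean P (fun w => F2 w * g (X i w) ^+ 2) = mean P F2 * s2.
  rewrite (mean_determined_mul indX iJ b4 dF2 (g := fun y => g y ^+ 2)) ?g2//.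
    exact: measurable_funX.
  by exists (K ^+ 2) => y; rewrite normrX lerXn2r// nnegrE.
have ABE : (fun w => A w - B w) = (fun w =>
    (Phi (qq * (t - S k.+1 w)) - Phi (q k * (t - S k w))) +
    (v i * (F1 w * g (X i w)) +
     (v i ^+ 2 / 2 * (F2 w * g (X i w) ^+ 2) - m / 2 * F2 w))).
  by apply/funext => w; rewrite /A /B /h; field.
have b5 : bdmeas (fun w => F1 w * g (X i w)) by exact: bdmeasM.
have b6 : bdmeas (fun w => F2 w * g (X i w) ^+ 2) by apply: bdmeasM => //; exact: bdmeasX.
have b7 := bdmeasZ (v i) b5; have b8 := bdmeasZ (v i ^+ 2 / 2) b6.
have b9 := bdmeasZ (m / 2) b4; have b10 := bdmeasB b8 b9; have b11 := bdmeasD b7 b10.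
have b12 := bdmeasB b1 (b2 (q k)).
have bAB : bdmeas (fun w => A w - B w) by rewrite ABE; exact: bdmeasD.
have -> : Q t k.+1 - Q t k = mean P (fun w => A w - B w).
  rewrite ABE (meanD P b12 b11) (meanB P b1 (b2 _)) (meanD P b7 b10) (meanB P b8 b9).
  rewrite (meanZ P (v i) b5) (meanZ P (v i ^+ 2 / 2) b6) (meanZ P (m / 2) b4) mF1 mF2.
  have cancel (a b c : R) : a - b =
    a - b + (v i * 0 + (v i ^+ 2 / 2 * (c * s2) - m / 2 * c)) by rewrite /m; field.
  exact: cancel.
by apply: mean_norm_le.
Qed.

(** Replacing the summands one at a time by Gaussian smoothing: each step costs a
    third moment, and the third moments add up to the largest weight. *)
Lemma lindeberg t :
  `|mean P (fun w => Phi ((t - \sum_i v i * g (X i w)) / e)) -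
    Phi (t / Num.sqrt (e ^+ 2 + s2))| <=
  64 * (K / e) ^+ 3 * om + 64 * (K / e) ^+ 4 * om ^+ 2.
Proof.
have Qn : mean P (fun w => Phi ((t - \sum_i v i * g (X i w)) / e)) = Q t n.
  congr mean; apply/funext => w; congr Phi; rewrite mulrC; congr (_ * (_ - _)).
    rewrite /q /var big1 ?mulr0 ?addr0; first by rewrite sqrtr_sqr gtr0_norm.
    by move=> i; rewrite leqNgt ltn_ord.
  by rewrite /S; apply: eq_bigl => i; rewrite ltn_ord.
have Q0 : Phi (t / Num.sqrt (e ^+ 2 + s2)) = Q t 0%N.
  have S0 w : S 0 w = 0 by rewrite /S big1.
  have var0 : var 0 = e ^+ 2 + s2.
    have E : \sum_(i < n | (0 <= i)%N) v i ^+ 2 = 1 by rewrite -v1; exact: eq_bigl.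
    by rewrite /var E mulr1.
  rewrite /Q -[LHS](mean_cst P); congr mean; apply/funext => w.
  by rewrite S0 subr0 /q var0 [in RHS]mulrC.
have tel : Q t n - Q t 0 = \sum_(i < n) (Q t i.+1 - Q t i).
  by rewrite -(big_mkord xpredT (fun k => Q t k.+1 - Q t k)) telescope_sumr.
rewrite Qn Q0 tel.
apply: le_trans (ler_norm_sum _ _ _) _.
apply: (le_trans (ler_sum _ (fun i _ => step t i))).
exact: (sum_pow_le e0 (le_trans (normr_ge0 _) (gK 0)) vom v1).
Qed.

End lindeberg.

Lemma indic_upper (R : realType) (A B : bool) (a b : R) : 0 <= a -> b <= 1 ->
  (A -> ~~ B -> b <= a) -> A%:R <= a + B%:R + (1 - b).
Proof. by case: A; case: B => /= a0 b1 h; rewrite ?mulr1n ?mulr0n; try lra; have := h isT isT; lra. Qed.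

Lemma indic_lower (R : realType) (A B : bool) (a b : R) : a <= 1 -> 0 <= b ->
  (~~ A -> ~~ B -> a <= b) -> a - B%:R - b <= A%:R.
Proof. by case: A; case: B => /= a1 b0 h; rewrite ?mulr1n ?mulr0n; try lra; have := h isT isT; lra. Qed.

Lemma shift_upper (R : realType) (y z t e : R) :
  `|y - z| <= e -> y <= t -> e <= t + 2 * e - z.
Proof. by rewrite ler_norml => /andP[]; lra. Qed.

Lemma shift_lower (R : realType) (y z t e : R) :
  `|y - z| <= e -> t < y -> t - 2 * e - z <= - e.
Proof. by rewrite ler_norml => /andP[]; lra. Qed.

Lemma sandwich (R : realType) (eta F G1 G2 M1 M2 p : R) :
  `|G1 - M1| <= eta / 8 -> `|G2 - M2| <= eta / 8 ->
  `|G1 - F| <= 2 * (eta / 8) -> `|G2 - F| <= 2 * (eta / 8) ->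
  p <= M1 + eta / 8 + eta / 8 -> M2 - eta / 8 - eta / 8 <= p -> `|F - p| <= eta.
Proof.
rewrite !ler_norml => /andP[? ?] /andP[? ?] /andP[? ?] /andP[? ?] ? ?.
by apply/andP; split; lra.
Qed.

Section clt.
Context d (T : measurableType d) (R : realType) (P : probability T R).
Local Notation Phi := (normal_cdf (1 : R)).
Variables (X : forall n, 'I_n -> {RV P >-> R}) (v : forall n, 'I_n -> R) (g : R -> R).
Variables (K s2 : R) (Y : nat -> T -> R).
Hypothesis indX : forall n, mutually_independent (@X n).
Hypothesis mg : measurable_fun setT g.
Hypothesis gK : forall y, `|g y| <= K.
Hypothesis g0 : forall n (i : 'I_n), mean P (fun w => g (X i w)) = 0.
Hypothesis g2 : forall n (i : 'I_n), mean P (fun w => g (X i w) ^+ 2) = s2.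
Hypothesis s20 : 0 < s2.
Hypothesis v1 : \forall n \near \oo, \sum_i (@v n) i ^+ 2 = 1.
Hypothesis v0 : forall e : R, 0 < e -> \forall n \near \oo, forall i, `|(@v n) i| <= e.
Hypothesis mY : forall n, measurable_fun setT (Y n).

Let S n w := \sum_i (@v n) i * g (X i w).

Hypothesis YS : forall e : R, 0 < e -> whp P (fun n => [set w | `|Y n w - S n w| <= e]).

Let bPhi n (t e : R) : bdmeas (fun w => Phi ((t - S n w) / e)).
Proof.
split; last first.
  by exists 1 => w; rewrite ger0_norm ?normal_cdf_ge0// normal_cdf_le1.
apply: (@measurableT_comp _ _ _ _ _ _ Phi).
  by apply: continuous_measurable_fun => x; exact: continuous_normal_cdf.
apply: measurable_funM => //; apply: measurable_funB => //.
suff [] : bdmeas (S n) by [].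
apply: bdmeas_sum => i _; apply: bdmeasZ; split; first exact: measurableT_comp.
by exists K.
Qed.

Let smoothed_cvg (t e : R) : 0 < e ->
  mean P (fun w => Phi ((t - S n w) / e)) @[n --> \oo] --> Phi (t / Num.sqrt (e ^+ 2 + s2)).
Proof.
move=> e0; apply/cvgrPdist_le => eta eta0.
have K0 : 0 <= K by exact: le_trans (gK 0).
pose A := 64 * (K / e) ^+ 3; pose B := 64 * (K / e) ^+ 4.
have A0 : 0 <= A by rewrite mulr_ge0// exprn_ge0// divr_ge0// ltW.
have B0 : 0 <= B by rewrite mulr_ge0// exprn_ge0// divr_ge0// ltW.
pose om := Num.min 1 (Num.min (e / (K + 1)) (eta / (A + B + 1))).
have AB0 : 0 < A + B + 1 by lra.
have K1 : 0 < K + 1 by lra.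
have om0 : 0 < om by rewrite !lt_min ltr01/= !divr_gt0.
have omK : om * K <= e.
  apply: (@le_trans _ _ (e / (K + 1) * (K + 1))); last by rewrite divfK ?gt_eqF.
  apply: ler_pM; rewrite ?(ltW om0)//; last by rewrite lerDl.
  by rewrite !ge_min lexx orbT.
have omeps : A * om + B * om ^+ 2 <= eta.
  have om1 : om <= 1 by rewrite ge_min lexx.
  have om2 : om <= eta / (A + B + 1) by rewrite !ge_min lexx !orbT.
  have omsq : om ^+ 2 <= om by rewrite expr2 ler_piMr// ltW.
  have : om * (A + B + 1) <= eta by rewrite -ler_pdivlMr.
  have := ler_wpM2l B0 omsq; lra.
near=> n; rewrite distrC; apply: le_trans omeps.
apply: (lindeberg (@indX n) mg gK (@g0 n) (@g2 n) e0 _ omK); last by near: n.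
by near: n; exact: v0.
Unshelve. all: by end_near. Qed.

(** The smoothed distribution functions converge, and the smoothing and the
    negligible remainder cost at most a shift of the argument. *)
Lemma clt_normal_cdf (t : R) :
  P [set w | Y n w <= t] @[n --> \oo] --> (normal_cdf (Num.sqrt s2) t)%:E.
Proof.
set s := Num.sqrt s2; have s_gt0 : 0 < s by rewrite sqrtr_gt0.
have s2E : s ^+ 2 = s2 by rewrite sqr_sqrtr// ltW.
have mA n := measurable_sublevel t (mY n).
have PE n : P [set w | Y n w <= t] = (mean P (fun w => \1_[set w | Y n w <= t] w))%:E.
  by rewrite mean_indic.
under eq_fun do rewrite PE; rewrite normal_cdf_scale//.
apply: cvg_EFin; first exact: nearW.
apply/cvgrPdist_le => eta eta0.
have eta8 : 0 < eta / 8 by rewrite divr_gt0.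
pose de := eta / 8 * s / 64.
have de0 : 0 < de by rewrite !mulr_gt0.
have [M M0 hM] : exists2 M, 0 < M & forall y, M <= y ->
    1 - Phi y <= eta / 8 /\ Phi (- y) <= eta / 8.
  have /cvgrPdist_le/(_ _ eta8)[M1 [_ hM1]] := @cvg_normal_cdfy R 1.
  have /cvgrPdist_le/(_ _ eta8)[M2 [_ hM2]] := @cvg_normal_cdfNy R 1.
  exists (`|M1| + `|M2| + 1) => [|y My]; first by rewrite ltr_wpDl// addr_ge0.
  have y1 : M1 < y by have := ler_norm M1; have := normr_ge0 M2; lra.
  have y2 : - y < M2.
    by have := ler_norm (- M2); rewrite normrN; have := normr_ge0 M1; lra.
  split; first by have := hM1 _ y1; apply: le_trans; exact: ler_norm.
  by have := hM2 _ y2; rewrite sub0r normrN; apply: le_trans; exact: ler_norm.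
pose c := eta / 8 * s2 / (32 * (`|t| + 1)).
have t1 : 0 < `|t| + 1 by rewrite ltr_wpDl.
have c0 : 0 < c by rewrite !mulr_gt0 ?invr_gt0 ?mulr_gt0.
pose e := Num.min (de / M) c.
have e0 : 0 < e by rewrite lt_min c0 divr_gt0.
have Me : M <= de / e.
  by rewrite ler_pdivlMr// mulrC -ler_pdivlMr// ge_min lexx.
have [tail1 tail2] := hM _ Me.
have close (a : R) : `|a| <= 2 * de ->
    `|Phi ((t + a) / Num.sqrt (e ^+ 2 + s2)) - Phi (t / s)| <= 2 * (eta / 8).
  move=> ha; set z := Num.sqrt (e ^+ 2 + s2).
  have z0 : 0 < z by rewrite sqrtr_gt0 ltr_wpDl// sqr_ge0.
  have z2 : z ^+ 2 = e ^+ 2 + s ^+ 2.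
    by rewrite s2E sqr_sqrtr// addr_ge0 ?sqr_ge0// ltW.
  have sz : s <= z by rewrite ler_wsqrtr// lerDr sqr_ge0.
  have zes : z <= e + s.
    rewrite -(@ler_pXn2r _ 2) ?nnegrE ?(ltW z0)//; last by rewrite addr_ge0 ?ltW.
    by rewrite z2 sqrrD lerD2r lerDl mulrn_wge0// mulr_ge0 ?ltW.
  apply: le_trans (normal_cdf_lipschitz _ _) _.
  have -> : (t + a) / z - t / s = a / z - t * ((z - s) / (s * z)).
    by field; rewrite !gt_eqF.
  have h1 : `|a / z| <= 2 * de / s.
    rewrite normrM (gtr0_norm (x := z^-1)) ?invr_gt0//.
    by apply: ler_pM; rewrite ?invr_ge0 ?(ltW z0)// lef_pV2.
  have h2 : `|t * ((z - s) / (s * z))| <= (`|t| + 1) * (e / s2).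
    rewrite normrM; apply: ler_pM => //; first by rewrite lerDl.
    have zs0 : 0 <= (z - s) / (s * z) by rewrite divr_ge0 ?subr_ge0// mulr_ge0 ?ltW.
    rewrite ger0_norm//; apply: ler_pM.
    - by rewrite subr_ge0.
    - by rewrite invr_ge0 mulr_ge0 ?ltW.
    - lra.
    - by rewrite lef_pV2 ?posrE ?mulr_gt0// -s2E expr2 ler_pM2l.
  have h3 : 2 * de / s = eta / 8 / 32 by rewrite /de; field; rewrite gt_eqF.
  have h4 : (`|t| + 1) * (e / s2) <= eta / 8 / 32.
    have ec : e <= c by rewrite ge_min lexx orbT.
    apply: (@le_trans _ _ ((`|t| + 1) * (c / s2))).
      by rewrite ler_pM2l// ler_pM2r ?invr_gt0.
    rewrite /c; apply: eq_ler.
    by field; rewrite !gt_eqF.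
  have := ler_normB (a / z) (t * ((z - s) / (s * z))); lra.
have cv1 := @smoothed_cvg (t + 2 * de) e e0.
have cv2 := @smoothed_cvg (t - 2 * de) e e0.
move: cv1 => /cvgrPdist_le/(_ _ eta8) cv1.
move: cv2 => /cvgrPdist_le/(_ _ eta8) cv2.
apply: (filterS _ (filterI cv1 (filterI cv2 (YS de0 eta8)))) => n [n1 [n2 [B [mB YB PB]]]].
have {}PB : mean P (fun w => \1_B w) <= eta / 8 by rewrite -lee_fin mean_indic.
have bB : bdmeas (fun w => (\1_B w : R)) by exact: bdmeas_indic.
have bA : bdmeas (fun w => (\1_[set w | Y n w <= t] w : R)) by exact: bdmeas_indic.
have notB w : w \notin B -> `|Y n w - S n w| <= de.
  by move=> /negP wB; apply: contrapT => h; apply: wB; rewrite inE; apply: YB.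
have up : mean P (fun w => \1_[set w | Y n w <= t] w) <=
    mean P (fun w => Phi ((t + 2 * de - S n w) / e)) + eta / 8 + eta / 8.
  have bu : bdmeas (fun w => Phi ((t + 2 * de - S n w) / e) + \1_B w) by exact: bdmeasD.
  apply: (@le_trans _ _ (mean P (fun w =>
      Phi ((t + 2 * de - S n w) / e) + \1_B w + (1 - Phi (de / e))))).
    apply: mean_le => //; first by apply: bdmeasD => //; exact: bdmeas_cst.
    move=> w; rewrite !indicE.
    apply: indic_upper; [exact: normal_cdf_ge0|exact: normal_cdf_le1|].
    rewrite inE/= => Yt /notB wB; apply: normal_cdf_nondecreasing.
    rewrite ler_pM2r ?invr_gt0//; exact: shift_upper wB Yt.
  rewrite (meanD P bu (bdmeas_cst T (1 - Phi (de / e)))) mean_cst.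
  by rewrite (meanD P (bPhi _ _ _) bB) lerD// lerD2l.
have lo : mean P (fun w => Phi ((t - 2 * de - S n w) / e)) - eta / 8 - eta / 8 <=
    mean P (fun w => \1_[set w | Y n w <= t] w).
  have bu : bdmeas (fun w => Phi ((t - 2 * de - S n w) / e) - \1_B w) by exact: bdmeasB.
  apply: (@le_trans _ _ (mean P (fun w =>
      Phi ((t - 2 * de - S n w) / e) - \1_B w - Phi (- (de / e))))); last first.
    apply: mean_le => //; first by apply: bdmeasB => //; exact: bdmeas_cst.
    move=> w; rewrite !indicE.
    apply: indic_lower; [exact: normal_cdf_le1|exact: normal_cdf_ge0|].
    rewrite notin_setE/= => /negP; rewrite -ltNge => Yt /notB wB.
    apply: normal_cdf_nondecreasing; rewrite -[leRHS]mulNr ler_pM2r ?invr_gt0//.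
    exact: shift_lower wB Yt.
  rewrite (meanB P bu (bdmeas_cst T (Phi (- (de / e))))) mean_cst.
  by rewrite (meanB P (bPhi _ _ _) bB) lerB// lerD2l lerN2.
have a1 : `|2 * de| <= 2 * de by rewrite ger0_norm// mulr_ge0// ltW.
have a2 : `|- (2 * de)| <= 2 * de by rewrite normrN.
exact: (sandwich n1 n2 (close _ a1) (close _ a2) up lo).
Qed.

End clt.

(** * Tails and separation *)

Section tails.
Context d (T : measurableType d) (R : realType) (P : probability T R).

Lemma tail_mean (X : {RV P >-> R}) (e : R) : 0 < e ->
  exists2 A : R, 0 < A & mean P (fun w => \1_[set w | A <= `|X w|] w) <= e.
Proof.
move=> e0; pose E k := [set w | k%:R <= `|X w|].
have mX : measurable_fun setT (fun w => `|X w|) by exact: measurableT_comp.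
have mE k : measurable (E k) := measurable_superlevel _ mX.
have : P (E k) @[k --> \oo] --> P (\bigcap_k E k).
  apply: nonincreasing_cvg_mu => //.
  - by rewrite (le_lt_trans (probability_le1 _ _)) ?ltry.
  - exact: bigcap_measurable.
  - by move=> m n mn; apply/subsetPset => w /=; apply: le_trans; rewrite ler_nat.
rewrite (_ : \bigcap_k E k = set0) ?measure0; last first.
  rewrite -subset0 => w /(_ (Num.truncn `|X w|).+1 Logic.I); rewrite /E /=.
  by rewrite leNgt truncnS_gt.
move=> /fine_cvgP[_ /cvgrPdist_le/(_ _ e0)[N _ hN]].
exists N.+1%:R => //; have := hN N.+1 (leqnSn N).
rewrite sub0r normrN /= -mean_indic//=; apply: le_trans; exact: ler_norm.
Qed.

(** Shifts beyond the bulk of the law bring the mean close to its supremum, so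
    the gap of intermediate shifts extends to all of them. *)
Lemma mean_translate_gap_unbounded (X : {RV P >-> R}) (rho : R -> R) :
  measurable_fun setT rho -> (forall y, 0 <= rho y) -> (forall y, rho y <= 1) ->
  (forall y, rho (- y) = rho y) -> (forall t v, `|t| <= `|v| -> rho t <= rho v) ->
  rho t @[t --> +oo] --> (1 : R) ->
  (forall c K : R, 0 < c -> c <= K -> exists2 kappa : R, 0 < kappa &
     forall t, c <= `|t| -> `|t| <= K ->
     mean P (fun w => rho (X w)) + kappa <= mean P (fun w => rho (X w - t))) ->
  forall c : R, 0 < c -> exists2 kappa : R, 0 < kappa & forall t, c <= `|t| ->
     mean P (fun w => rho (X w)) + kappa <= mean P (fun w => rho (X w - t)).
Proof.
move=> mrho rho0 rho1 rhoN rho_mono rho_lim gap c c0.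
have b t : bdmeas (fun w => rho (X w - t)).
  split; last by exists 1 => w; rewrite ger0_norm.
  by apply: (measurableT_comp mrho); exact: measurable_funB.
set m := mean P _ in gap *.
have [k1 k10 hk1] := gap c c c0 (lexx c).
have m1 : m < 1.
  have := hk1 c; rewrite (gtr0_norm c0) => /(_ (lexx _) (lexx _)).
  have : mean P (fun w => rho (X w - c)) <= 1.
    by rewrite -[leRHS](mean_cst P); apply: mean_le => //; exact: bdmeas_cst.
  lra.
pose e := (1 - m) / 4; have e0 : 0 < e by rewrite divr_gt0// subr_gt0.
have [A A0 hA] := tail_mean X e0.
have [y0 y00 hy0] : exists2 y0 : R, 0 < y0 & forall y, y0 <= `|y| -> 1 - e <= rho y.
  have /cvgrPdist_le/(_ _ e0)[M [_ hM]] := rho_lim.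
  exists (`|M| + 1) => [|y hy]; first by rewrite ltr_wpDl.
  have : 1 - e <= rho `|y|.
    have := hM `|y|; rewrite ler_norml => /(_ _)/andP[]; last by lra.
    by apply: lt_le_trans hy; rewrite ltr_pwDr// ler_norm.
  move=> /le_trans; apply; apply: rho_mono; by rewrite normr_id.
have Ky : c <= c + A + y0 by lra.
have [k2 k20 hk2] := gap c _ c0 Ky.
exists (Num.min k2 e); first by rewrite lt_min k20.
move=> t ct; have [tK|tK] := leP `|t| (c + A + y0).
  by apply: le_trans (hk2 t ct tK); rewrite lerD2l ge_min lexx.
apply: (@le_trans _ _ (m + e)); first by rewrite lerD2l ge_min lexx orbT.
pose B := [set w | A <= `|X w|].
have mB : measurable B.
  by apply: measurable_superlevel; exact: measurableT_comp.
have bB : bdmeas (fun w => (\1_B w : R)) by exact: bdmeas_indic.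
apply: (@le_trans _ _ (mean P (fun w => 1 - e - \1_B w))).
  rewrite meanB//; last exact: bdmeas_cst.
  by rewrite mean_cst; move: hA; rewrite -/B /e; lra.
apply: mean_le => //; first by apply: bdmeasB => //; exact: bdmeas_cst.
move=> w; rewrite indicE; case: (boolP (w \in B)) => [_|].
  by apply: le_trans (rho0 _); rewrite /=; lra.
rewrite notin_setE/= => /negP; rewrite -ltNge => XA.
rewrite subr0; apply: hy0.
have := lerB_dist t (X w); rewrite distrC; lra.
Qed.

End tails.

(** * Uniform laws of large numbers over nets *)

Section union_bound.
Context d (T : measurableType d) (R : realType) (P : probability T R).

Lemma measure_bigsetU_le_const (C : finType) (B : C -> set T) (b : R) :
  (forall c, measurable (B c)) -> (forall c, (P (B c) <= b%:E)%E) ->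
  (P (\big[setU/set0]_c B c) <= (#|C|%:R * b)%:E)%E.
Proof.
move=> mB Bb; rewrite cardE -[index_enum C]enumT.
elim: (enum C) => [|c r ih]; first by rewrite big_nil measure0 mul0r.
rewrite big_cons; apply: le_trans (measureU2 _ _ _) _ => //.
  exact: bigsetU_measurable.
by rewrite /= -natr1 mulrDl mul1r EFinD addeC leeD.
Qed.

(** Union bound: exponential tails beat the cardinality of the nets [C n]. *)
Lemma whp_union_exponential (X : forall n, 'I_n -> {RV P >-> R}) (C : nat -> finType)
    (h : forall n, C n -> 'I_n -> R -> R) (K e : R) :
  (forall n, mutually_independent (@X n)) ->
  (forall n c i, measurable_fun setT (@h n c i)) ->
  (forall n c i y, `|@h n c i y| <= K) ->
  (forall n c i, mean P (fun w => @h n c i (X n i w)) = 0) ->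
  0 < K -> 0 < e -> e <= 2 * K ->
  #|C n|%:R * expR (- (n%:R * (e ^+ 2 / (8 * K ^+ 2)))) @[n --> \oo] --> (0 : R) ->
  whp P (fun n => [set w | forall c, \sum_i @h n c i (X n i w) < n%:R * e]).
Proof.
move=> indX mh hK h0 K0 e0 eK lim0.
have mS n c : measurable [set w | n%:R * e <= \sum_i @h n c i (X n i w)].
  apply: measurable_superlevel.
  suff [] : bdmeas (fun w => \sum_i @h n c i (X n i w)) by [].
  by apply: bdmeas_sum => i _; split; [exact: measurableT_comp|exists K].
pose B n := \big[setU/set0]_c [set w | n%:R * e <= \sum_i @h n c i (X n i w)].
have := @whp_cvg0 _ _ _ P B _ _ _ lim0; move=> /(_ _ _)/whpS; apply.
- by move=> n; exact: bigsetU_measurable.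
- apply: nearW => n; apply: measure_bigsetU_le_const => // c.
  by rewrite [X in expR (- X)]mulrA; exact: exponential_tail.
- move=> n w nB c; rewrite ltNge; apply/negP => hc; apply: nB.
  by rewrite /B -bigcup_seq; exists c => //=; rewrite mem_index_enum.
Qed.

Lemma cvg_expR_natN (th : R) : 0 < th -> expR (- (n%:R * th)) @[n --> \oo] --> (0 : R).
Proof.
move=> th0; apply/cvgrPdist_le => e e0; near=> n.
rewrite sub0r normrN ger0_norm ?expR_ge0// expRN.
have n0 : e^-1 / th <= n%:R by near: n; exact: nbhs_infty_ger.
rewrite -[leRHS]invrK lef_pV2 ?posrE ?invr_gt0 ?expR_gt0//.
apply: le_trans (expR_ge1Dx _); rewrite ler_wpDl//.
by rewrite -ler_pdivrMr.
Unshelve. all: by end_near. Qed.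

(** A net with polynomially many points per dimension is negligible against
    exponential tails as soon as [p * ln n = o(n)]. *)
Lemma net_size_cvg (p A : nat -> nat) (k : nat) (th : R) : 0 < th ->
  (p n)%:R * ln n%:R / n%:R @[n --> \oo] --> (0 : R) ->
  (\forall n \near \oo, (A n <= n ^ k)%N) ->
  (A n ^ p n)%:R * expR (- (n%:R * th)) @[n --> \oo] --> (0 : R).
Proof.
move=> th0 hp hA; have th2 : 0 < th / 2 by rewrite divr_gt0.
have thk : 0 < th / 2 / k.+1%:R by rewrite divr_gt0.
have := cvg_expR_natN th2; apply: squeeze_cvgr; last exact: cvg_cst.
move/cvgrPdist_le : hp => /(_ _ thk) hp.
near=> n; apply/andP; split; first by rewrite mulr_ge0 ?expR_ge0.
have n0 : (0 < n)%N by near: n; exact: nbhs_infty_gt.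
have nR : 0 < n%:R :> R by rewrite ltr0n.
have hpn : (p n)%:R * ln n%:R / n%:R <= th / 2 / k.+1%:R.
  have : `|0 - (p n)%:R * ln n%:R / n%:R| <= th / 2 / k.+1%:R by near: n.
  by rewrite sub0r normrN; apply: le_trans; exact: ler_norm.
have An : (A n <= n ^ k)%N by near: n.
apply: (@le_trans _ _ (expR (n%:R * (th / 2)) * expR (- (n%:R * th)))); last first.
  by rewrite -expRD ler_expR; lra.
rewrite ler_pM2r ?expR_gt0//.
apply: (@le_trans _ _ ((n ^ (k.+1 * p n))%:R)).
  rewrite ler_nat expnM; have [->//|p0] := posnP (p n).
  rewrite leq_exp2r//; apply: leq_trans An _.
  exact: leq_pexp2l.
have -> : (n ^ (k.+1 * p n))%:R = expR ((k.+1 * p n)%:R * ln n%:R) :> R.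
  by rewrite natrX -[in LHS](lnK (x := n%:R)) ?posrE// -expRM_natl.
rewrite ler_expR natrM.
have : (p n)%:R * ln n%:R <= n%:R * (th / 2 / k.+1%:R).
  by rewrite mulrC [leRHS]mulrC -ler_pdivrMr// mulrC.
rewrite mulrA ler_pdivlMr ?ltr0n//; lra.
Unshelve. all: by end_near. Qed.

End union_bound.

(** * Consequences of the design conditions *)

Lemma unit_scale (R : realType) (p : nat) (z : 'cV[R]_p) : z != 0 ->
  exists2 z', l2norm z' = 1 & z = l2norm z *: z'.
Proof.
move=> z0; have nz : l2norm z != 0 by apply: contra_neq z0 => /l2norm_eq0.
exists ((l2norm z)^-1 *: z); last by rewrite scalerA divff// scale1r.
by rewrite l2normZ ger0_norm ?invr_ge0 ?l2norm_ge0// mulVf.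
Qed.

Lemma l2norm0 (R : realType) (p : nat) : l2norm (0 : 'cV[R]_p) = 0.
Proof. by rewrite /l2norm dotv0r sqrtr0. Qed.

Section design.
Variables (R : realType) (p : nat -> nat) (x : forall n, 'I_n -> 'cV[R]_(p n)).
Arguments x : clear implicits.

Hypothesis hlower : forall c : R, 0 < c -> exists a delta C : R,
  [/\ 0 < a, 0 < delta, 0 < C &
    forall n (beta z : 'cV[R]_(p n)), (0 < n)%N ->
      l2norm beta <= delta -> l2norm z = 1 ->
      let J := (slab (x n) beta c :&: slab (x n) z C)%SET in
      a * n%:R <= \sum_(i in J) dotv (x n i) z ^+ 2].
Hypothesis hupper : forall c e : R, 0 < c -> 0 < e -> exists delta' C : R,
  [/\ 0 < delta', 0 < C &
    forall n (beta z : 'cV[R]_(p n)), (0 < n)%N ->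
      l2norm beta <= delta' -> l2norm z = 1 ->
      let J := (slab (x n) beta c :&: slab (x n) z C)%SET in
      \sum_(i | i \notin J) dotv (x n i) z ^+ 2 <= e * n%:R].

Lemma in_slab0 n (z : 'cV[R]_(p n)) C i :
  (i \in (slab (x n) 0 1 :&: slab (x n) z C)%SET) = (`|dotv (x n i) z| <= C).
Proof. by rewrite !inE dotv0r normr0 ler01. Qed.

Lemma design_tail (e : R) : 0 < e -> exists2 C : R, 0 < C &
  forall n (z : 'cV[R]_(p n)), (0 < n)%N -> l2norm z = 1 ->
  \sum_(i | C < `|dotv (x n i) z|) dotv (x n i) z ^+ 2 <= e * n%:R.
Proof.
move=> e0; have [de [C [de0 C0 h]]] := hupper ltr01 e0.
exists C => // n z n0 z1; have := h n 0 z n0 _ z1; rewrite l2norm0 => /(_ (ltW de0)).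
apply: le_trans; apply: eq_ler.
by apply: eq_bigl => i; rewrite in_slab0 -ltNge.
Qed.

Lemma design_lower : exists2 a : R, 0 < a & exists2 C : R, 0 < C &
  forall n (z : 'cV[R]_(p n)), (0 < n)%N -> l2norm z = 1 ->
  a * n%:R <= \sum_(i | `|dotv (x n i) z| <= C) dotv (x n i) z ^+ 2.
Proof.
have [a [de [C [a0 de0 C0 h]]]] := hlower ltr01.
exists a => //; exists C => // n z n0 z1.
have := h n 0 z n0 _ z1; rewrite l2norm0 => /(_ (ltW de0)) /le_trans; apply.
apply: eq_ler.
by apply: eq_bigl => i; rewrite in_slab0.
Qed.

(** Splitting at the level of [design_tail] bounds the largest eigenvalue. *)
Lemma design_upper : exists2 tau : R, 0 < tau & forall n (z : 'cV[R]_(p n)),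
  (0 < n)%N -> \sum_i dotv (x n i) z ^+ 2 <= tau * n%:R * l2norm z ^+ 2.
Proof.
have [C C0 hC] := design_tail ltr01.
exists (1 + C ^+ 2) => [|n z n0]; first by rewrite ltr_wpDr ?sqr_ge0.
have [->|z0] := eqVneq z 0.
  rewrite l2norm0 expr0n mulr0 big1// => i _; by rewrite dotv0r expr0n.
have [z' z'1 zE] := unit_scale z0.
rewrite [in leLHS]zE; under eq_bigr do rewrite dotvZr exprMn.
rewrite -mulr_sumr mulrC ler_wpM2r ?sqr_ge0//.
rewrite (bigID (fun i => C < `|dotv (x n i) z'|))/= mulrDl lerD ?hC//.
apply: (@le_trans _ _ (\sum_(i < n) C ^+ 2)).
  apply: (@le_trans _ _ (\sum_(i < n | ~~ (C < `|dotv (x n i) z'|)) C ^+ 2)).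
    apply: ler_sum => i; rewrite -leNgt => hi.
    by rewrite -[leLHS]real_normK ?num_real// lerXn2r// nnegrE ltW.
  by rewrite [leRHS](bigID (fun i => C < `|dotv (x n i) z'|))/= lerDr sumr_ge0// => i _; rewrite sqr_ge0.
by rewrite sumr_const card_ord -[leLHS]mulr_natr.
Qed.

Lemma design_lower_norm : exists2 a : R, 0 < a & forall n (z : 'cV[R]_(p n)),
  (0 < n)%N -> a * n%:R * l2norm z ^+ 2 <= \sum_i dotv (x n i) z ^+ 2.
Proof.
have [a a0 [C C0 h]] := design_lower; exists a => // n z n0.
have [->|z0] := eqVneq z 0.
  by rewrite l2norm0 expr0n mulr0 sumr_ge0// => i _; rewrite sqr_ge0.
have [z' z'1 zE] := unit_scale z0.
rewrite [in leRHS]zE; under [leRHS]eq_bigr do rewrite dotvZr exprMn.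
rewrite -mulr_sumr mulrC ler_wpM2l ?sqr_ge0//; apply: le_trans (h n z' n0 z'1) _.
rewrite [leRHS](bigID (fun i => `|dotv (x n i) z'| <= C))/= lerDl sumr_ge0// => i _.
by rewrite sqr_ge0.
Qed.

(** A quadratic form of order [n] made of terms at most [C ^+ 2] has a number of
    non-negligible terms proportional to [n]. *)
Lemma design_count : exists2 h : R, 0 < h & exists2 q : R, 0 < q &
  forall n (z : 'cV[R]_(p n)), (0 < n)%N -> l2norm z = 1 ->
  q * n%:R <= #|[pred i | h <= `|dotv (x n i) z|]|%:R.
Proof.
have [a a0 [C C0 hC]] := design_lower.
have a2 : 0 < a / 2 by rewrite divr_gt0.
exists (Num.sqrt (a / 2)); first by rewrite sqrtr_gt0.
exists (a / 2 / C ^+ 2) => [|n z n0 z1]; first by rewrite divr_gt0// exprn_gt0.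
set h := Num.sqrt _; have h0 : 0 <= h by exact: sqrtr_ge0.
have h2 : h ^+ 2 = a / 2 by rewrite sqr_sqrtr// ltW.
rewrite mulrAC ler_pdivrMr ?exprn_gt0//.
have up : \sum_(i | `|dotv (x n i) z| <= C) dotv (x n i) z ^+ 2 <=
    \sum_(i < n) a / 2 + \sum_(i < n | h <= `|dotv (x n i) z|) C ^+ 2.
  rewrite [X in _ + X]big_mkcond -big_split/= big_mkcond; apply: ler_sum => i _.
  have sq : dotv (x n i) z ^+ 2 = `|dotv (x n i) z| ^+ 2 by rewrite real_normK ?num_real.
  case: ifPn => [hi|_]; last first.
    by rewrite addr_ge0 ?(ltW a2)//; case: ifP => // _; rewrite sqr_ge0.
  case: ifPn => [_|].
    by rewrite ler_wpDl ?(ltW a2)// sq lerXn2r// nnegrE ltW.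
  by rewrite -ltNge addr0 -h2 sq => /ltW hh; rewrite lerXn2r.
rewrite sumr_const card_ord -[(a / 2) *+ n]mulr_natr in up.
have sumC : \sum_(i < n | h <= `|dotv (x n i) z|) C ^+ 2 =
    C ^+ 2 * #|[pred i | h <= `|dotv (x n i) z|]|%:R by rewrite sumr_const mulr_natr.
rewrite sumC in up; have := hC n z n0 z1; lra.
Qed.

Lemma design_span n (z : 'cV[R]_(p n)) : (0 < n)%N ->
  (forall i, dotv (x n i) z = 0) -> z = 0.
Proof.
move=> n0 xz; have [a a0 h] := design_lower_norm.
apply: l2norm_eq0; apply/eqP; rewrite -sqrf_eq0 eq_le sqr_ge0 andbT.
have an : 0 < a * n%:R by rewrite mulr_gt0// ltr0n.
rewrite -(pmulr_rle0 _ an); apply: le_trans (h n z n0) _.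
by rewrite big1// => i _; rewrite xz expr0n.
Qed.

End design.

(** * Consistency *)

(** Clamping the shift at a level that the error does not reach can only bring it
    closer to the error. *)
Lemma clamp_loss (R : realType) (rho : R -> R) (K y t : R) : 0 <= K ->
  (forall y, 0 <= rho y) -> (forall y, rho y <= 1) ->
  (forall t v, `|t| <= `|v| -> rho t <= rho v) ->
  rho (y - clamp K t) - (K <= `|y|)%R%:R <= rho (y - t).
Proof.
move=> K0 rho0 rho1 rho_mono; case: (leP K `|y|) => [_|yK].
  by rewrite mulr1n; have := rho1 (y - clamp K t); have := rho0 (y - t); lra.
rewrite mulr0n subr0; apply: rho_mono; move: yK; rewrite ltr_norml => /andP[y1 y2].
case: (clamp_cases t K0) => -[ht ->] //.
  by rewrite !ler0_norm; lra.
by rewrite !ger0_norm; lra.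
Qed.

Lemma ge_clamp (R : realType) (K c t : R) : 0 <= K -> c <= K -> c <= `|t| ->
  c <= `|clamp K t|.
Proof.
move=> K0 cK ct; case: (clamp_cases t K0) => -[ht ->] //; first by rewrite ger0_norm.
by rewrite normrN ger0_norm.
Qed.

Lemma loss_lower_bound (R : realType) (g g' r r' l l0 B th : R) :
  `|g - g'| <= th -> `|r - r'| <= th -> `|l - l0| <= th -> r - B <= l0 ->
  g - 3 * th - (g' - r') - B <= l.
Proof. by rewrite !ler_norml => /andP[? ?] /andP[? ?] /andP[? ?] ?; lra. Qed.

(** Comparison of the mean loss of a minimizer with that of the true parameter: the
    separation [kappa] on a proportion [q] of the sample exceeds the errors [th]. *)
Lemma no_large_minimizer (R : realType) (n m th kappa q SG SD SB SR : R) :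
  0 < n -> 0 < q * kappa -> th <= q * kappa / 16 -> n * m + kappa * (q * n) <= SG ->
  SD < n * th -> SR <= n * (m + th) -> SB <= n * (th + th) ->
  SG - n * (3 * th) - SD - SB <= SR + n * th -> False.
Proof.
move=> n0 qk0 thq h1 h2 h3 h4 h5.
have := mulr_gt0 n0 qk0; have : n * th <= n * (q * kappa / 16) by rewrite ler_pM2l.
lra.
Qed.

Lemma sum_split4 (R : realType) n (f g h : 'I_n -> R) (c : R) :
  \sum_i (f i - c - g i - h i) = \sum_i f i - n%:R * c - \sum_i g i - \sum_i h i.
Proof. by rewrite 3!sumrB sumr_const card_ord mulr_natl. Qed.

Section consistency.
Context d (T : measurableType d) (R : realType) (P : probability T R).
Variables (p : nat -> nat) (x : forall n, 'I_n -> 'cV[R]_(p n)).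
Arguments x : clear implicits.
Variables (u : forall n, 'I_n -> {RV P >-> R}) (u0 : {RV P >-> R}).
Arguments u : clear implicits.
Hypothesis indu : forall n, mutually_independent (u n).
Hypothesis mean_u : forall n i (h : R -> R), measurable_fun setT h ->
  (exists K : R, forall y, `|h y| <= K) ->
  mean P (fun w => h (u n i w)) = mean P (fun w => h (u0 w)).
Variables (s : nat -> T -> R) (s0 : R) (b : forall n, T -> 'cV[R]_(p n)).
Hypothesis s00 : 0 < s0.
Hypothesis s_cvg : forall e : R, 0 < e -> whp P (fun n => [set w | `|s n w - s0| <= e]).
Variables (rho psi : R -> R) (K : R).
Hypothesis K0 : 0 <= K.
Hypothesis rho_psi : forall c : R, is_derive c 1 rho (psi c).
Hypothesis psiK : forall t, `|psi t| <= K.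
Hypothesis tpsiK : forall t, `|t * psi t| <= K.
Hypothesis rho_ge0 : forall y, 0 <= rho y.
Hypothesis rho_le1 : forall y, rho y <= 1.
Hypothesis rho_mono : forall t v, `|t| <= `|v| -> rho t <= rho v.

Let rs y := rho (y / s0).

Hypothesis gap_ge : forall t, mean P (fun w => rs (u0 w)) <= mean P (fun w => rs (u0 w - t)).
Hypothesis gap : forall c : R, 0 < c -> exists2 kappa : R, 0 < kappa &
  forall t, c <= `|t| ->
  mean P (fun w => rs (u0 w)) + kappa <= mean P (fun w => rs (u0 w - t)).

Hypothesis count : exists2 h : R, 0 < h & exists2 q : R, 0 < q &
  forall n (z : 'cV[R]_(p n)), (0 < n)%N -> l2norm z = 1 ->
  q * n%:R <= #|[pred i | h <= `|dotv (x n i) z|]|%:R.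
Hypothesis span : forall n (z : 'cV[R]_(p n)), (0 < n)%N ->
  (forall i, dotv (x n i) z = 0) -> z = 0.
Hypothesis hp : (p n)%:R * ln n%:R / n%:R @[n --> \oo] --> (0 : R).
Hypothesis b_min : forall n w (beta : 'cV[R]_(p n)),
  \sum_i rho ((u n i w - dotv (x n i) (b n w)) / s n w) <=
  \sum_i rho ((u n i w - dotv (x n i) beta) / s n w).

Let crho : continuous rho.
Proof.
move=> t; apply: differentiable_continuous; apply/derivable1_diffP.
by have [] := rho_psi t.
Qed.

Let mrs : measurable_fun setT rs.
Proof.
apply: (measurableT_comp (continuous_measurable_fun crho)).
exact: measurable_funM.
Qed.

Let mrst t : measurable_fun setT (fun y : R => rs (y - t)).
Proof. by apply: (measurableT_comp mrs); exact: measurable_funB. Qed.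

Let rs_mono t v : `|t| <= `|v| -> rs t <= rs v.
Proof.
by move=> tv; apply: rho_mono; rewrite !normrM ler_wpM2r// normr_ge0.
Qed.

Let rs_norm y : `|rs y| <= 1.
Proof. by rewrite ger0_norm /rs. Qed.

Let L := K / s0.

Let rs_lip y z : `|rs y - rs z| <= L * `|y - z|.
Proof.
apply: le_trans (lipschitz_of_derive rho_psi psiK _ _) _.
rewrite -mulrBl normrM (gtr0_norm (x := s0^-1)) ?invr_gt0// /L.
by apply: eq_ler; ring.
Qed.

Let G t := mean P (fun w => rs (u0 w - t)).
Let m := mean P (fun w => rs (u0 w)).

Let brs t : bdmeas (fun w => rs (u0 w - t)).
Proof. by split; [exact: (measurableT_comp (mrst t))|exists 1]. Qed.

Let G_lip t v : `|G t - G v| <= L * `|t - v|.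
Proof.
rewrite /G -meanB//; apply: mean_norm_le; first exact: bdmeasB.
move=> w; apply: le_trans (rs_lip _ _) _; rewrite distrC.
by rewrite (_ : u0 w - v - (u0 w - t) = t - v)//; ring.
Qed.

Let mean01 (f : T -> R) : bdmeas f -> (forall w, 0 <= f w) -> (forall w, f w <= 1) ->
  0 <= mean P f <= 1.
Proof.
move=> bf f0 f1; rewrite mean_ge0//= -[leRHS](mean_cst P).
by apply: mean_le => //; exact: bdmeas_cst.
Qed.

Let sub01 (a c : R) : 0 <= a <= 1 -> 0 <= c <= 1 -> `|a - c| <= 1.
Proof. by move=> /andP[? ?] /andP[? ?]; rewrite ler_norml; apply/andP; split; lra. Qed.

Let whp_average (h : R -> R) (e : R) : measurable_fun setT h ->
  (forall y, 0 <= h y <= 1) -> 0 < e -> e <= 2 ->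
  whp P (fun n => [set w | \sum_i h (u n i w) <=
    n%:R * (mean P (fun w => h (u0 w)) + e)]).
Proof.
move=> mh h01 e0 e2; set M := mean P _.
have hb : exists K : R, forall y, `|h y| <= K.
  by exists 1 => y; have /andP[? ?] := h01 y; rewrite ger0_norm.
have bh : bdmeas (fun w => h (u0 w)).
  by split; [exact: measurableT_comp|have [k hk] := hb; exists k].
have M01 : 0 <= M <= 1.
  by apply: mean01 => // w; have /andP[] := h01 (u0 w).
have := @whp_union_exponential _ _ _ P u (fun=> unit) (fun n _ i y => h y - M) 1 e indu.
move=> /(_ _ _ _ _ _ _ _)/whpS; apply => //.
- by move=> n _ i; exact: measurable_funB.
- by move=> n _ i y; exact: sub01.
- move=> n _ i; have bi : bdmeas (fun w => h (u n i w)).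
    by split; [exact: measurableT_comp|have [k hk] := hb; exists k].
  rewrite meanB//; last exact: bdmeas_cst.
  by rewrite mean_cst mean_u// subrr.
- by rewrite mulr1.
- under eq_fun do rewrite card_unit mul1r.
  by apply: cvg_expR_natN; rewrite divr_gt0 ?exprn_gt0// mulr_gt0// exprn_gt0.
- move=> n w /(_ tt) /ltW /=; rewrite sumrB sumr_const card_ord lerBlDl.
  by rewrite mulrDr [n%:R * M]mulr_natl.
Qed.

(** The loss at an arbitrary parameter is compared with the loss at a vertex of the
    arrangement that has almost the same clamped shifts. The vertices are so few that
    the mean losses there are close to their expectations, which exceed those at the
    true parameter by a fixed amount as soon as many shifts are bounded away from 0. *)
Theorem consistency (e1 : R) : 0 < e1 -> whp P (fun n => [set w | l2norm (b n w) <= e1]).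
Proof.
move=> e10; have [h h0 [q q0 hq]] := count.
have c0 : 0 < e1 * h by rewrite mulr_gt0.
have [kappa kappa0 hk] := gap c0.
pose th := Num.min (q * kappa / 16) 1.
have th0 : 0 < th by rewrite lt_min ltr01 andbT divr_gt0// mulr_gt0.
have th1 : th <= 1 by rewrite ge_min lexx orbT.
have thq : th <= q * kappa / 16 by rewrite ge_min lexx.
have [A A0 hA] := tail_mean u0 th0.
pose e := th / (L + 1).
have L0 : 0 <= L by rewrite divr_ge0// ltW.
have e0 : 0 < e by rewrite divr_gt0// ltr_wpDl.
have Le : L * e <= th.
  rewrite /e mulrCA ler_piMr ?(ltW th0)// ler_pdivrMr ?ltr_wpDl// mul1r.
  by rewrite lerDl.
(* the clamping level [Kc] lies beyond the bulk of the errors and is a multiple of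
   the mesh [e] of the arrangement *)
pose mm := (Num.truncn ((A + e1 * h) / e)).+1.
have [Kc KcE] : exists Kc, Kc = mm%:R * e by exists (mm%:R * e).
have Kc1 : A + e1 * h <= Kc.
  by rewrite KcE -ler_pdivrMr// ltW// truncnS_gt.
have KcA : A <= Kc by lra.
have Kcc : e1 * h <= Kc by lra.
have Kc0 : 0 <= Kc by lra.
pose de := Num.min (s0 / 2) (th / (8 * K / s0 + 1)).
have L80 : 0 <= 8 * K / s0 by rewrite !mulr_ge0// invr_ge0 ltW.
have de0 : 0 < de by rewrite lt_min !divr_gt0// ltr_wpDl.
have de1 : de <= s0 / 2 by rewrite ge_min lexx.
have de2 : 8 * K / s0 * de <= th.
  apply: (@le_trans _ _ ((8 * K / s0 + 1) * de)).
    by rewrite ler_wpM2r ?(ltW de0)// lerDl.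
  by rewrite mulrC -ler_pdivlMr ?ltr_wpDl// ge_min lexx orbT.
have th2 : th <= 2 by apply: le_trans th1 _; rewrite ler1n.
have E2 := @whp_average rs th mrs (fun y => _) th0 th2.
have mB : measurable_fun setT (fun y : R => (Kc <= `|y|)%R%:R : R).
  rewrite (_ : (fun y => _) = \1_[set y : R | Kc <= `|y|]); last first.
    by apply/funext => y; rewrite indicE mem_setE.
  by apply: measurable_indic; apply: measurable_superlevel; exact: normr_measurable.
have E3 := @whp_average (fun y => (Kc <= `|y|)%R%:R) th mB _ th0 th2.
pose code n := {ffun 'I_(p n) -> 'I_n * 'I_(2 * mm).+1} : finType.
pose tt n (f : code n) i := clamp Kc (dotv (x n i) (vertex e (x n) f)).
have E1 : whp P (fun n => [set w | forall f : code n,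
    \sum_i (G (tt n f i) - rs (u n i w - tt n f i)) < n%:R * th]).
  apply: (@whp_union_exponential _ _ _ P u code
    (fun n f i y => G (tt n f i) - rs (y - tt n f i)) 1 th indu) => //.
  - by move=> n f i; apply: measurable_funB => //; exact: mrst.
  - move=> n f i y; apply: sub01; last by rewrite rho_ge0 rho_le1.
    by apply: mean01 => // w; [exact: rho_ge0|exact: rho_le1].
  - move=> n f i.
    have bi : bdmeas (fun w => rs (u n i w - tt n f i)).
      by split; [exact: (measurableT_comp (mrst _))|exists 1].
    rewrite meanB//; last exact: bdmeas_cst.
    rewrite mean_cst (@mean_u n i (fun y => rs (y - tt n f i))) ?subrr//.
    by exists 1.
  - by rewrite mulr1.
  - pose A0' n := (n * (2 * mm).+1)%N.
    have thh : 0 < th ^+ 2 / (8 * 1 ^+ 2) by rewrite divr_gt0 ?exprn_gt0// mulr_gt0// exprn_gt0.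
    have An : \forall n \near \oo, (A0' n <= n ^ 2)%N.
      near=> n; rewrite /A0' expnS expn1 leq_mul2l; apply/orP; right.
      by near: n; exact: nbhs_infty_ge.
    have := net_size_cvg thh hp An.
    by under eq_fun do rewrite /A0' -[in (_ * _).+1]/mm; under [X in _ -> X @ _ --> _]eq_fun do
      rewrite card_ffun card_prod !card_ord.
have E4 := s_cvg de0.
have G01 y : 0 <= rs y <= 1 by rewrite rho_ge0 rho_le1.
have B01 (y : R) : 0 <= ((Kc <= `|y|)%R%:R : R) <= 1 by case: (Kc <= _); rewrite ?ler01 ?lexx.
have {}E2 := E2 G01; have {}E3 := E3 B01.
have mB0 : mean P (fun w => (Kc <= `|u0 w|)%R%:R) <= th.
  apply: le_trans hA; apply: mean_le.
  - split; first exact: (measurableT_comp mB).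
    by exists 1 => w; case: (Kc <= _); rewrite ?normr1 ?normr0.
  - by apply: bdmeas_indic; apply: measurable_superlevel; exact: measurableT_comp.
  - move=> w; rewrite indicE; case: (leP Kc `|u0 w|) => [h1|_]; last by rewrite ler0n.
    by rewrite mem_set//=; exact: le_trans KcA h1.
move: (whpI (whpI E1 E2) (whpI E3 E4)) => /whp_near; apply.
near=> n => w [[F1 F2] [F3 F4]] /=.
have n0 : (0 < n)%N by near: n; exact: nbhs_infty_gt.
rewrite leNgt; apply/negP => be.
have bn0 : 0 < l2norm (b n w) by exact: lt_trans be.
have bnz : b n w != 0 by apply/negP => /eqP h'; move: bn0; rewrite h' l2norm0 ltxx.
have [z z1 bE] := unit_scale bnz.
have spn : forall z' : 'cV[R]_(p n), (forall i, dotv (x n i) z' = 0) -> z' = 0.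
  by move=> z'; exact: span.
have [f hf] := arrangement_net mm e0 spn (b n w).
rewrite -KcE in hf; have {F1} := F1 f; set t' := tt n f => F1.
pose t i := clamp Kc (dotv (x n i) (b n w)).
have tt' i : `|t i - t' i| <= e by exact: hf.
have Le' i : L * `|t i - t' i| <= th by apply: le_trans Le; rewrite ler_wpM2l.
have sa : s0 / 2 <= s n w /\ s n w <= 2 * s0.
  by move: F4; rewrite /= ler_norml => /andP[? ?]; split; lra.
have scale v : `|rho (v / s n w) - rs v| <= th.
  apply: le_trans de2; apply: le_trans (lipschitz_scale s00 K0 rho_psi tpsiK _ _ _ _ _) _.
  - by case: sa.
  - by case: sa.
  - lra.
  - lra.
  - by rewrite ler_wpM2l.
have low i : G (t i) - 3 * th - (G (t' i) - rs (u n i w - t' i)) -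
    (Kc <= `|u n i w|)%R%:R <= rho ((u n i w - dotv (x n i) (b n w)) / s n w).
  have l1 := clamp_loss (u n i w) (dotv (x n i) (b n w)) Kc0 (fun y => rho_ge0 (y / s0))
    (fun y => rho_le1 (y / s0)) rs_mono.
  have l2 := le_trans (G_lip (t i) (t' i)) (Le' i).
  have l3 : `|rs (u n i w - t i) - rs (u n i w - t' i)| <= th.
    apply: le_trans (rs_lip _ _) _; apply: le_trans (Le' i).
    by rewrite ler_wpM2l// le_eqVlt distrC; apply/orP; left; apply/eqP; congr `|_|; ring.
  have l4 := scale (u n i w - dotv (x n i) (b n w)).
  exact: loss_lower_bound l2 l3 l4 l1.
have up i : rho ((u n i w - dotv (x n i) 0) / s n w) <= rs (u n i w) + th.
  by rewrite dotv0r subr0 -lerBlDl; apply: le_trans (scale (u n i w)); exact: ler_norm.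
have cnt : n%:R * m + kappa * (q * n%:R) <= \sum_i G (t i).
  apply: (@le_trans _ _ (\sum_(i < n) (m + kappa * (h <= `|dotv (x n i) z|)%R%:R))).
    rewrite big_split/= sumr_const card_ord -[m *+ n]mulr_natl lerD2l -mulr_sumr.
    rewrite ler_pM2l//; apply: le_trans (hq n z n0 z1) _.
    by rewrite -sum1_card natr_sum big_mkcond/=; apply: ler_sum => i _; rewrite inE; case: ifP.
  apply: ler_sum => i _; case: (leP h) => [hz|_]; last by rewrite mulr0 addr0; exact: gap_ge.
  rewrite mulr1; apply: hk; apply: ge_clamp => //.
  by rewrite bE dotvZr normrM (ger0_norm (ltW bn0)) ler_pM// ltW.
have := le_trans (ler_sum _ (fun i _ => low i)) (le_trans (@b_min n w 0) (ler_sum _ (fun i _ => up i))).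
have Elow : \sum_i (G (t i) - 3 * th - (G (t' i) - rs (u n i w - t' i)) -
      (Kc <= `|u n i w|)%R%:R) = \sum_i G (t i) - n%:R * (3 * th) -
      \sum_i (G (t' i) - rs (u n i w - t' i)) - \sum_i (Kc <= `|u n i w|)%R%:R.
  exact: sum_split4.
have Eup : \sum_i (rs (u n i w) + th) = \sum_i rs (u n i w) + n%:R * th.
  by rewrite big_split/= sumr_const card_ord [n%:R * th]mulr_natl.
rewrite Elow Eup => bound.
have nR : 0 < n%:R :> R by rewrite ltr0n.
have F3' : \sum_i (Kc <= `|u n i w|)%R%:R <= n%:R * (th + th).
  by apply: le_trans F3 _; rewrite ler_pM2l// lerD2r.
exact: (no_large_minimizer nR (mulr_gt0 q0 kappa0) thq cnt F1 F2 F3' bound).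
Unshelve. all: by end_near. Qed.

End consistency.

(** * Rate of convergence *)

Section quadratic_expansion.
Variables (R : realType) (rho psi psi' : R -> R) (K : R).
Hypothesis K0 : 0 <= K.
Hypothesis rho_psi : forall c : R, is_derive c 1 rho (psi c).
Hypothesis psi_psi' : forall c : R, is_derive c 1 psi (psi' c).
Hypothesis psi'K : forall t, `|psi' t| <= K.
Hypothesis psi'_lip : forall s t, `|psi' s - psi' t| <= K * `|s - t|.

(** A bound on the second derivative gives a quadratic remainder also for large
    increments. *)
Lemma quadratic_remainder_sqr (y h : R) :
  rho y + h * psi y + h ^+ 2 / 2 * psi' y - 2 * K * h ^+ 2 <= rho (y + h).
Proof.
have := taylor1 K0 rho_psi (lipschitz_of_derive psi_psi' psi'K) y h.
have h2 : 0 <= h ^+ 2 by exact: sqr_ge0.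
have := psi'K y; rewrite !ler_norml => /andP[_ a] /andP[b _].
have := ler_wpM2l h2 a; have := mulr_ge0 K0 h2; lra.
Qed.

(** The remainder of the expansion of the loss in the direction [z]: cubic for
    the moderate observations, and merely quadratic for the few others. *)
Lemma quadratic_expansion (y g z C : R) : 0 <= g -> 0 <= C ->
  rho y - g * (z * psi y) + g ^+ 2 / 2 * (z ^+ 2 * psi' y) -
    2 * K * g ^+ 2 * (g * C * z ^+ 2 + (C < `|z|)%R%:R * z ^+ 2) <=
  rho (y - g * z).
Proof.
move=> g0 C0; have K2 : 0 <= 2 * K * g ^+ 2 by rewrite !mulr_ge0// sqr_ge0.
have z2 : 0 <= z ^+ 2 by exact: sqr_ge0.
case: (ltP C) => [_|zC].
  have := quadratic_remainder_sqr y (- (g * z)).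
  have : 0 <= 2 * K * g ^+ 2 * (g * C * z ^+ 2) by apply: mulr_ge0 => //; apply: mulr_ge0 => //; exact: mulr_ge0.
  rewrite mul1r; lra.
have := taylor2 K0 rho_psi psi_psi' psi'_lip y (- (g * z)).
rewrite ler_norml => /andP[+ _].
have : K * `|- (g * z)| ^+ 3 <= 2 * K * g ^+ 2 * (g * C * z ^+ 2).
  rewrite normrN normrM (ger0_norm g0) exprMn [`|z| ^+ 3]exprS.
  rewrite (real_normK (num_real z)).
  have -> : K * (g ^+ 3 * (`|z| * z ^+ 2)) = (K * g ^+ 3 * z ^+ 2) * `|z| by ring.
  have -> : 2 * K * g ^+ 2 * (g * C * z ^+ 2) = (K * g ^+ 3 * z ^+ 2) * (2 * C) by ring.
  apply: ler_wpM2l; last lra.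
  by apply: mulr_ge0 => //; apply: mulr_ge0 => //; exact: exprn_ge0.
by rewrite mul0r addr0; lra.
Qed.

End quadratic_expansion.

(** Replacing the square by its clamped version, whose entropy is controlled,
    only costs the tail of the design. *)
Lemma clamped_curvature (R : realType) (z C K ka q q0 m : R) :
  0 <= C -> 0 <= m -> `|q0| <= K -> `|q - q0| <= ka ->
  clamp C z ^+ 2 * (q0 - m) + m * ((`|z| <= C)%R%:R * z ^+ 2) -
    K * ((C < `|z|)%R%:R * z ^+ 2) - ka * z ^+ 2 <= z ^+ 2 * q.
Proof.
move=> C0 m0; rewrite 2!ler_norml => /andP[q1 q2] /andP[q3 q4].
have z2 : 0 <= z ^+ 2 by exact: sqr_ge0.
have zq : - (ka * z ^+ 2) <= z ^+ 2 * (q - q0).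
  by rewrite mulrC -mulrN ler_wpM2l.
have [zC|zC] := leP `|z| C.
  move: zC; rewrite ler_norml => /andP[a b]; rewrite clamp_id// mul1r mul0r; lra.
have c2 : 0 <= clamp C z ^+ 2 <= z ^+ 2.
  rewrite sqr_ge0 /= -[leRHS]real_normK ?num_real// -[leLHS]real_normK ?num_real//.
  rewrite lerXn2r ?nnegrE//; apply: le_trans (ltW zC).
  by case: (clamp_cases z C0) => -[h ->]; rewrite ?normrN ?(ger0_norm C0)// ler_norml; apply/andP.
have /andP[c20 c2z] := c2.
have e1 : 0 <= (z ^+ 2 - clamp C z ^+ 2) * (q0 + K) by rewrite mulr_ge0//; lra.
have e2 : 0 <= m * clamp C z ^+ 2 by exact: mulr_ge0.
have e3 : 0 <= K * clamp C z ^+ 2 by rewrite mulr_ge0//; lra.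
rewrite mul0r mul1r; lra.
Qed.

(** The curvature [q] of the quadratic term beats all the perturbations, so the
    minimizer is controlled by the score. *)
Lemma curvature_controls_minimizer (R : realType) (n g q K Z SD SL ST S ka C m S1 : R) :
  0 < n -> 0 <= g -> 0 <= Z ->
  - (n * (q / 16)) <= SD -> n * q <= m * SL -> K * ST <= n * (q / 32) ->
  ka * S <= n * (q / 16) -> 2 * K * (g * C * S) <= n * (q / 16) -> 0 < q ->
  S1 <= n * Z ->
  g ^+ 2 / 2 * (SD + m * SL - K * ST - ka * S) - 2 * K * g ^+ 2 * (g * C * S + ST) <=
    g * S1 ->
  g * q / 4 <= Z.
Proof.
move=> n0 g0 Z0 h1 h2 h3 h4 h5 q0 h6 h7.
move: g0; rewrite le_eqVlt => /orP[/eqP <-|gp]; first by rewrite !mul0r.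
pose X := 2^-1 * (SD + m * SL - K * ST - ka * S) - 2 * K * (g * C * S + ST).
have X0 : n * (q / 4) <= X.
  rewrite /X; have := mulr_gt0 n0 q0; lra.
have h8 : g * X <= n * Z.
  apply: le_trans h6; rewrite -(ler_pM2l gp); apply: le_trans h7.
  by rewrite /X; apply: eq_ler; field.
rewrite -(ler_pM2l n0); apply: le_trans h8.
apply: (@le_trans _ _ (g * (n * (q / 4)))); last by rewrite ler_pM2l.
by apply: eq_ler; ring.
Qed.

Lemma clamp_norm (R : realType) (C z : R) : 0 <= C -> `|clamp C z| <= C.
Proof.
move=> C0; case: (clamp_cases z C0) => -[h ->]; rewrite ?normrN ?(ger0_norm C0)//.
by rewrite ler_norml; apply/andP.
Qed.

Lemma clamp_sqr_lipschitz (R : realType) (C z z' : R) : 0 <= C ->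
  `|clamp C z ^+ 2 - clamp C z' ^+ 2| <= 2 * C * `|z - z'|.
Proof.
move=> C0; rewrite subr_sqr normrM mulrC ler_pM//; last exact: clamp_lipschitz.
by rewrite (le_trans (ler_normD _ _))// mulr_natl mulr2n lerD// clamp_norm.
Qed.

(** Variance at [s0] plus squared oscillation around [s0]. *)
Lemma scale_process_second_moment d (T : measurableType d) (R : realType)
    (P : probability T R) (n : nat) (X : 'I_n -> {RV P >-> R}) (h : R -> R -> R)
    (s0 delta L K : R) (C : finType) (v : C -> 'I_n -> R) :
  mutually_independent X -> 0 <= delta -> 0 <= L ->
  (forall s, measurable_fun setT (h ^~ s)) -> (forall y s, `|h y s| <= K) ->
  (forall i s, mean P (fun w => h (X i w) s) = 0) ->
  (forall y s s', `|s - s0| <= delta -> `|s' - s0| <= delta ->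
    `|h y s - h y s'| <= L * `|s - s'|) ->
  exists V : T -> R, [/\ bdmeas V, forall w, 0 <= V w,
    mean P V <= (2 * K ^+ 2 + 100 * (L ^+ 2 * delta ^+ 2)) * \sum_c \sum_i v c i ^+ 2 &
    forall w s, `|s - s0| <= delta -> \sum_c (\sum_i v c i * h (X i w) s) ^+ 2 <= V w].
Proof.
move=> indX delta0 L0 mh hK h0 hL.
have [W [bW W0 mW hW]] := scale_process_bound indX delta0 L0 mh hK h0 hL v.
have [D DE] : exists D : C -> T -> R -> R,
  D = fun c w s => \sum_i v c i * h (X i w) s by eexists.
pose V0 w := \sum_c D c w s0 ^+ 2.
have bD c s : bdmeas (fun w => D c w s).
  rewrite DE; apply: bdmeas_sum => i _; apply: bdmeasZ; split; last by exists K.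
  exact: (measurableT_comp (mh s)).
have bV0 : bdmeas V0 by apply: bdmeas_sum => c _; exact: bdmeasX.
exists (fun w => 2 * V0 w + 2 * W w); split.
- by apply: bdmeasD; exact: bdmeasZ.
- by move=> w; rewrite addr_ge0// mulr_ge0// sumr_ge0// => c _; exact: sqr_ge0.
- have mV0 : mean P V0 <= K ^+ 2 * \sum_c \sum_i v c i ^+ 2.
    rewrite /V0 mean_sum; last by move=> c _; exact: bdmeasX.
    rewrite mulr_sumr DE; apply: ler_sum => c _.
    exact: (mean_sqr_sum_indep indX _ (fun i => mh s0)).
  rewrite meanD ?meanZ//; do ?exact: bdmeasZ.
  by move: mW mV0; set N := \sum_c \sum_i _; lra.
- move=> w s hs; have := hW w s hs.
  have -> : \sum_c (\sum_i v c i * h (X i w) s) ^+ 2 = \sum_c D c w s ^+ 2 by rewrite DE.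
  have -> : \sum_c (\sum_i v c i * h (X i w) s - \sum_i v c i * h (X i w) s0) ^+ 2 =
    \sum_c (D c w s - D c w s0) ^+ 2 by rewrite DE.
  move=> hWw; apply: le_trans (lerD (lexx _) (ler_wpM2l _ hWw)) => //.
  rewrite /V0 !mulr_sumr -big_split/=; apply: ler_sum => c _.
  have := sqr_ge0 (D c w s - 2 * D c w s0); lra.
Qed.

Lemma sum_expansion (R : realType) n (r a A L T S : 'I_n -> R) (g c m K k e f : R) :
  \sum_i (r i - g * a i + c * (A i + m * L i - K * T i - k * S i) - e * (f * S i + T i)) =
  \sum_i r i - g * \sum_i a i +
    c * (\sum_i A i + m * \sum_i L i - K * \sum_i T i - k * \sum_i S i) -
    e * (f * \sum_i S i + \sum_i T i).
Proof.
elim: (index_enum _) => [|i l ih]; first by rewrite !big_nil; ring.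
by rewrite !big_cons ih; ring.
Qed.

Lemma perturbation_le (R : realType) (k q de c : R) : 0 <= k * c -> 0 <= de ->
  de <= q / (16 * (k * c + 1)) -> k * de * c <= q / 16.
Proof.
move=> kc de0; have kc1 : 0 < 16 * (k * c + 1) by rewrite mulr_gt0// ltr_wpDl.
rewrite ler_pdivlMr// => h; rewrite ler_pdivlMr//; apply: le_trans h.
lra.
Qed.

Lemma cancel_main (R : realType) (A B D E : R) : A - B + D - E <= A -> D - E <= B.
Proof. lra. Qed.

Section rate.
Context d (T : measurableType d) (R : realType) (P : probability T R).
Variables (p : nat -> nat) (x : forall n, 'I_n -> 'cV[R]_(p n)).
Arguments x : clear implicits.
Variables (u : forall n, 'I_n -> {RV P >-> R}) (u0 : {RV P >-> R}).
Arguments u : clear implicits.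
Hypothesis indu : forall n, mutually_independent (u n).
Hypothesis mean_u : forall n i (h : R -> R), measurable_fun setT h ->
  (exists K : R, forall y, `|h y| <= K) ->
  mean P (fun w => h (u n i w)) = mean P (fun w => h (u0 w)).
Variables (s : nat -> T -> R) (s0 : R) (b : forall n, T -> 'cV[R]_(p n)).
Hypothesis s00 : 0 < s0.
Hypothesis s_cvg : forall e : R, 0 < e -> whp P (fun n => [set w | `|s n w - s0| <= e]).
Variables (rho psi psi' : R -> R) (K : R).
Hypothesis K0 : 0 <= K.
Hypothesis rho_psi : forall c : R, is_derive c 1 rho (psi c).
Hypothesis psi_psi' : forall c : R, is_derive c 1 psi (psi' c).
Hypothesis mpsi' : measurable_fun setT psi'.
Hypothesis psiK : forall t, `|psi t| <= K.
Hypothesis psi'K : forall t, `|psi' t| <= K.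
Hypothesis psi'_lip : forall t v, `|psi' t - psi' v| <= K * `|t - v|.
Hypothesis psi_scale : forall y t t' : R, s0 / 2 <= t -> t <= 2 * s0 ->
  s0 / 2 <= t' -> t' <= 2 * s0 -> `|psi (y / t) - psi (y / t')| <= K * `|t - t'|.
Hypothesis psi'_scale : forall y t t' : R, s0 / 2 <= t -> t <= 2 * s0 ->
  s0 / 2 <= t' -> t' <= 2 * s0 -> `|psi' (y / t) - psi' (y / t')| <= K * `|t - t'|.
Hypothesis mean_psi : forall t : R, mean P (fun w => psi (u0 w / t)) = 0.

Let m := mean P (fun w => psi' (u0 w / s0)).
Hypothesis m0 : 0 < m.

Hypothesis p0 : forall n, (0 < n)%N -> (0 < p n)%N.
Hypothesis hp : (p n)%:R * ln n%:R / n%:R @[n --> \oo] --> (0 : R).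
Hypothesis hx : forall e : R, 0 < e -> \forall n \near \oo, forall i,
  (p n)%:R ^+ 2 * l2norm (x n i) ^+ 2 <= e * n%:R.

Hypothesis design_upper : exists2 tau : R, 0 < tau & forall n (z : 'cV[R]_(p n)),
  (0 < n)%N -> \sum_i dotv (x n i) z ^+ 2 <= tau * n%:R * l2norm z ^+ 2.
Hypothesis design_split : exists2 a : R, 0 < a & forall e, 0 < e ->
  exists2 C : R, 0 < C & forall n (z : 'cV[R]_(p n)), (0 < n)%N -> l2norm z = 1 ->
    a * n%:R <= \sum_i (`|dotv (x n i) z| <= C)%R%:R * dotv (x n i) z ^+ 2 /\
    \sum_i (C < `|dotv (x n i) z|)%R%:R * dotv (x n i) z ^+ 2 <= e * n%:R.
Hypothesis hX2 : exists2 M : R, 0 < M & forall n, (0 < n)%N ->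
  n%:R^-1 * \sum_(i < n) l2norm (x n i) ^+ 2 <= (p n)%:R * M.
Hypothesis consistency : forall e : R, 0 < e -> whp P (fun n => [set w | l2norm (b n w) <= e]).
Hypothesis b_min : forall n w,
  \sum_i rho ((u n i w - dotv (x n i) (b n w)) / s n w) <= \sum_i rho (u n i w / s n w).

Let mpsi : measurable_fun setT psi.
Proof.
apply: continuous_measurable_fun => t; apply: differentiable_continuous.
by apply/derivable1_diffP; have [] := psi_psi' t.
Qed.

Let mpsis t : measurable_fun setT (fun y : R => psi (y / t)).
Proof. by apply: (measurableT_comp mpsi); exact: measurable_funM. Qed.

Let mpsi's t : measurable_fun setT (fun y : R => psi' (y / t)).
Proof. by apply: (measurableT_comp mpsi'); exact: measurable_funM. Qed.

Let mK : `|m| <= K.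
Proof.
by apply: mean_norm_le => //; split; [exact: (measurableT_comp (mpsi's _))|exists K].
Qed.

(** Clamped squares are Lipschitz, so a grid of the unit ball whose mesh decreases
    polynomially in [n] is a sufficient net. *)
Let uniform_curvature (C th : R) : 0 < C -> 0 < th ->
  whp P (fun n => [set w | forall z, l2norm z = 1 ->
    - (n%:R * th) <= \sum_i clamp C (dotv (x n i) z) ^+ 2 * (psi' (u n i w / s0) - m)]).
Proof.
move=> C0 th0; have [K' K'E] : exists K', K' = 2 * K * C ^+ 2 + th by eexists.
have KC0 : 0 <= 2 * K * C ^+ 2 by rewrite mulr_ge0 ?sqr_ge0// mulr_ge0.
have K'0 : 0 < K' by lra.
have th2 : 0 < th / 2 by rewrite divr_gt0.
have thK : th / 2 <= 2 * K' by lra.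
pose code n := {ffun 'I_(p n) -> 'I_(2 * n ^ 2).+1} : finType.
pose h n (f : code n) i (y : R) :=
  - (clamp C (dotv (x n i) (grid_point R f)) ^+ 2 * (psi' (y / s0) - m)).
have ev : whp P (fun n => [set w | forall f : code n, \sum_i h n f i (u n i w) < n%:R * (th / 2)]).
  apply: (@whp_union_exponential _ _ _ P u code h K') => //.
  - move=> n f i; apply: measurableT_comp => //.
    by apply: measurable_funM => //; exact: measurable_funB.
  - move=> n f i y; rewrite normrN normrM K'E ler_wpDr ?(ltW th0)// mulrC.
    rewrite ler_pM//.
      by rewrite (le_trans (ler_normB _ _))// mulr_natl mulr2n lerD.
    by rewrite normrX; apply: lerXn2r; rewrite ?nnegrE ?(ltW C0)//; exact/clamp_norm/ltW.
  - move=> n f i.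
    have bi : bdmeas (fun w => psi' (u n i w / s0)).
      by split; [exact: (measurableT_comp (mpsi's _))|exists K].
    rewrite /h; under eq_fun do rewrite -mulNr.
    rewrite meanZ; last by apply: bdmeasB => //; exact: bdmeas_cst.
    rewrite meanB//; last exact: bdmeas_cst.
    rewrite mean_cst (mean_u i (mpsi's s0)) ?subrr ?mulr0//; by exists K.
  - have thh : 0 < (th / 2) ^+ 2 / (8 * K' ^+ 2) by rewrite divr_gt0 ?exprn_gt0// mulr_gt0// exprn_gt0.
    have An : \forall n \near \oo, ((2 * n ^ 2).+1 <= n ^ 3)%N.
      near=> n; have n3 : (3 <= n)%N by near: n; exact: nbhs_infty_ge.
      rewrite [(n ^ 3)%N]expnS; apply: (@leq_trans (3 * n ^ 2)); last by rewrite leq_mul2r n3 orbT.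
      by rewrite ltn_pmul2r// expn_gt0; case: (n) n3.
    have := net_size_cvg thh hp An.
    by under [X in _ -> X @ _ --> _]eq_fun do rewrite card_ffun !card_ord.
have big : \forall n \near \oo, 4 * C * K / (th / 2) + 1 <= n%:R :> R by exact: nbhs_infty_ger.
apply: (whp_near ev); have := hx ltr01; apply: filterS2 big => n nbig hxn w /= evw z z1.
have CK0 : 0 <= 4 * C * K / (th / 2).
  by apply: divr_ge0 (ltW th2); apply: mulr_ge0 => //; apply: mulr_ge0 => //; exact: ltW.
have n1 : 1 <= n%:R :> R by apply: le_trans nbig; rewrite lerDr.
have n0 : (0 < n)%N by rewrite -(ltr_nat R); lra.
have nR : 0 < n%:R :> R by rewrite ltr0n.
have n2 : (0 < n ^ 2)%N by rewrite expn_gt0 n0.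
have z1' : l2norm z <= 1 by rewrite z1.
have [f hf] := @grid_net R (p n) (n ^ 2) n2 z z1'.
have := evw f; rewrite /h sumrN => evf.
have pR : 1 <= (p n)%:R :> R by rewrite ler1n p0.
have xp i : l2norm (x n i) * Num.sqrt (p n)%:R <= n%:R.
  rewrite -(@ler_pXn2r _ 2 isT) ?nnegrE ?mulr_ge0 ?l2norm_ge0 ?sqrtr_ge0//.
  rewrite exprMn (@sqr_sqrtr _ (p n)%:R)// mulrC.
  apply: le_trans (le_trans (hxn i) _); last by rewrite mul1r expr2 ler_peMl.
  by rewrite ler_wpM2r ?sqr_ge0// expr2 ler_peMl.
have xn i : `|dotv (x n i) z - dotv (x n i) (grid_point R f)| <= n%:R^-1.
  apply: le_trans (hf _) _; rewrite mulrA natrX expr2 invfM mulrA ler_pdivrMr// mulVf ?gt_eqF//.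
  by rewrite ler_pdivrMr// mul1r.
have nth : 4 * C * K * n%:R^-1 <= th / 2.
  rewrite ler_pdivrMr// [th / 2 * _]mulrC -ler_pdivrMr//; apply: le_trans nbig.
  by rewrite lerDl.
have step i : - (clamp C (dotv (x n i) z) ^+ 2 * (psi' (u n i w / s0) - m)) <=
    - (clamp C (dotv (x n i) (grid_point R f)) ^+ 2 * (psi' (u n i w / s0) - m)) + th / 2.
  rewrite -lerBlDl opprK addrC -mulrBl; apply: le_trans (ler_norm _) (le_trans _ nth).
  have -> : 4 * C * K * n%:R^-1 = (2 * C * n%:R^-1) * (2 * K) by ring.
  rewrite normrM; apply: ler_pM => //.
    apply: le_trans (clamp_sqr_lipschitz _ _ (ltW C0)) _.
    by rewrite ler_pM2l ?mulr_gt0// distrC.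
  by rewrite (le_trans (ler_normB _ _))// mulr_natl mulr2n lerD.
have := ler_sum (index_enum 'I_n) (fun i (_ : true) => step i).
rewrite big_split/= sumr_const card_ord !sumrN -[_ *+ n]mulr_natl => total.
by move: evf; rewrite lerNl -/(dotv _ _) => /ltW evf; apply: le_trans total _; lra.
Unshelve. all: by end_near. Qed.

Let score n w (t : R) (j : 'I_(p n)) :=
  \sum_i (x n i j 0 / n%:R) * psi (u n i w / t).

Let sum_weights n :
  \sum_(j < p n) \sum_i (x n i j 0 / n%:R) ^+ 2 = n%:R ^- 2 * \sum_i l2norm (x n i) ^+ 2.
Proof.
rewrite exchange_big mulr_sumr/=; apply: eq_bigr => i _.
by rewrite sqr_l2norm mulr_sumr; apply: eq_bigr => j _; rewrite exprMn exprVn mulrC.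
Qed.

(** The squared norm of the score is of order [p / n], uniformly over scales. *)
Let score_bound : exists2 Cs : R, 0 < Cs & forall n, exists V : T -> R,
  [/\ bdmeas V, forall w, 0 <= V w,
      mean P V <= Cs * (n%:R ^- 2 * \sum_i l2norm (x n i) ^+ 2) &
      forall w t, `|t - s0| <= s0 / 2 -> \sum_j @score n w t j ^+ 2 <= V w].
Proof.
have K21 : 0 <= K ^+ 2 by exact: sqr_ge0.
have KS : 0 <= K ^+ 2 * (s0 / 2) ^+ 2 by rewrite mulr_ge0// sqr_ge0.
exists (2 * K ^+ 2 + 100 * (K ^+ 2 * (s0 / 2) ^+ 2) + 1) => [|n]; first lra.
have s02 : 0 <= s0 / 2 by rewrite divr_ge0// ltW.
have psi0 (i : 'I_n) t : mean P (fun w => psi (u n i w / t)) = 0.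
  by rewrite (mean_u i (mpsis t))//; exists K.
have range (t : R) : `|t - s0| <= s0 / 2 -> s0 / 2 <= t /\ t <= 2 * s0.
  by rewrite ler_norml => /andP[? ?]; split; lra.
have [V [bV V0 mV hV]] := @scale_process_second_moment _ _ _ P n (u n)
  (fun y t => psi (y / t)) s0 (s0 / 2) K K 'I_(p n) (fun j i => x n i j 0 / n%:R)
  (@indu n) s02 K0 mpsis (fun y t => psiK _) psi0
  (fun y t t' ht ht' => psi_scale y (range t ht).1 (range t ht).2 (range t' ht').1 (range t' ht').2).
exists V; split => //; apply: le_trans mV _; rewrite sum_weights ler_wpM2r ?lerDl//.
by rewrite mulr_ge0 ?invr_ge0 ?exprn_ge0// sumr_ge0// => i _; exact: sqr_ge0.
Qed.

Let sum_score n w t (z : 'cV[R]_(p n)) : (0 < n)%N -> l2norm z = 1 ->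
  \sum_i dotv (x n i) z * psi (u n i w / t) <=
  n%:R * Num.sqrt (\sum_j @score n w t j ^+ 2).
Proof.
move=> n0 z1; have nR : 0 < n%:R :> R by rewrite ltr0n.
have -> : \sum_i dotv (x n i) z * psi (u n i w / t) = n%:R * \sum_j z j 0 * @score n w t j.
  under eq_bigr do rewrite dotvE mulr_suml.
  rewrite exchange_big mulr_sumr/=; apply: eq_bigr => j _.
  rewrite /score !mulr_sumr; apply: eq_bigr => i _.
  by field; rewrite gt_eqF.
rewrite ler_pM2l//; apply: le_trans (ler_norm _) (le_trans (norm_sum_mul_le _ _) _).
by rewrite -l2normE z1 mul1r.
Qed.

(** Near the true parameter the loss is at least a linear term, given by the score,
    plus a quadratic term whose curvature is bounded below along every direction. *)
Let deviation_le_score : exists2 C1 : R, 0 < C1 & whp P (fun n => [set w |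
  `|s n w - s0| <= s0 / 2 /\
  l2norm (b n w) ^+ 2 <= C1 * \sum_j @score n w (s n w) j ^+ 2]).
Proof.
have [tau tau0 upper] := design_upper; have [a a0 split] := design_split.
have [q qE] : exists q, q = m * a by eexists.
have q0 : 0 < q by rewrite qE mulr_gt0.
have K1 : 0 < K + 1 by rewrite ltr_wpDl.
have eps0 : 0 < q / (32 * (K + 1)) by rewrite divr_gt0// mulr_gt0.
have [C C0 hC] := split _ eps0.
have KCt : 0 <= K * C * tau by rewrite mulr_ge0 ?(ltW tau0)// mulr_ge0// ltW.
(* [e1] and [de] keep each perturbation of the curvature [q] within [q / 16] *)
have [e1 e1E] : exists e1, e1 = q * s0 / (64 * (K * C * tau + 1)) by eexists.
have e10 : 0 < e1 by rewrite e1E divr_gt0 ?mulr_gt0// ltr_wpDl.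
have Kt : 0 <= K * tau by rewrite mulr_ge0// ltW.
pose de := Num.min (s0 / 2) (q / (16 * (K * tau + 1))).
have de0 : 0 < de by rewrite lt_min !divr_gt0// mulr_gt0// ltr_wpDl.
have de1 : de <= s0 / 2 by rewrite ge_min lexx.
have de2 : de <= q / (16 * (K * tau + 1)) by rewrite ge_min lexx orbT.
have th0 : 0 < q / 16 by rewrite divr_gt0.
exists ((8 * s0 / q) ^+ 2); first by rewrite exprn_gt0// divr_gt0// mulr_gt0.
have ev := whpI (whpI (s_cvg de0) (consistency e10)) (uniform_curvature C0 th0).
apply: (whp_near ev); near=> n => w [[/= F1 F2] F3].
have n0 : (0 < n)%N by near: n; exact: nbhs_infty_gt.
have nR : 0 < n%:R :> R by rewrite ltr0n.
have F1' : `|s n w - s0| <= s0 / 2 by exact: le_trans de1.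
have [s1 s2] : s0 / 2 <= s n w /\ s n w <= 2 * s0.
  by move: F1'; rewrite ler_norml => /andP[? ?]; split; lra.
have sp : 0 < s n w by lra.
split => //; set V := \sum_j _ ^+ 2.
have V0 : 0 <= V by apply: sumr_ge0 => j _; exact: sqr_ge0.
have [->|bnz] := eqVneq (b n w) 0.
  by rewrite l2norm0 expr0n/= mulr_ge0// sqr_ge0.
have [z z1 bE] := unit_scale bnz.
have [g gE] : exists g, g = l2norm (b n w) / s n w by eexists.
have g0 : 0 <= g by rewrite gE divr_ge0 ?l2norm_ge0// ltW.
have [C1 C2] := hC n z n0 z1; have S1 := upper n z n0; rewrite z1 expr1n mulr1 in S1.
have curv := F3 z z1.
have low i : rho (u n i w / s n w) - g * (dotv (x n i) z * psi (u n i w / s n w)) +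
    g ^+ 2 / 2 * (clamp C (dotv (x n i) z) ^+ 2 * (psi' (u n i w / s0) - m) +
      m * ((`|dotv (x n i) z| <= C)%R%:R * dotv (x n i) z ^+ 2) -
      K * ((C < `|dotv (x n i) z|)%R%:R * dotv (x n i) z ^+ 2) -
      K * de * dotv (x n i) z ^+ 2) -
    2 * K * g ^+ 2 * (g * C * dotv (x n i) z ^+ 2 +
      (C < `|dotv (x n i) z|)%R%:R * dotv (x n i) z ^+ 2) <=
    rho ((u n i w - dotv (x n i) (b n w)) / s n w).
  have -> : (u n i w - dotv (x n i) (b n w)) / s n w = u n i w / s n w - g * dotv (x n i) z.
    by rewrite bE dotvZr gE mulrBl; congr (_ - _); rewrite mulrAC.
  apply: le_trans (quadratic_expansion K0 rho_psi psi_psi' psi'K psi'_lip _ _ g0 (ltW C0)).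
  rewrite lerD2r lerD2l ler_wpM2l ?divr_ge0 ?sqr_ge0//.
  apply: clamped_curvature => //; [exact: ltW|exact: ltW|].
  apply: le_trans (psi'_scale _ s1 s2 _ _) _; [lra|lra|].
  by rewrite ler_wpM2l.
have := le_trans (ler_sum (index_enum 'I_n) (fun i (_ : true) => low i)) (b_min n w).
rewrite sum_expansion => /cancel_main total.
have main : g * q / 4 <= Num.sqrt V.
  apply: (curvature_controls_minimizer nR g0 (sqrtr_ge0 V) curv _ _ _ _ q0
    (sum_score w (s n w) n0 z1) total).
  - by rewrite qE mulrCA ler_pM2l// mulrC.
  - apply: le_trans (ler_wpM2l K0 C2) _.
    have Ke : K * (q / (32 * (K + 1))) <= q / 32.
      have -> : K * (q / (32 * (K + 1))) = K / (K + 1) * (q / 32) by field; rewrite gt_eqF.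
      by rewrite ler_piMl ?divr_ge0 ?(ltW q0)// ler_pdivrMr// mul1r lerDl.
    by have := ler_wpM2r (ltW nR) Ke; lra.
  - apply: (@le_trans _ _ (K * de * (tau * n%:R))); first by rewrite ler_wpM2l ?mulr_ge0 ?(ltW de0).
    rewrite [leRHS]mulrC mulrA ler_pM2r//.
    exact: perturbation_le Kt (ltW de0) de2.
  - apply: (@le_trans _ _ (2 * K * (g * C * (tau * n%:R)))).
      by rewrite ler_wpM2l ?mulr_ge0// ler_wpM2l// mulr_ge0// ltW.
    rewrite [leRHS]mulrC !mulrA ler_pM2r//.
    have g2 : g <= e1 / (s0 / 2).
      by rewrite gE ler_pM ?l2norm_ge0 ?invr_ge0 ?(ltW sp)// lef_pV2 ?posrE// divr_gt0.
    have g2E : e1 / (s0 / 2) = q / (16 * (K * C * tau + 1)) / 2.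
      by rewrite e1E; field; rewrite !gt_eqF ?ltr_wpDl.
    have := @perturbation_le _ K q (2 * g) (C * tau); rewrite mulrA.
    rewrite (_ : K * (2 * g) * (C * tau) = 2 * K * g * C * tau); last by ring.
    by apply => //; [rewrite mulr_ge0|lra].
have c0 : 0 <= 8 * s0 / q by rewrite divr_ge0 ?(ltW q0)// mulr_ge0// ltW.
rewrite -(sqr_sqrtr V0) -exprMn; apply: lerXn2r; rewrite ?nnegrE ?l2norm_ge0//.
  by rewrite mulr_ge0// sqrtr_ge0.
have bg : l2norm (b n w) <= g * (2 * s0).
  by rewrite gE mulrAC ler_pdivlMr// ler_wpM2l// l2norm_ge0.
apply: le_trans bg _; rewrite -(ler_pM2r q0).
have -> : 8 * s0 / q * Num.sqrt V * q = 8 * s0 * Num.sqrt V by field; rewrite gt_eqF.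
have := ler_wpM2l (ltW s00) main; lra.
Unshelve. all: by end_near. Qed.

(** Markov's inequality for the squared norm of the score. *)
Theorem rate (k : nat -> R) : (forall n, 0 < k n) -> (k n)^-1 @[n --> \oo] --> (0 : R) ->
  whp P (fun n => [set w | l2norm (b n w) ^+ 2 <= k n * ((p n)%:R / n%:R)]).
Proof.
move=> k0 klim; have [C1 C10 dev] := deviation_le_score.
have [Cs Cs0 /choice[V hV]] := score_bound; have [M M0 hM] := hX2.
have bV n : bdmeas (V n) by have [] := hV n.
pose B n := [set w | k n * ((p n)%:R / n%:R) <= C1 * V n w].
have lim : C1 * (Cs * M) * (k n)^-1 @[n --> \oo] --> (0 : R).
  by rewrite -[X in _ --> X](mulr0 (C1 * (Cs * M))); apply: cvgM => //; exact: cvg_cst.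
have PB : \forall n \near \oo, (P (B n) <= (C1 * (Cs * M) * (k n)^-1)%:E)%E.
  near=> n; have n0 : (0 < n)%N by near: n; exact: nbhs_infty_gt.
  have nR : 0 < n%:R :> R by rewrite ltr0n.
  have pn : 0 < (p n)%:R / n%:R :> R by rewrite divr_gt0// ltr0n p0.
  apply: le_trans (markov_mean P (bdmeasZ C1 (bV n)) _ _) _.
  - by move=> w; rewrite mulr_ge0 ?(ltW C10)//; have [_ ->] := hV n.
  - exact: mulr_gt0.
  - rewrite lee_fin meanZ// ler_pdivrMr; last exact: mulr_gt0.
    have -> : C1 * (Cs * M) * (k n)^-1 * (k n * ((p n)%:R / n%:R)) =
        C1 * (Cs * (n%:R^-1 * ((p n)%:R * M))) by field; rewrite !gt_eqF.
    rewrite ler_pM2l//; have [_ _ mV _] := hV n; apply: le_trans mV _.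
    rewrite ler_pM2l// (_ : n%:R ^- 2 = n%:R^-1 * n%:R^-1 :> R); last by rewrite expr2 invfM.
    by rewrite -mulrA ler_wpM2l ?invr_ge0 ?(ltW nR)// hM.
have := whpI dev (whp_cvg0 (fun n => measurable_superlevel _ (bdmeasZ C1 (bV n)).1) PB lim).
move=> /whpS; apply => n w [[F1 F2] /= nB].
have [_ _ _ hs] := hV n; apply: le_trans F2 _.
apply: (@le_trans _ _ (C1 * V n w)); first by rewrite ler_pM2l// hs.
by rewrite leNgt; apply/negP => /ltW.
Unshelve. all: by end_near. Qed.

End rate.

(** A common threshold for the lower and the upper bound. *)
Lemma design_splitting (R : realType) (p : nat -> nat) (x : forall n, 'I_n -> 'cV[R]_(p n)) :
  (exists2 a : R, 0 < a & exists2 C : R, 0 < C &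
    forall n (z : 'cV[R]_(p n)), (0 < n)%N -> l2norm z = 1 ->
    a * n%:R <= \sum_(i | `|dotv (x n i) z| <= C) dotv (x n i) z ^+ 2) ->
  (forall e : R, 0 < e -> exists2 C : R, 0 < C &
    forall n (z : 'cV[R]_(p n)), (0 < n)%N -> l2norm z = 1 ->
    \sum_(i | C < `|dotv (x n i) z|) dotv (x n i) z ^+ 2 <= e * n%:R) ->
  exists2 a : R, 0 < a & forall e : R, 0 < e ->
  exists2 C : R, 0 < C & forall n (z : 'cV[R]_(p n)), (0 < n)%N -> l2norm z = 1 ->
    a * n%:R <= \sum_i (`|dotv (x n i) z| <= C)%R%:R * dotv (x n i) z ^+ 2 /\
    \sum_i (C < `|dotv (x n i) z|)%R%:R * dotv (x n i) z ^+ 2 <= e * n%:R.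
Proof.
move=> [a a0 [C C0 lo]] tl; exists a => // e e0; have [C' C'0 hi] := tl e e0.
exists (Num.max C C') => [|n z n0 z1]; first by rewrite lt_max C0.
split.
  apply: le_trans (lo n z n0 z1) _; rewrite big_mkcond; apply: ler_sum => i _.
  rewrite le_max; case: ifP => _ /=; first by rewrite mul1r.
  by rewrite mulr_ge0 ?sqr_ge0.
apply: le_trans (hi n z n0 z1); rewrite [leRHS]big_mkcond; apply: ler_sum => i _.
rewrite gt_max; case: ifP => _; last by rewrite andbF mul0r.
by rewrite andbT ler_piMl ?sqr_ge0// lern1 leq_b1.
Qed.

(** * Linearization of the estimator *)

(** A sequence tending to infinity slowly enough not to spoil a given negligible one. *)
Lemma slow_growth (R : realType) (mu : nat -> R) : (forall n, 0 <= mu n) ->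
  mu n @[n --> \oo] --> (0 : R) ->
  exists k : nat -> R, [/\ forall n, 0 < k n, (k n)^-1 @[n --> \oo] --> (0 : R) &
    forall e : R, 0 < e -> \forall n \near \oo, k n ^+ 2 * mu n <= e].
Proof.
move=> mu0 mulim; pose t n := Num.sqrt (Num.sqrt (mu n)).
have t0 n : 0 <= t n by exact: sqrtr_ge0.
have t2 n : t n ^+ 2 = Num.sqrt (mu n) by rewrite sqr_sqrtr// sqrtr_ge0.
have sqrt0 (f : nat -> R) : f n @[n --> \oo] --> (0 : R) ->
    Num.sqrt (f n) @[n --> \oo] --> (0 : R).
  move=> f0; have : Num.sqrt (f n) @[n --> \oo] --> Num.sqrt (0 : R).
    exact: (cvg_comp _ _ f0 (@sqrt_continuous R 0)).
  by rewrite sqrtr0.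
have d0 n : 0 < t n + n.+1%:R^-1 by rewrite ltr_wpDl// invr_gt0.
(* [k ^+ 2 * t ^+ 4 <= t ^+ 2] where [t ^+ 4 = mu] *)
exists (fun n => (t n + n.+1%:R^-1)^-1); split.
- by move=> n; rewrite invr_gt0.
- under eq_fun do rewrite invrK.
  have : t n + harmonic n @[n --> \oo] --> (0 + 0 : R).
    by apply: cvgD; [exact: sqrt0 (sqrt0 _ mulim)|exact: cvg_harmonic].
  by rewrite addr0.
- move=> e e0; have /cvgr0_norm_le/(_ e e0) := sqrt0 _ mulim; apply: filterS => n.
  apply: le_trans; apply: le_trans (ler_norm _).
  rewrite -[X in _ * X]sqr_sqrtr// -t2 exprVn mulrC ler_pdivrMr ?exprn_gt0//.
  rewrite expr2 ler_wpM2l ?sqr_ge0// lerXn2r ?nnegrE ?(ltW (d0 n))// lerDl.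
  by rewrite invr_ge0.
Qed.

(** The maximum over the row. *)
Lemma uniform_bound_cvg0 (R : realType) (f : forall n, 'I_n -> R) :
  (forall e : R, 0 < e -> \forall n \near \oo, forall i, @f n i <= e) ->
  exists mu : nat -> R, [/\ forall n, 0 <= mu n, mu n @[n --> \oo] --> (0 : R) &
    forall n i, @f n i <= mu n].
Proof.
move=> hf; exists (fun n => \big[Num.max/0]_i @f n i); split.
- by move=> n; exact: bigmax_ge_id.
- apply/cvgrPdist_le => e e0; apply: filterS (hf e e0) => n fe.
  rewrite sub0r normrN ger0_norm ?bigmax_ge_id//.
  by apply: bigmax_le => //; exact: ltW.
- by move=> n i; exact: le_bigmax.
Qed.

Lemma mean_small d (T : measurableType d) (R : realType) (P : probability T R)
    (V : nat -> T -> R) :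
  (forall n, bdmeas (V n)) -> (forall n w, 0 <= V n w) ->
  (forall e : R, 0 < e -> \forall n \near \oo, mean P (V n) <= e) ->
  forall e : R, 0 < e -> whp P (fun n => [set w | V n w <= e]).
Proof.
move=> bV V0 mV e e0.
have lim : mean P (V n) / e @[n --> \oo] --> (0 : R).
  apply/cvgrPdist_le => h h0; apply: filterS (mV _ (mulr_gt0 h0 e0)) => n.
  rewrite sub0r normrN ger0_norm ?ler_pdivrMr// divr_ge0 ?(ltW e0)//.
  exact: mean_ge0.
have := whp_cvg0 (P := P) (fun n => measurable_superlevel e (bV n).1) _ lim.
move=> /(_ _)/whpS; apply; last by move=> n w /= /negP; rewrite -ltNge => /ltW.
by apply: nearW => n; exact: markov_mean.
Qed.

(** Moving the minimizer along [c] cannot decrease the loss, so the quadratic upper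
    bound of its increment has no linear term. *)
Lemma minimizer_critical (R : realType) (rho psi : R -> R) (K : R) n p
    (x : 'I_n -> 'cV[R]_p) (y : 'I_n -> R) (s : R) (b c : 'cV[R]_p) :
  0 <= K -> 0 < s -> (forall t : R, is_derive t 1 rho (psi t)) ->
  (forall t v, `|psi t - psi v| <= K * `|t - v|) ->
  (forall b', \sum_i rho ((y i - dotv (x i) b) / s) <= \sum_i rho ((y i - dotv (x i) b') / s)) ->
  \sum_i dotv (x i) c * psi ((y i - dotv (x i) b) / s) = 0.
Proof.
move=> K0 s0 rho_psi psi_lip b_min.
apply: (@critical_of_quadratic_bound _ _ (K * \sum_i dotv (x i) c ^+ 2)) => t.
have := b_min (b - (s * t) *: c); rewrite -subr_ge0 => /le_trans; apply.
rewrite -sumrB mulr_sumr [K * _]mulr_sumr mulr_suml -big_split/=; apply: ler_sum => i _.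
have -> : (y i - dotv (x i) (b - (s * t) *: c)) / s =
    (y i - dotv (x i) b) / s + t * dotv (x i) c.
  by rewrite dotvBr dotvZr; field; rewrite gt_eqF.
have := taylor1 K0 rho_psi psi_lip ((y i - dotv (x i) b) / s) (t * dotv (x i) c).
rewrite ler_norml => /andP[_]; rewrite exprMn.
move: (rho _) (rho _) (psi _) => r1 r2 q; lra.
Qed.

(** The linear term has the mean curvature [m]; the fluctuations of the curvature
    around [m] and the quadratic remainder are errors. *)
Lemma linearized_score (R : realType) (psi psi' : R -> R) (K s m w : R) n
    (v y t : 'I_n -> R) :
  0 <= K -> 0 < s -> (forall c : R, is_derive c 1 psi (psi' c)) ->
  (forall c c', `|psi' c - psi' c'| <= K * `|c - c'|) ->
  (forall i, `|v i| <= w) ->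
  \sum_i v i * psi ((y i - t i) / s) = 0 ->
  `|\sum_i v i * psi (y i / s) - m * (\sum_i v i * t i) / s| <=
    s^-1 * `|\sum_i v i * t i * (psi' (y i / s) - m)| + K * s^-1 ^+ 2 * w * \sum_i t i ^+ 2.
Proof.
move=> K0 s0 psi_psi' psi'_lip vw zero.
have si0 : 0 <= s^-1 by rewrite invr_ge0 ltW.
have -> : \sum_i v i * psi (y i / s) - m * (\sum_i v i * t i) / s =
  s^-1 * (\sum_i v i * t i * (psi' (y i / s) - m)) +
  \sum_i v i * (psi (y i / s) - psi ((y i - t i) / s) - t i / s * psi' (y i / s)).
  rewrite -[LHS]subr0 -[X in _ - X = _]zero [m * _]mulr_sumr mulr_suml mulr_sumr -!sumrB -big_split/=.
  by apply: eq_bigr => i _; ring.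
apply: le_trans (ler_normD _ _) _; rewrite normrM (ger0_norm si0) lerD2l mulr_sumr.
apply: le_trans (ler_norm_sum _ _ _) _; apply: ler_sum => i _.
have := taylor1 K0 psi_psi' psi'_lip (y i / s) (- (t i / s)).
rewrite -mulrBl sqrrN => tay.
have -> : K * s^-1 ^+ 2 * w * t i ^+ 2 = w * (K * (t i / s) ^+ 2) by rewrite exprMn; ring.
rewrite normrM ler_pM//; apply: le_trans tay.
rewrite -normrN; apply: eq_ler; congr `|_|; ring.
Qed.

Section linearization.
Context d (T : measurableType d) (R : realType) (P : probability T R).
Variables (p : nat -> nat) (x : forall n, 'I_n -> 'cV[R]_(p n)).
Arguments x : clear implicits.
Variables (u : forall n, 'I_n -> {RV P >-> R}) (u0 : {RV P >-> R}).
Arguments u : clear implicits.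
Hypothesis indu : forall n, mutually_independent (u n).
Hypothesis mean_u : forall n i (h : R -> R), measurable_fun setT h ->
  (exists K : R, forall y, `|h y| <= K) ->
  mean P (fun w => h (u n i w)) = mean P (fun w => h (u0 w)).
Variables (s : nat -> T -> R) (s0 : R) (b : forall n, T -> 'cV[R]_(p n)).
Hypothesis s00 : 0 < s0.
Hypothesis s_cvg : forall e : R, 0 < e -> whp P (fun n => [set w | `|s n w - s0| <= e]).
Variables (psi psi' : R -> R) (K : R).
Hypothesis K0 : 0 <= K.
Hypothesis psi_psi' : forall c : R, is_derive c 1 psi (psi' c).
Hypothesis mpsi' : measurable_fun setT psi'.
Hypothesis psiK : forall t, `|psi t| <= K.
Hypothesis psi'K : forall t, `|psi' t| <= K.
Hypothesis psi'_lip : forall t v, `|psi' t - psi' v| <= K * `|t - v|.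
Hypothesis psi_scale : forall y t t' : R, s0 / 2 <= t -> t <= 2 * s0 ->
  s0 / 2 <= t' -> t' <= 2 * s0 -> `|psi (y / t) - psi (y / t')| <= K * `|t - t'|.
Hypothesis psi'_scale : forall y t t' : R, s0 / 2 <= t -> t <= 2 * s0 ->
  s0 / 2 <= t' -> t' <= 2 * s0 -> `|psi' (y / t) - psi' (y / t')| <= K * `|t - t'|.
Hypothesis mean_psi : forall t : R, mean P (fun w => psi (u0 w / t)) = 0.

Let m t := mean P (fun w => psi' (u0 w / t)).
Hypothesis m0 : 0 < m s0.

Hypothesis p0 : forall n, (0 < n)%N -> (0 < p n)%N.
Hypothesis design_upper : exists2 tau : R, 0 < tau & forall n (z : 'cV[R]_(p n)),
  (0 < n)%N -> \sum_i dotv (x n i) z ^+ 2 <= tau * n%:R * l2norm z ^+ 2.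
Variable k : nat -> R.
Hypothesis k0 : forall n, 0 < k n.
Hypothesis klim : (k n)^-1 @[n --> \oo] --> (0 : R).
Hypothesis rate : whp P (fun n => [set w | l2norm (b n w) ^+ 2 <= k n * ((p n)%:R / n%:R)]).
Hypothesis kx : forall e : R, 0 < e -> \forall n \near \oo, forall i,
  (k n * (p n)%:R) ^+ 2 * l2norm (x n i) ^+ 2 <= e * n%:R.

Variable v : forall n, 'I_n -> R.
Arguments v : clear implicits.
Hypothesis v2 : forall n, (0 < n)%N -> \sum_i v n i ^+ 2 = 1.
Hypothesis vx : exists2 Lc : R, 0 < Lc & forall n i, (0 < n)%N ->
  n%:R * v n i ^+ 2 <= Lc * l2norm (x n i) ^+ 2.
Hypothesis critical : forall n w,
  \sum_i v n i * psi ((u n i w - dotv (x n i) (b n w)) / s n w) = 0.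

Let mpsi : measurable_fun setT psi.
Proof.
apply: continuous_measurable_fun => t; apply: differentiable_continuous.
by apply/derivable1_diffP; have [] := psi_psi' t.
Qed.

Let mpsis t : measurable_fun setT (fun y : R => psi (y / t)).
Proof. by apply: (measurableT_comp mpsi); exact: measurable_funM. Qed.

Let mpsi's t : measurable_fun setT (fun y : R => psi' (y / t)).
Proof. by apply: (measurableT_comp mpsi'); exact: measurable_funM. Qed.

Let bpsi' t : bdmeas (fun w => psi' (u0 w / t)).
Proof. by split; [exact: (measurableT_comp (mpsi's _))|exists K]. Qed.

Let mK t : `|m t| <= K.
Proof. exact: mean_norm_le. Qed.

Let range (t : R) : `|t - s0| <= s0 / 2 -> s0 / 2 <= t /\ t <= 2 * s0.
Proof. by rewrite ler_norml => /andP[? ?]; split; lra. Qed.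

Let m_lip t t' : `|t - s0| <= s0 / 2 -> `|t' - s0| <= s0 / 2 -> `|m t - m t'| <= K * `|t - t'|.
Proof.
move=> /range[a1 a2] /range[b1 b2]; rewrite /m -meanB//; apply: mean_norm_le; first exact: bdmeasB.
by move=> w; exact: psi'_scale.
Qed.

Let kp_ge1 : \forall n \near \oo, 1 <= k n * (p n)%:R.
Proof.
have /cvgr0_norm_le/(_ 1 ltr01) := klim; apply: filterS2 (nbhs_infty_gt 0) => n n0 kn.
have p1 : 1 <= (p n)%:R :> R by rewrite ler1n p0.
have k1 : 1 <= k n.
  by move: kn; rewrite ger0_norm ?invr_ge0 ?(ltW (k0 n))// invf_le1.
by apply: (@le_trans _ _ (1 * 1)); [rewrite mulr1|rewrite ler_pM].
Qed.

(** The size of a weight is that of a covariate over [sqrt n]. *)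
Let weight_small (e : R) : 0 < e -> \forall n \near \oo, forall i, k n * (p n)%:R * `|v n i| <= e.
Proof.
move=> e0; have [Lc Lc0 hv] := vx.
have e'0 : 0 < e ^+ 2 / Lc by rewrite divr_gt0// exprn_gt0.
apply: filterS2 (nbhs_infty_gt 0) (kx e'0) => n n0 hx i.
have nR : 0 < n%:R :> R by rewrite ltr0n.
rewrite -(@ler_pXn2r _ 2 isT) ?nnegrE ?(ltW e0)//; last by rewrite !mulr_ge0// ltW.
rewrite exprMn real_normK ?num_real// -(ler_pM2l nR) mulrCA.
apply: le_trans (ler_wpM2l _ (hv n i n0)) _; first exact: sqr_ge0.
rewrite mulrCA -ler_pdivlMl//; apply: le_trans (hx i) _.
by apply: eq_ler; field; rewrite gt_eqF.
Qed.

Let centered_curvature n : exists V : T -> R, [/\ bdmeas V, forall w, 0 <= V w,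
  mean P V <= (2 * (2 * K) ^+ 2 + 100 * ((2 * K) ^+ 2 * (s0 / 2) ^+ 2)) *
    \sum_i v n i ^+ 2 * l2norm (x n i) ^+ 2 &
  forall w t, `|t - s0| <= s0 / 2 ->
    \sum_j (\sum_i v n i * x n i j 0 * (psi' (u n i w / t) - m t)) ^+ 2 <= V w].
Proof.
have s02 : 0 <= s0 / 2 by rewrite divr_ge0// ltW.
have K20 : 0 <= 2 * K by rewrite mulr_ge0.
have weights : \sum_(j < p n) \sum_i (v n i * x n i j 0) ^+ 2 =
    \sum_i v n i ^+ 2 * l2norm (x n i) ^+ 2.
  rewrite exchange_big/=; apply: eq_bigr => i _.
  by rewrite sqr_l2norm mulr_sumr; apply: eq_bigr => j _; rewrite exprMn.
rewrite -weights; apply: (@scale_process_second_moment _ _ _ P n (u n)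
  (fun y t => psi' (y / t) - m t)) => //.
- by move=> t; exact: measurable_funB.
- move=> y t; rewrite (le_trans (ler_normB _ _))// mulr_natl mulr2n lerD//.
- move=> i t; rewrite meanB ?mean_cst; last exact: bdmeas_cst.
    by rewrite (mean_u i (mpsi's t)) ?subrr//; exists K.
  by split; [exact: (measurableT_comp (mpsi's _))|exists K].
- move=> y t t' /[dup] /range[a1 a2] ht /[dup] /range[b1 b2] ht'.
  rewrite (_ : _ - _ - _ = (psi' (y / t) - psi' (y / t')) - (m t - m t')); last by ring.
  rewrite (le_trans (ler_normB _ _))// -mulrA mulr_natl mulr2n lerD//; first exact: psi'_scale.
  exact: m_lip.
Qed.

Let Y n w := \sum_i v n i * dotv (x n i) (b n w).
Let H n w t := \sum_i v n i * psi (u n i w / t).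

(** The factor [k * p / n] is the bound on the squared deviation of the estimator;
    it is compensated by the negligible size of the covariates. *)
Let curvature_small (e : R) : 0 < e -> whp P (fun n => [set w |
  forall t, `|t - s0| <= s0 / 2 -> k n * ((p n)%:R / n%:R) *
    \sum_j (\sum_i v n i * x n i j 0 * (psi' (u n i w / t) - m t)) ^+ 2 <= e]).
Proof.
have [V hV] := choice centered_curvature.
have kp0 n : 0 <= k n * ((p n)%:R / n%:R) by rewrite mulr_ge0 ?divr_ge0// ltW.
have [Cg CgE] : exists Cg, Cg = 2 * (2 * K) ^+ 2 + 100 * ((2 * K) ^+ 2 * (s0 / 2) ^+ 2) by eexists.
have Cg0 : 0 <= Cg.
  have := sqr_ge0 (2 * K); have : 0 <= (2 * K) ^+ 2 * (s0 / 2) ^+ 2 by rewrite mulr_ge0// sqr_ge0.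
  by rewrite CgE; lra.
have Cg1 : 0 < Cg + 1 by rewrite ltr_wpDl.
move=> e0; have := @mean_small _ T R P (fun n w => k n * ((p n)%:R / n%:R) * V n w) _ _ _ e e0.
move=> /(_ _ _ _)/whpS; apply.
- by move=> n; apply: bdmeasZ; have [] := hV n.
- by move=> n w; apply: mulr_ge0 => //; have [_ ->] := hV n.
- move=> e' e'0; have e'' : 0 < e' / (Cg + 1) by rewrite divr_gt0.
  apply: filterS (filterI (filterI (nbhs_infty_gt 0) kp_ge1) (kx e'')) => n [[n0 kp1] hx].
  have nR : 0 < n%:R :> R by rewrite ltr0n.
  have [bV _ mV _] := hV n; rewrite meanZ//.
  apply: le_trans (ler_wpM2l (kp0 n) mV) _; rewrite -CgE mulrCA.
  apply: (@le_trans _ _ (Cg * (e' / (Cg + 1)))); last first.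
    by rewrite mulrCA ler_piMr ?(ltW e'0)// ler_pdivrMr// mul1r lerDl.
  rewrite ler_wpM2l// mulr_sumr.
  apply: (@le_trans _ _ (\sum_i v n i ^+ 2 * (e' / (Cg + 1)))); last first.
    by rewrite -mulr_suml v2// mul1r.
  apply: ler_sum => i _; rewrite mulrCA ler_wpM2l ?sqr_ge0//.
  rewrite -(ler_pM2l nR); apply: le_trans (_ : (k n * (p n)%:R) ^+ 2 * l2norm (x n i) ^+ 2 <= _).
    rewrite (_ : n%:R * _ = (k n * (p n)%:R) * l2norm (x n i) ^+ 2).
      by rewrite ler_wpM2r ?sqr_ge0// expr2 ler_peMl// mulr_ge0// ltW.
    by field; rewrite gt_eqF.
  by rewrite [leRHS]mulrC; exact: hx.
- move=> n w /= hw t ht; apply: le_trans hw; rewrite ler_wpM2l//.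
  by have [_ _ _] := hV n; apply.
Qed.

(** Both errors of [linearized_score] are of smaller order than the deviation: the
    fluctuation by the Cauchy-Schwarz inequality and [curvature_small], the remainder
    because it is quadratic with negligible weights. *)
Let score_linear (e : R) : 0 < e -> whp P (fun n => [set w |
  `|H n w (s n w) - m (s n w) * Y n w / s n w| <= e]).
Proof.
move=> e0; have [tau tau0 upper] := design_upper.
have s02 : 0 < s0 / 2 by rewrite divr_gt0.
have Kt : 0 < K * tau + 1 by rewrite ltr_wpDl// mulr_ge0// ltW.
have [e1 e1E] : exists e1, e1 = e * (s0 / 2) ^+ 2 / (2 * (K * tau + 1)) by eexists.
have e10 : 0 < e1 by rewrite e1E divr_gt0 ?mulr_gt0 ?exprn_gt0.
have e20 : 0 < e * (s0 / 2) / 2 by rewrite divr_gt0 ?mulr_gt0.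
have e2 : 0 < (e * (s0 / 2) / 2) ^+ 2 by rewrite exprn_gt0.
apply: (whp_near (whpI (whpI (s_cvg s02) rate) (curvature_small e2))).
apply: filterS (filterI (filterI (nbhs_infty_gt 0) kp_ge1) (weight_small e10)).
move=> n [[n0 kp1] vsmall] w [[/= F1 F2] F3].
have nR : 0 < n%:R :> R by rewrite ltr0n.
have kp0 : 0 < k n * (p n)%:R by lra.
have [s1 _] := range F1; have sp : 0 < s n w by lra.
have sV : (s n w)^-1 <= (s0 / 2)^-1 by rewrite lef_pV2.
have vw i : `|v n i| <= e1 / (k n * (p n)%:R).
  by rewrite ler_pdivlMr// mulrC vsmall.
apply: le_trans (linearized_score _ K0 sp psi_psi' psi'_lip vw (critical n w)) _.
rewrite [leRHS]splitr lerD//.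
  set S := \sum_i _.
  have SE : S = \sum_j b n w j 0 *
      (\sum_i v n i * x n i j 0 * (psi' (u n i w / s n w) - m (s n w))).
    rewrite /S; under eq_bigr do rewrite dotvE mulr_sumr mulr_suml.
    rewrite exchange_big; apply: eq_bigr => j _; rewrite mulr_sumr; apply: eq_bigr => i _; ring.
  have Sb : `|S| <= e * (s0 / 2) / 2.
    rewrite -(@ler_pXn2r _ 2 isT) ?nnegrE ?(ltW e20)// real_normK ?num_real// SE.
    apply: le_trans (cauchy_schwarz_sum _ _) _; rewrite -sqr_l2norm.
    apply: le_trans (F3 _ F1); rewrite ler_wpM2r//.
    by apply: sumr_ge0 => j _; exact: sqr_ge0.
  apply: (@le_trans _ _ ((s0 / 2)^-1 * (e * (s0 / 2) / 2))).
    by rewrite ler_pM// invr_ge0 ltW.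
  by apply: eq_ler; field; rewrite gt_eqF.
have up : \sum_i dotv (x n i) (b n w) ^+ 2 <= tau * (k n * (p n)%:R).
  apply: le_trans (upper n (b n w) n0) _; rewrite -mulrA ler_pM2l//.
  apply: le_trans (ler_wpM2l (ltW nR) F2) _.
  by apply: eq_ler; field; rewrite gt_eqF.
apply: (@le_trans _ _ (K * (s0 / 2)^-1 ^+ 2 * (e1 / (k n * (p n)%:R)) * (tau * (k n * (p n)%:R)))).
  apply: ler_pM => //.
  - by rewrite !mulr_ge0 ?invr_ge0 ?(ltW e10) ?(ltW kp0) ?exprn_ge0 ?invr_ge0 ?(ltW sp).
  - by apply: sumr_ge0 => i _; exact: sqr_ge0.
  - rewrite ler_wpM2r ?divr_ge0 ?(ltW e10) ?(ltW kp0)// ler_wpM2l//.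
    by rewrite lerXn2r// nnegrE invr_ge0 ltW.
have -> : K * (s0 / 2)^-1 ^+ 2 * (e1 / (k n * (p n)%:R)) * (tau * (k n * (p n)%:R)) =
   K * tau / (K * tau + 1) * (e / 2).
  by rewrite e1E; field; rewrite !gt_eqF//; move: kp0; rewrite pmulr_rgt0.
by rewrite ler_piMl ?divr_ge0 ?(ltW e0)// ler_pdivrMr// mul1r lerDl.
Qed.

Let psi_mean0 n (i : 'I_n) t : mean P (fun w => psi (u n i w / t)) = 0.
Proof. by rewrite (mean_u i (mpsis t))//; exists K. Qed.

(** The oscillation of the score over a window of scales is proportional to the
    width of the window, which is arbitrary. *)
Let score_scale (e : R) : 0 < e -> whp P (fun n => [set w |
  `|H n w (s n w) - H n w s0| <= e]).
Proof.
move=> e0; apply: whp_approx => h h0.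
have e2 : 0 < e ^+ 2 by rewrite exprn_gt0.
have he : 0 < h * e ^+ 2 by rewrite mulr_gt0.
have K50 : 0 < 50 * K ^+ 2 + 1 by rewrite ltr_wpDl// mulr_ge0// sqr_ge0.
pose de := Num.min (Num.min (s0 / 2) 1) (h * e ^+ 2 / (50 * K ^+ 2 + 1)).
have de0 : 0 < de by rewrite !lt_min ltr01 !divr_gt0.
have de1 : de <= s0 / 2 by rewrite !ge_min lexx.
have de2 : de <= 1 by rewrite !ge_min lexx orbT.
have de3 : de * (50 * K ^+ 2 + 1) <= h * e ^+ 2 by rewrite -ler_pdivlMr// !ge_min lexx !orbT.
exists (fun n => [set w | `|s n w - s0| <= de]); first exact: s_cvg.
apply: filterS (nbhs_infty_gt 0) => n n0.
have in_range (t : R) : `|t - s0| <= de -> s0 / 2 <= t /\ t <= 2 * s0.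
  by move=> ht; apply: range; exact: le_trans de1.
have [W [bW W0 mW hW]] := @scale_process_bound _ _ _ P n (u n) (@indu n)
  (fun y t => psi (y / t)) s0 de K K (ltW de0) K0 mpsis (fun y t => psiK _) (@psi_mean0 n)
  (fun y t t' ht ht' => psi_scale y (in_range t ht).1 (in_range t ht).2
    (in_range t' ht').1 (in_range t' ht').2) unit (fun=> v n).
exists [set w | e ^+ 2 <= W w]; split.
- exact: measurable_superlevel bW.1.
- move=> w [/= hs /negP]; rewrite -ltNge => /ltW hWe.
  have := hW w _ hs; rewrite big_const card_unit/= addr0 => hHW.
  rewrite -(@ler_pXn2r _ 2 isT) ?nnegrE ?(ltW e0)// real_normK ?num_real//.
  exact: le_trans hWe.
- apply: le_trans (markov_mean P bW W0 e2) _; rewrite lee_fin ler_pdivrMr//.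
  apply: le_trans mW _; rewrite big_const card_unit/= addr0 v2// mulr1.
  apply: le_trans de3; have : de ^+ 2 <= de by rewrite expr2 ler_piMr// ltW.
  have := sqr_ge0 K; move: (K ^+ 2) => K2 K20 dd.
  have := ler_wpM2l K20 dd; lra.
Qed.

Let slope_cvg (e : R) : 0 < e -> whp P (fun n => [set w |
  [/\ 0 < s n w, 0 < m (s n w) & `|s n w / m (s n w) - s0 / m s0| <= e]]).
Proof.
move=> e0; have Ks : 0 < m s0 + s0 * K by rewrite ltr_wpDr// mulr_ge0// ltW.
pose de := Num.min (Num.min (s0 / 2) (m s0 / (2 * (K + 1))))
  (e * m s0 ^+ 2 / 2 / (m s0 + s0 * K)).
have K1 : 0 < K + 1 by rewrite ltr_wpDl.
have de0 : 0 < de by rewrite !lt_min !divr_gt0 ?mulr_gt0 ?exprn_gt0.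
have de1 : de <= s0 / 2 by rewrite !ge_min lexx.
have de2 : de * (2 * (K + 1)) <= m s0.
  by rewrite -ler_pdivlMr ?mulr_gt0// !ge_min lexx orbT.
have de3 : de * (m s0 + s0 * K) <= e * m s0 ^+ 2 / 2.
  by rewrite -ler_pdivlMr// !ge_min lexx orbT.
apply: (whpS (s_cvg de0)) => n w /= hs.
have hs2 : `|s n w - s0| <= s0 / 2 by exact: le_trans de1.
have [s1 _] := range hs2; have sp : 0 < s n w by lra.
have ml : `|m (s n w) - m s0| <= K * `|s n w - s0|.
  by apply: m_lip => //; rewrite subrr normr0 divr_ge0// ltW.
have mld : `|m (s n w) - m s0| <= K * de by apply: le_trans ml _; rewrite ler_wpM2l.
have mhalf : m s0 / 2 <= m (s n w).
  by move: mld; rewrite ler_norml => /andP[mm _]; lra.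
have mp : 0 < m (s n w) by apply: lt_le_trans mhalf; rewrite divr_gt0.
split => //.
have -> : s n w / m (s n w) - s0 / m s0 =
    ((s n w - s0) * m s0 - s0 * (m (s n w) - m s0)) / (m (s n w) * m s0).
  by field; rewrite !gt_eqF.
have mm0 : 0 < m (s n w) * m s0 by rewrite mulr_gt0.
rewrite normrM normfV (gtr0_norm mm0) ler_pdivrMr//.
apply: le_trans (ler_normB _ _) _; rewrite !normrM (gtr0_norm m0) (gtr0_norm s00).
apply: (@le_trans _ _ (de * (m s0 + s0 * K))).
  have := ler_wpM2l (ltW s00) mld; have := ler_wpM2r (ltW m0) hs; lra.
apply: le_trans de3 _; have := ler_wpM2l (ltW (mulr_gt0 e0 m0)) mhalf; lra.
Qed.

(** After the random scale has been replaced by its limit in the slope and in the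
    score, the estimator is a weighted sum of independent variables. *)
Theorem linearization (e : R) : 0 < e -> whp P (fun n => [set w |
  `|Y n w - \sum_i v n i * (s0 / m s0 * psi (u n i w / s0))| <= e]).
Proof.
move=> e0; apply: whp_approx => h h0.
have K21 : 0 < K ^+ 2 + 1 by rewrite ltr_wpDl// sqr_ge0.
(* the score at [s0] exceeds [A] with probability at most [h] *)
have [A AE] : exists A, A = Num.sqrt ((K ^+ 2 + 1) / h) by eexists.
have A0 : 0 < A by rewrite AE sqrtr_gt0 divr_gt0.
have A2 : A ^+ 2 = (K ^+ 2 + 1) / h by rewrite AE sqr_sqrtr// divr_ge0// ltW.
have sm0 : 0 < s0 / m s0 by rewrite divr_gt0.
have [L LE] : exists L, L = s0 / m s0 + 1 by eexists.
have L0 : 0 < L by lra.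
have eL : 0 < e / (4 * L) by rewrite divr_gt0// mulr_gt0.
have eA : 0 < Num.min 1 (e / (2 * A)) by rewrite lt_min ltr01 divr_gt0// mulr_gt0.
have close := whpI (whpI (score_linear eL) (score_scale eL)) (slope_cvg eA).
apply: (ex_intro2 _ _ _ close).
have bH n t : bdmeas (fun w => H n w t).
  apply: bdmeas_sum => i _; apply: bdmeasZ; split; last by exists K.
  exact: (measurableT_comp (mpsis t)).
apply: filterS (nbhs_infty_gt 0) => n n0.
exists [set w | A ^+ 2 <= H n w s0 ^+ 2]; split.
- exact: measurable_superlevel (bdmeasX 2 (bH n s0)).1.
- move=> w [[[/= F1 F2] [sp mp F3]] /negP]; rewrite -ltNge => HA.
  have HA' : `|H n w s0| <= A.
    rewrite -(@ler_pXn2r _ 2 isT) ?nnegrE ?(ltW A0)// real_normK ?num_real//.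
    exact: ltW.
  have -> : \sum_i v n i * (s0 / m s0 * psi (u n i w / s0)) = s0 / m s0 * H n w s0.
    by rewrite /H mulr_sumr; apply: eq_bigr => i _; rewrite mulrCA.
  have [r rE] : exists r, r = s n w / m (s n w) by eexists.
  rewrite -rE in F3.
  have F3a : `|r - s0 / m s0| <= 1 by apply: le_trans F3 _; rewrite ge_min lexx.
  have F3b : `|r - s0 / m s0| <= e / (2 * A) by apply: le_trans F3 _; rewrite ge_min lexx orbT.
  have r0 : 0 <= r by rewrite rE divr_ge0// ltW.
  have rL : r <= L by move: F3a; rewrite ler_norml => /andP[_ ?]; lra.
  have -> : Y n w - s0 / m s0 * H n w s0 =
     - (r * (H n w (s n w) - m (s n w) * Y n w / s n w)) +
     r * (H n w (s n w) - H n w s0) + (r - s0 / m s0) * H n w s0.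
    by rewrite rE; field; rewrite !gt_eqF.
  apply: le_trans (ler_normD _ _) _.
  apply: le_trans (lerD (ler_normD _ _) (lexx _)) _; rewrite normrN !normrM (ger0_norm r0).
  have a1 := ler_pM r0 (normr_ge0 _) rL F1.
  have a2 := ler_pM r0 (normr_ge0 _) rL F2.
  have a3 := ler_pM (normr_ge0 _) (normr_ge0 _) F3b HA'.
  have a4 : L * (e / (4 * L)) = e / 4 by field; rewrite gt_eqF.
  have a5 : e / (2 * A) * A = e / 2 by field; rewrite gt_eqF.
  rewrite a4 in a1 a2; rewrite a5 in a3.
  apply: le_trans (lerD (lerD a1 a2) a3) _; lra.
- apply: le_trans (markov_mean P (bdmeasX 2 (bH n s0)) (fun w => sqr_ge0 _) _) _.
    by rewrite exprn_gt0.
  rewrite lee_fin ler_pdivrMr ?exprn_gt0//.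
  have := mean_sqr_sum_indep (@indu n) (v n) (fun i => mpsis s0) (fun i y => psiK _)
    (fun i => psi_mean0 i s0).
  move=> /le_trans; apply; rewrite v2// mulr1 A2 mulrCA divff ?gt_eqF// mulr1.
  by rewrite lerDl.
Qed.

End linearization.

(** * Loss function and direction of projection *)

Lemma is_derive_derive1 (R : realType) (f : R -> R) : (forall t, derivable f t 1) ->
  forall t : R, is_derive t 1 f (derive1 f t).
Proof. by move=> df t; rewrite derive1E; exact: derivableP. Qed.

Section bounded_loss.
Variables (R : realType) (rho : R -> R).
Hypotheses (hrho : is_rho_function rho) (brho : bounded_fun rho).

Lemma rho_function_ge0 t : 0 <= rho t.
Proof. by have [_ mono rho0 _ _] := hrho; rewrite -rho0; apply: mono; rewrite normr0. Qed.

Lemma rho_function_lim : rho t @[t --> +oo] --> (1 : R).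
Proof. by have [_ _ _ _] := hrho; apply. Qed.

Lemma rho_function_le1 t : rho t <= 1.
Proof.
have [[even _] mono _ _ _] := hrho.
apply: (cvgr_to_ge rho_function_lim); near=> v; apply: mono.
rewrite [leRHS]ger0_norm; first by near: v; exact: nbhs_pinfty_ge.
by near: v; apply: nbhs_pinfty_ge; exact: num_real.
Unshelve. all: by end_near. Qed.

(** The loss grows strictly as long as it stays below its supremum. *)
Lemma rho_function_strict : exists2 e : R, 0 < e &
  forall t v, `|t| < e -> `|t| < `|v| -> rho t < rho v.
Proof.
have [[even cont] mono rho0 strict _] := hrho.
have lim1 : lim ((rho t)%:E @[t --> +oo%R]) = 1%:E.
  by apply/cvg_lim => //; apply: cvg_EFin rho_function_lim; exact: nearW.
have rho_norm t : rho `|t| = rho t by apply/eqP; rewrite eq_le !mono ?normr_id.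
have /cvgrPdist_lt/(_ 1 ltr01)/nbhs_ballP[e /= e0 he] := cont 0.
exists e => // t v te tv; have [v1|v1] := ltP (rho v) 1.
  rewrite -rho_norm -[ltRHS]rho_norm; apply: strict => //.
  by rewrite rho_norm lim1 lte_fin.
apply: lt_le_trans v1; have := he t; rewrite /ball/= sub0r normrN rho0 sub0r normrN => /(_ te).
exact: le_lt_trans (ler_norm _).
Qed.

End bounded_loss.

Lemma sum_dotv_Sigma (R : realType) n p (x : 'I_n -> 'cV[R]_p) (z z' : 'cV[R]_p) : (0 < n)%N ->
  \sum_i dotv (x i) z * dotv (x i) z' = n%:R * dotv z (Sigma_mx x *m z').
Proof.
move=> n0; rewrite /Sigma_mx -scalemxAl dotvZr mulrA divff ?mul1r ?pnatr_eq0 -?lt0n//.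
rewrite mulmx_suml dotv_sumr; apply: eq_bigr => i _.
rewrite -mulmxA (_ : (x i)^T *m z' = (dotv (x i) z')%:M); last first.
  by apply/matrixP => j j'; rewrite [RHS]mxE !ord1 eqxx mulr1n.
by rewrite mul_mx_scalar dotvZr [RHS]mulrC (dotvC z).
Qed.

(** Normalization of the direction in which the estimator is projected. *)
Lemma projection_direction (R : realType) n p (x : 'I_n -> 'cV[R]_p) (a : 'cV[R]_p) (r : R) :
  (0 < n)%N -> Sigma_mx x \in unitmx -> 0 < r -> r ^+ 2 = quad_form (invmx (Sigma_mx x)) a ->
  let c := r^-1 *: (invmx (Sigma_mx x) *m a) in
  \sum_i dotv (x i) c ^+ 2 = n%:R /\
  forall z, \sum_i dotv (x i) c * dotv (x i) z = n%:R * (r^-1 * dotv a z).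
Proof.
move=> n0 Su r0 r2 c.
have Sc : Sigma_mx x *m c = r^-1 *: a by rewrite /c -scalemxAr mulmxA mulmxV// mul1mx.
have cz z : \sum_i dotv (x i) c * dotv (x i) z = n%:R * (r^-1 * dotv a z).
  under eq_bigr do rewrite mulrC.
  by rewrite sum_dotv_Sigma// Sc dotvZr (dotvC z).
split => //; under eq_bigr do rewrite expr2.
rewrite cz /c dotvZr (_ : dotv a _ = r ^+ 2).
  by field; rewrite gt_eqF.
by rewrite r2 /quad_form /dotv mulmxA.
Qed.

(** * Scale, leverage and smoothness of the loss *)

Lemma cvg_in_probability_whp d (T : measurableType d) (R : realType) (P : probability T R)
    (X : nat -> {RV P >-> R}) (c : R) :
  cvg_in_probability P (fun n => X n) c ->
  forall e : R, 0 < e -> whp P (fun n => [set w | `|X n w - c| <= e]).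
Proof.
move=> Xc e e0; pose B n := [set w | e <= `|X n w - c|].
have mB n : measurable (B n).
  apply: measurable_superlevel; apply: measurableT_comp => //.
  exact: measurable_funB.
have lim : fine (P (B n)) @[n --> \oo] --> (0 : R).
  by apply: fine_cvg; exact: Xc.
have PB : \forall n \near \oo, (P (B n) <= (fine (P (B n)))%:E)%E.
  by apply: nearW => n; rewrite fineK// fin_num_measure.
apply: (whpS (whp_cvg0 mB PB lim)) => n w /= /negP; rewrite -ltNge.
exact: ltW.
Qed.

Lemma leverage_negligible (R : realType) (p : nat -> nat) (x : forall n, 'I_n -> 'cV[R]_(p n)) :
  (forall n, (0 < n)%N -> (0 < p n)%N) ->
  (fun n => \big[Num.max/0]_(i < n) l2norm (@x n i) ^+ 2)
    =o_\oo (fun n => n%:R / (p n)%:R ^+ 2 : R) ->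
  forall e : R, 0 < e -> \forall n \near \oo, forall i,
    (p n)%:R ^+ 2 * l2norm (@x n i) ^+ 2 <= e * n%:R.
Proof.
move=> p0 /eqoP h e e0; apply: filterS2 (nbhs_infty_gt 0) (h e e0) => n n0 hn i.
have pR : 0 < (p n)%:R ^+ 2 :> R by rewrite exprn_gt0// ltr0n p0.
rewrite -ler_pdivlMl// mulrC -mulrA.
have : l2norm (x n i) ^+ 2 <= \big[Num.max/0]_(i < n) l2norm (x n i) ^+ 2.
  exact: (le_bigmax _ (fun i => l2norm (x n i) ^+ 2)).
move=> /le_trans; apply; apply: le_trans (ler_norm _) (le_trans hn _).
by rewrite ger0_norm// divr_ge0// ltW.
Qed.

Lemma measurable_dotv d (T : measurableType d) (R : realType) p (a beta : 'cV[R]_p)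
    (b : T -> 'cV[R]_p) : (forall j, measurable_fun setT (fun w => b w j 0)) ->
  measurable_fun setT (fun w => dotv a (b w - beta)).
Proof.
move=> mb; under eq_fun do rewrite dotvE.
apply: measurable_sum => j; under eq_fun do rewrite !mxE.
by apply: measurable_funM => //; exact: measurable_funB.
Qed.

Section derivatives_of_loss.
Variables (R : realType) (rho : R -> R) (s0 : R).
Hypothesis s00 : 0 < s0.
Hypothesis C3 : continuously_differentiable 3 rho.
Let psi := derive1 rho.
Hypothesis b1 : [/\ bounded_fun psi, bounded_fun (derive1 psi) & bounded_fun (derive1n 2 psi)].
Hypothesis b2 : [/\ bounded_fun (fun t => t * psi t),
  bounded_fun (fun t => t * derive1 psi t) & bounded_fun (fun t => t * derive1n 2 psi t)].

Lemma loss_derivative (t : R) : is_derive t 1 rho (psi t).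
Proof. by apply: is_derive_derive1; exact: (C3.1 0%N). Qed.

Lemma score_derivative (t : R) : is_derive t 1 psi (derive1 psi t).
Proof. by apply: is_derive_derive1; exact: (C3.1 1%N). Qed.

Lemma curvature_derivative (t : R) : is_derive t 1 (derive1 psi) (derive1n 2 psi t).
Proof. by apply: is_derive_derive1; exact: (C3.1 2%N). Qed.

(** One constant for all the bounds; the multiple absorbs the change of scale. *)
Lemma loss_bounds : exists K : R, [/\ 0 <= K, forall t, `|psi t| <= K,
  forall t, `|t * psi t| <= K, forall t, `|derive1 psi t| <= K &
  [/\ forall t v, `|derive1 psi t - derive1 psi v| <= K * `|t - v|,
   forall y t t' : R, s0 / 2 <= t -> t <= 2 * s0 -> s0 / 2 <= t' -> t' <= 2 * s0 ->
     `|psi (y / t) - psi (y / t')| <= K * `|t - t'| &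
   forall y t t' : R, s0 / 2 <= t -> t <= 2 * s0 -> s0 / 2 <= t' -> t' <= 2 * s0 ->
     `|derive1 psi (y / t) - derive1 psi (y / t')| <= K * `|t - t'|]].
Proof.
have [/bounded_fun_le[k1 k10 h1] /bounded_fun_le[k2 k20 h2] /bounded_fun_le[k3 k30 h3]] := b1.
have [/bounded_fun_le[k4 k40 h4] /bounded_fun_le[k5 k50 h5] /bounded_fun_le[k6 k60 h6]] := b2.
have [k kE] : exists k, k = k1 + k2 + k3 + k4 + k5 + k6 by eexists.
have k0 : 0 <= k by lra.
have k80 : 0 <= 8 * k / s0 by rewrite !mulr_ge0// invr_ge0 ltW.
have le h : h <= k -> h <= k + 8 * k / s0 by move=> /le_trans; apply; rewrite lerDl.
exists (k + 8 * k / s0); split; first exact: addr_ge0.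
- by move=> t; apply: le; apply: le_trans (h1 t) _; lra.
- by move=> t; apply: le; apply: le_trans (h4 t) _; lra.
- by move=> t; apply: le; apply: le_trans (h2 t) _; lra.
split.
- apply: lipschitz_of_derive curvature_derivative _ => t; apply: le.
  by apply: le_trans (h3 t) _; lra.
- move=> y t t' a1 a2 a3 a4.
  apply: le_trans (lipschitz_scale s00 k0 score_derivative _ y a1 a2 a3 a4) _.
    by move=> c; apply: le_trans (h5 c) _; lra.
  by rewrite ler_wpM2r// lerDr.
- move=> y t t' a1 a2 a3 a4.
  apply: le_trans (lipschitz_scale s00 k0 curvature_derivative _ y a1 a2 a3 a4) _.
    by move=> c; apply: le_trans (h6 c) _; lra.
  by rewrite ler_wpM2r// lerDr.
Qed.

Lemma continuous_curvature : continuous (derive1 psi).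
Proof.
move=> t; apply: differentiable_continuous; apply/derivable1_diffP.
by have [] := curvature_derivative t.
Qed.

Lemma continuous_score : continuous psi.
Proof.
move=> t; apply: differentiable_continuous; apply/derivable1_diffP.
by have [] := score_derivative t.
Qed.

End derivatives_of_loss.

(** * The mean loss of symmetric errors *)

Section symmetric_errors.
Context d (T : measurableType d) (R : realType) (P : probability T R).
Variables (X : {RV P >-> R}) (F f : R -> R).
Hypothesis XF : forall r, cdf X r = (F r)%:E.
Hypothesis Ff : is_density F f.
Hypothesis f_even : forall t, f (- t) = f t.
Hypothesis f_mono : forall t v, `|t| <= `|v| -> f v <= f t.
Hypothesis f_strict : exists2 e : R, 0 < e &
  forall t v, `|t| < `|v| -> `|v| < e -> f v < f t.
Variables (rho psi : R -> R) (K s0 : R).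
Hypothesis s00 : 0 < s0.
Hypotheses (hrho : is_rho_function rho) (brho : bounded_fun rho).
Hypothesis K0 : 0 <= K.
Hypothesis rho_psi : forall c : R, is_derive c 1 rho (psi c).
Hypothesis cpsi : continuous psi.
Hypothesis psiK : forall t, `|psi t| <= K.

Let mf : measurable_fun setT f. Proof. by have [] := Ff. Qed.
Let f0 t : 0 <= f t. Proof. by have [_ ->] := Ff. Qed.
Let Xf r : cdf X r = (\int[lebesgue_measure]_(t in `]-oo, r]) (f t)%:E)%E.
Proof. by have [_ _ h] := Ff; rewrite XF h. Qed.

Lemma mean_score (t : R) : mean P (fun w => psi (X w / t)) = 0.
Proof.
apply: (mean_odd mf f0 Xf f_even (h := fun y => psi (y / t))).
- by apply: (measurableT_comp (continuous_measurable_fun cpsi)); exact: measurable_funM.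
- by exists K.
- move=> y; rewrite mulNr; apply: (derive_even rho_psi).
  by have [[]] := hrho.
Qed.

(** The score cannot vanish near 0, where the loss increases strictly. *)
Lemma mean_score_sqr_gt0 : 0 < mean P (fun w => psi (X w / s0) ^+ 2).
Proof.
have [e e0 he] := mean_gt0_near mf f0 Xf f_strict.
have [e' e'0 strict] := rho_function_strict hrho brho.
apply: (he (fun y => psi (y / s0) ^+ 2)).
- have cs : continuous (fun y : R => psi (y / s0)).
    move=> y; apply: (@continuous_comp R R R (fun z => z / s0) psi y); last exact: cpsi.
    exact: mulrr_continuous.
  move=> y; apply: (@continuous_comp R R R (fun y => psi (y / s0)) (fun z => z ^+ 2) y).
    exact: cs.
  exact: exprn_continuous.
- exists (K ^+ 2) => y; rewrite normrX lerXn2r ?nnegrE//.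
- by move=> y; exact: sqr_ge0.
- pose y := e / 2 / s0.
  have y0 : 0 < y by rewrite !divr_gt0.
  have [c cy] := mvt_between (ltW y0) (fun c _ => rho_psi c).
  rewrite subr0 => yE; exists (c * s0).
    rewrite normrM (gtr0_norm s00) -ltr_pdivlMr//.
    move: cy => /andP[c0 cy]; rewrite ger0_norm//; apply: le_lt_trans cy _.
    by rewrite /y ltr_pM2r ?invr_gt0//; lra.
  rewrite mulfK ?gt_eqF// lt_neqAle sqr_ge0 andbT eq_sym sqrf_eq0.
  apply/negP => /eqP c0; have := strict 0 y.
  by rewrite normr0 normr_gt0 gt_eqF// => /(_ e'0 isT); rewrite -subr_gt0 yE c0 mul0r ltxx.
Qed.

Let rs (y : R) := rho (y / s0).

Let rs_lip y z : `|rs y - rs z| <= K / s0 * `|y - z|.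
Proof.
apply: le_trans (lipschitz_of_derive rho_psi psiK _ _) _.
by rewrite -mulrBl normrM (gtr0_norm (x := s0^-1)) ?invr_gt0// mulrA mulrAC.
Qed.

Let mrs : measurable_fun setT rs.
Proof.
have [[_ crho] _ _ _ _] := hrho.
by apply: (measurableT_comp (continuous_measurable_fun crho)); exact: measurable_funM.
Qed.

Let rs_ge0 y : 0 <= rs y. Proof. exact: (rho_function_ge0 hrho). Qed.
Let rs_le1 y : rs y <= 1. Proof. exact: (rho_function_le1 hrho brho). Qed.
Let rs_bnd : exists K : R, forall y, `|rs y| <= K.
Proof. by exists 1 => y; rewrite ger0_norm. Qed.
Let rs_even y : rs (- y) = rs y.
Proof. by have [[h _] _ _ _ _] := hrho; rewrite /rs mulNr h. Qed.
Let rs_mono t v : `|t| <= `|v| -> rs t <= rs v.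
Proof. by have [_ h _ _ _] := hrho => tv; apply: h; rewrite !normrM ler_wpM2r. Qed.

Lemma mean_loss_translate_ge t : mean P (fun w => rs (X w)) <= mean P (fun w => rs (X w - t)).
Proof. exact: (mean_translate_ge mf f0 Xf f_mono mrs rs_ge0 rs_bnd rs_even rs_mono). Qed.

Lemma mean_loss_translate_gap (c : R) : 0 < c -> exists2 kappa : R, 0 < kappa &
  forall t, c <= `|t| ->
  mean P (fun w => rs (X w)) + kappa <= mean P (fun w => rs (X w - t)).
Proof.
apply: (mean_translate_gap_unbounded mrs rs_ge0 rs_le1 rs_even rs_mono) => [|c' K' c'0 cK].
  have lim := rho_function_lim hrho brho.
  apply/cvgrPdist_le => e e0; have /cvgrPdist_le/(_ e e0)[A [Ar hA]] := lim.
  exists (A * s0); split; first exact: num_real.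
  by move=> y Ay; apply: hA; rewrite ltr_pdivlMr.
apply: (mean_translate_gap mf f0 Xf f_mono f_strict mrs rs_ge0 rs_bnd rs_even rs_mono) => //.
  have [e e0 strict] := rho_function_strict hrho brho.
  exists (e * s0) => [|t v te tv]; first exact: mulr_gt0.
  have si : 0 < s0^-1 by rewrite invr_gt0.
  by apply: strict; rewrite !normrM (gtr0_norm si) ?ltr_pM2r// ltr_pdivrMr.
by exists (K / s0).
Qed.

End symmetric_errors.

(** * Asymptotic normality *)

Theorem theorem4p5 (R : realType) (d : measure_display) (T : measurableType d)
  (P : probability T R)
  (* the sequence of linear models; row n has the observations i < n *)
  (p : nat -> nat)
  (x : forall n, 'I_n -> 'cV[R]_(p n))
  (beta0 : forall n, 'cV[R]_(p n))
  (u : forall n, 'I_n -> {RV P >-> R})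
  (y : forall n, 'I_n -> T -> R)
  (hy : forall n i w, y n i w = dotv (x n i) (beta0 n) + u n i w)
  (hSigma : forall n, (0 < n)%N -> Sigma_mx (x n) \in unitmx)
  (* errors, with common distribution function F0; u0 is a generic error *)
  (F0 : R -> R)
  (hindep : forall n, mutually_independent (u n))
  (hF0 : forall n i r, cdf (u n i) r = (F0 r)%:E)
  (u0 : {RV P >-> R})
  (hu0 : forall r, cdf u0 r = (F0 r)%:E)
  (* random scales *)
  (s : nat -> {RV P >-> R})
  (hs : forall n w, 0 < s n w)
  (s0 : R) (hs0 : 0 < s0)
  (hscvg : cvg_in_probability P (fun n => s n) s0)
  (* loss and M-estimator *)
  (rho1 psi1 : R -> R)
  (hpsi1 : psi1 = derive1 rho1)
  (betahat : forall n, T -> 'cV[R]_(p n))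
  (hbetahat_meas : forall n j, measurable_fun setT (fun w => betahat n w j 0))
  (hbetahat : forall n w,
     is_argmin (fun beta : 'cV[R]_(p n) =>
       \sum_(i < n) rho1 ((y n i w - dotv (x n i) beta) / s n w))
       (betahat n w))
  (* (1) *)
  (hrho1 : is_rho_function rho1)
  (hrho1_bounded : bounded_fun rho1)
  (hrho1_C3 : continuously_differentiable 3 rho1)
  (hpsi1_bounded : [/\ bounded_fun psi1, bounded_fun (derive1 psi1)
                     & bounded_fun (derive1n 2 psi1)])
  (htpsi1_bounded : [/\ bounded_fun (fun t => t * psi1 t),
                        bounded_fun (fun t => t * derive1 psi1 t)
                      & bounded_fun (fun t => t * derive1n 2 psi1 t)])
  (hpsi1_pos : (0 < 'E_P[fun w => derive1 psi1 (u0 w / s0)%R])%E)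
  (* (2) *)
  (f0 : R -> R)
  (hf0 : is_density F0 f0)
  (hf0_even : forall t, f0 (- t) = f0 t)
  (hf0_mono : forall t v, `|t| <= `|v| -> f0 v <= f0 t)
  (hf0_strict : exists2 e : R, 0 < e &
     forall t v, `|t| < `|v| -> `|v| < e -> f0 v < f0 t)
  (* (3) *)
  (hX2 : exists2 M : R, 0 < M & forall n, (0 < n)%N ->
     n%:R^-1 * \sum_(i < n) l2norm (x n i) ^+ 2 <= (p n)%:R * M)
  (hXmax : exists2 B : R, 0 < B & forall n i, l2norm (x n i) <= B * n%:R)
  (* (4) *)
  (htau : (ereal_sup [set (largest_eigenvalue (Sigma_mx (x n)))%:E
                     | n in [set n | (0 < n)%N]] < +oo)%E)
  (* (5) *)
  (heta : exists alpha : R, [/\ 0 < alpha, alpha < 1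
     & (0 < limn_einf (fun n => (eta (x n) alpha)%:E))%E])
  (* (6) *)
  (hlower : forall c : R, 0 < c -> exists a delta C : R,
     [/\ 0 < a, 0 < delta, 0 < C &
       forall n (beta z : 'cV[R]_(p n)), (0 < n)%N ->
         l2norm beta <= delta -> l2norm z = 1 ->
         let J := (slab (x n) beta c :&: slab (x n) z C)%SET in
         a * n%:R <= \sum_(i in J) dotv (x n i) z ^+ 2])
  (* (7) *)
  (hupper : forall c e : R, 0 < c -> 0 < e -> exists delta' C : R,
     [/\ 0 < delta', 0 < C &
       forall n (beta z : 'cV[R]_(p n)), (0 < n)%N ->
         l2norm beta <= delta' -> l2norm z = 1 ->
         let J := (slab (x n) beta c :&: slab (x n) z C)%SET in
         \sum_(i | i \notin J) dotv (x n i) z ^+ 2 <= e * n%:R])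
  (* (8) *)
  (hXmax_o : (fun n => \big[Num.max/0]_(i < n) l2norm (x n i) ^+ 2)
             =o_\oo (fun n => n%:R / (p n)%:R ^+ 2 : R))
  (* (9) *)
  (hp : (p n)%:R * ln n%:R / n%:R @[n --> \oo] --> (0 : R))
  (* direction and normalization *)
  (a : forall n, 'cV[R]_(p n))
  (ha : forall n, (0 < n)%N -> l2norm (a n) = 1)
  (r : nat -> R)
  (hr : forall n, (0 < n)%N ->
     0 < r n /\ r n ^+ 2 = quad_form (invmx (Sigma_mx (x n))) (a n)) :
  let a_psi := fine 'E_P[fun w => psi1 (u0 w / s0) ^+ 2] in
  let b_psi := fine 'E_P[fun w => derive1 psi1 (u0 w / s0)] in
  cvg_in_distribution P
    (fun n w => Num.sqrt n%:R * (r n)^-1 * dotv (a n) (betahat n w - beta0 n))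
    (normal_prob 0 (Num.sqrt (s0 ^+ 2 * (a_psi / b_psi ^+ 2)))).
Proof.
have p0 n : (0 < n)%N -> (0 < p n)%N.
  move=> n0; rewrite lt0n; apply/negP => /eqP pn; have := ha n n0.
  rewrite (_ : l2norm (a n) = 0) => [/eqP|]; first by rewrite eq_sym oner_eq0.
  rewrite l2normE big1 ?sqrtr0// => j _; exfalso; by case: j => j; rewrite pn.
have mean_u n i (h : R -> R) : measurable_fun setT h -> (exists K : R, forall y, `|h y| <= K) ->
    mean P (fun w => h (u n i w)) = mean P (fun w => h (u0 w)).
  by move=> mh bh; apply: mean_comp_cdf => // q; rewrite hF0 hu0.
have s_cvg := cvg_in_probability_whp hscvg.
rewrite hpsi1 in hpsi1_bounded htpsi1_bounded hpsi1_pos *; set psi := derive1 rho1.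
have rho_psi := loss_derivative hrho1_C3; have psi_psi' := score_derivative hrho1_C3.
have [K [K0 psiK tpsiK psi'K [psi'_lip psi_scale psi'_scale]]] :=
  loss_bounds hs0 hrho1_C3 hpsi1_bounded htpsi1_bounded.
have cpsi := continuous_score hrho1_C3.
have mpsi : measurable_fun setT psi := continuous_measurable_fun cpsi.
have mpsi' := continuous_measurable_fun (continuous_curvature hrho1_C3).
have mpsis t : measurable_fun setT (fun y : R => psi (y / t)).
  by apply: (measurableT_comp mpsi); exact: measurable_funM.
have mpsi's : measurable_fun setT (fun y : R => derive1 psi (y / s0)).
  by apply: (measurableT_comp mpsi'); exact: measurable_funM.
have mean_psi := mean_score hu0 hf0 hf0_even hrho1 rho_psi cpsi psiK.
have b_psi' : bdmeas (fun w => derive1 psi (u0 w / s0)).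
  by split; [exact: (measurableT_comp mpsi's)|exists K].
have b_psi2 : bdmeas (fun w => psi (u0 w / s0) ^+ 2).
  by apply: bdmeasX; split; [exact: (measurableT_comp (mpsis s0))|exists K].
rewrite (mean_expectation P b_psi') lte_fin in hpsi1_pos.
move=> a_psi b_psi.
have aE : a_psi = mean P (fun w => psi (u0 w / s0) ^+ 2).
  by rewrite /a_psi mean_expectation.
have bE : b_psi = mean P (fun w => derive1 psi (u0 w / s0)).
  by rewrite /b_psi mean_expectation.
have a0 : 0 < a_psi.
  rewrite aE; exact: (mean_score_sqr_gt0 hu0 hf0 hf0_strict hs0 hrho1 hrho1_bounded K0
    rho_psi cpsi psiK).
have b0 : 0 < b_psi by rewrite bE.
pose b n w := betahat n w - beta0 n.
have b_min n w (beta : 'cV[R]_(p n)) :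
    \sum_i rho1 ((u n i w - dotv (x n i) (b n w)) / s n w) <=
    \sum_i rho1 ((u n i w - dotv (x n i) beta) / s n w).
  have := hbetahat n w (beta + beta0 n).
  have resid i be : y n i w - dotv (x n i) (be + beta0 n) = u n i w - dotv (x n i) be.
    by rewrite hy dotvDr; ring.
  have bE' : betahat n w = b n w + beta0 n by rewrite subrK.
  by rewrite {1}bE'; under eq_bigr do rewrite resid; under [leRHS]eq_bigr do rewrite resid.
have rho_mono t v : `|t| <= `|v| -> rho1 t <= rho1 v by have [_ + _ _ _] := hrho1; apply.
have cons := consistency hindep mean_u hs0 s_cvg K0 rho_psi psiK tpsiK
  (rho_function_ge0 hrho1) (rho_function_le1 hrho1 hrho1_bounded) rho_mono
  (mean_loss_translate_ge hu0 hf0 hf0_mono s0 hrho1 hrho1_bounded)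
  (mean_loss_translate_gap hu0 hf0 hf0_mono hf0_strict hs0 hrho1 hrho1_bounded rho_psi psiK)
  (design_count hlower) (design_span hlower) hp b_min.
have hx := leverage_negligible p0 hXmax_o.
have [mu [mu0 mulim hmu]] : exists mu : nat -> R, [/\ forall n, 0 <= mu n,
    mu n @[n --> \oo] --> (0 : R) &
    forall n i, (p n)%:R ^+ 2 * l2norm (x n i) ^+ 2 / n%:R <= mu n].
  apply: (@uniform_bound_cvg0 R (fun n i => (p n)%:R ^+ 2 * l2norm (x n i) ^+ 2 / n%:R)).
  move=> e e0; apply: filterS2 (nbhs_infty_gt 0) (hx e e0) => n n0 h i.
  by rewrite ler_pdivrMr ?ltr0n.
have [k [k0 klim kmu]] := slow_growth mu0 mulim.
have b_min0 n w : \sum_i rho1 ((u n i w - dotv (x n i) (b n w)) / s n w) <=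
    \sum_i rho1 (u n i w / s n w).
  by have := b_min n w 0; under [leRHS]eq_bigr do rewrite dotv0r subr0.
have brate := rate hindep mean_u hs0 s_cvg K0 rho_psi psi_psi' mpsi' psiK psi'K psi'_lip
  psi_scale psi'_scale mean_psi hpsi1_pos p0 hp hx (design_upper hupper)
  (design_splitting (design_lower hlower) (design_tail hupper)) hX2 cons b_min0 k0 klim.
have kx (e : R) : 0 < e -> \forall n \near \oo, forall i,
    (k n * (p n)%:R) ^+ 2 * l2norm (x n i) ^+ 2 <= e * n%:R.
  move=> e0; apply: filterS2 (nbhs_infty_gt 0) (kmu e e0) => n n0 h i.
  have nR : 0 < n%:R :> R by rewrite ltr0n.
  rewrite -ler_pdivrMr//; apply: le_trans h; rewrite exprMn -2!mulrA ler_wpM2l ?sqr_ge0//.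
  by rewrite mulrA.
(* the direction in which the first order condition isolates [dotv (a n) (b n w)] *)
pose c n := (r n)^-1 *: (invmx (Sigma_mx (x n)) *m a n).
have c2 n : (0 < n)%N -> \sum_i dotv (x n i) (c n) ^+ 2 = n%:R.
  by move=> n0; have [r0 r2] := hr n n0; have [] := projection_direction n0 (hSigma n n0) r0 r2.
have cz n z : (0 < n)%N ->
    \sum_i dotv (x n i) (c n) * dotv (x n i) z = n%:R * ((r n)^-1 * dotv (a n) z).
  by move=> n0; have [r0 r2] := hr n n0; have [_] := projection_direction n0 (hSigma n n0) r0 r2.
have sqrtn n : (0 < n)%N -> 0 < Num.sqrt n%:R :> R by move=> n0; rewrite sqrtr_gt0 ltr0n.
pose v n i := dotv (x n i) (c n) / Num.sqrt n%:R.
have v2 n : (0 < n)%N -> \sum_i v n i ^+ 2 = 1.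
  move=> n0; rewrite /v; under eq_bigr do rewrite expr_div_n sqr_sqrtr//.
  by rewrite -mulr_suml c2// divff// pnatr_eq0 -lt0n.
have vx : exists2 Lc : R, 0 < Lc & forall n i, (0 < n)%N ->
    n%:R * v n i ^+ 2 <= Lc * l2norm (x n i) ^+ 2.
  have [al al0 hal] := design_lower_norm hlower.
  exists al^-1 => [|n i n0]; first by rewrite invr_gt0.
  have nR : 0 < n%:R :> R by rewrite ltr0n.
  rewrite /v expr_div_n sqr_sqrtr// mulrC divfK ?gt_eqF//.
  have := hal n (c n) n0; rewrite c2// mulrAC => cn.
  have {}cn : l2norm (c n) ^+ 2 <= al^-1.
    rewrite -(ler_pM2l al0) mulfV ?gt_eqF//.
    by rewrite -(ler_pM2r nR) mul1r.
  rewrite -[leLHS]real_normK ?num_real//.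
  apply: (@le_trans _ _ ((l2norm (x n i) * l2norm (c n)) ^+ 2)).
    by apply: lerXn2r; rewrite ?nnegrE ?mulr_ge0 ?l2norm_ge0// cauchy_schwarz_dotv.
  by rewrite exprMn mulrC ler_wpM2r// sqr_ge0.
have critical n w : \sum_i v n i * psi ((u n i w - dotv (x n i) (b n w)) / s n w) = 0.
  have := minimizer_critical (c n) K0 (hs n w) rho_psi
    (lipschitz_of_derive psi_psi' psi'K) (b_min n w).
  rewrite /v; under [X in _ -> X = _]eq_bigr do rewrite mulrAC.
  by rewrite -mulr_suml => ->; rewrite mul0r.
have lin := linearization hindep mean_u hs0 s_cvg K0 psi_psi' mpsi' psiK psi'K psi'_lip
  psi_scale psi'_scale mean_psi hpsi1_pos p0 (design_upper hupper) k0 klim brate kx v2 vx critical.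
have v0 (e : R) : 0 < e -> \forall n \near \oo, forall i, `|v n i| <= e.
  move=> e0; have [Lc Lc0 hv] := vx; have e'0 : 0 < e ^+ 2 / Lc by rewrite divr_gt0// exprn_gt0.
  apply: filterS2 (nbhs_infty_gt 0) (hx _ e'0) => n n0 h i.
  have nR : 0 < n%:R :> R by rewrite ltr0n.
  rewrite -(@ler_pXn2r _ 2 isT) ?nnegrE ?(ltW e0)// real_normK ?num_real// -(ler_pM2l nR).
  apply: le_trans (hv n i n0) _; rewrite -ler_pdivlMl//.
  apply: (@le_trans _ _ ((p n)%:R ^+ 2 * l2norm (x n i) ^+ 2)); last first.
    by apply: le_trans (h i) _; apply: eq_ler; ring.
  by rewrite ler_peMl ?sqr_ge0// exprn_ege1// ler1n p0.
pose Y n w := Num.sqrt n%:R * (r n)^-1 * dotv (a n) (b n w).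
have YE n w : Y n w = \sum_i v n i * dotv (x n i) (b n w).
  rewrite /Y; have [n0|n0] := posnP n.
    by rewrite n0 sqrtr0 !mul0r big1// => -[].
  under eq_bigr do rewrite /v mulrAC.
  have [r0 _] := hr n n0; have q0 := sqrtn n n0; have q2 := @sqr_sqrtr R n%:R (ler0n _ _).
  rewrite -mulr_suml cz//; set q := Num.sqrt _ in q0 q2 *; rewrite -q2.
  by field; rewrite !gt_eqF.
pose g (z : R) := s0 / b_psi * psi (z / s0).
have mg : measurable_fun setT g by exact: measurable_funM.
have s2 : 0 < s0 ^+ 2 * (a_psi / b_psi ^+ 2) by rewrite mulr_gt0 ?divr_gt0// exprn_gt0.
move=> t _.
suff : P [set w | Y n w <= t] @[n --> \oo] -->
    (normal_cdf (Num.sqrt (s0 ^+ 2 * (a_psi / b_psi ^+ 2))) t)%:E.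
  by rewrite EFin_normal_cdf.
apply: (@clt_normal_cdf _ _ _ P u v g (s0 / b_psi * K) _ Y hindep mg) => //.
- move=> z; rewrite normrM ger0_norm ?divr_ge0 ?(ltW hs0) ?(ltW b0)//.
  by rewrite ler_wpM2l// divr_ge0 ?(ltW hs0) ?(ltW b0).
- move=> n i; rewrite /g meanZ; last first.
    by split; [exact: (measurableT_comp (mpsis s0))|exists K].
  rewrite (mean_u n i (fun y => psi (y / s0)))//; last by exists K.
  by rewrite mean_psi mulr0.
- move=> n i; rewrite /g; under eq_fun do rewrite exprMn.
  rewrite meanZ; last first.
    by apply: bdmeasX; split; [exact: (measurableT_comp (mpsis s0))|exists K].
  rewrite (mean_u n i (fun y => psi (y / s0) ^+ 2)).
  + by rewrite -aE; field; rewrite gt_eqF.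
  + exact: measurable_funX.
  + by exists (K ^+ 2) => z; rewrite normrX lerXn2r ?nnegrE.
- by apply: filterS (nbhs_infty_gt 0) => n n0; exact: v2.
- by move=> n; apply: measurable_funM => //; exact: measurable_dotv.
- move=> e e0; apply: (whpS (lin e e0)) => n w /=; rewrite -YE.
  by rewrite /g bE.
Qed.
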